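(* Let $(n_t,n_p,n_m)$ be an admissible $3$-tuple and put $n_{\mathbb{R}}=n_t+n_p+n_m$. Suppose that one of the following holds: \begin{itemize} \item $n_{\mathbb{R}}\in\{0,2,4,6\}$; \item $n_{\mathbb{R}}=8$ and $n_t\neq 1$; \item $n_{\mathbb{R}}=10$ and $n_t\in\{5,6,7,8,9,10\}$. \end{itemize} Then there exist real twisted cubic curves $C_1,C_2$ in $\mathbb{P}^3(\mathbb{C})$ that realize $(n_t,n_p,n_m)$.
   Context: A twisted cubic curve in $\mathbb{P}^3(\mathbb{C})$ is a smooth rational curve of degree three in $\mathbb{P}^3(\mathbb{C})$; equivalently, it is the image of the standard twisted cubic $C_0=\{[s^3,s^2t,st^2,t^3] : [s,t]\in\mathbb{P}^1(\mathbb{C})\}$ under a projective linear transformation of $\mathbb{P}^3(\mathbb{C})$. A curve in $\mathbb{P}^3(\mathbb{C})$ (in particular a twisted cubic curve or a line) is real if it has a set of defining equations with real coefficients. A point of $\mathbb{P}^3(\mathbb{C})$ is real if it can be represented by real homogeneous coordinates. A line $\ell\subset\mathbb{P}^3(\mathbb{C})$ is a secant line of a twisted cubic $C$ if $C\cap\ell$ contains at least two distinct points (it then consists of exactly two points). A common secant line of $C_1,C_2$ is a line that is a secant line of both. For real twisted cubic curves $C_1,C_2$ and a common secant line $\ell$ that is a real line: \begin{itemize} \item $\ell$ is totally real if both $C_1\cap\ell$ and $C_2\cap\ell$ consist of two real points; \item $\ell$ is partially real if one of $C_1\cap\ell$, $C_2\cap\ell$ consists of two real points and the other consists of a pair of nonreal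 complex conjugate points; \item $\ell$ is minimally real if both $C_1\cap\ell$ and $C_2\cap\ell$ consist of a pair of nonreal complex conjugate points. \end{itemize} A $3$-tuple $(n_t,n_p,n_m)$ of nonnegative integers is admissible if $n_t,n_p,n_m\in\{0,1,\dots,10\}$ and $n_t+n_p+n_m$ is an even number between $0$ and $10$ (inclusive). Real twisted cubic curves $C_1,C_2$ realize $(n_t,n_p,n_m)$ if they have $10$ common secant lines, of which exactly $n_t$ are totally real, exactly $n_p$ are partially real, and exactly $n_m$ are minimally real (the remaining $10-n_t-n_p-n_m$ being nonreal lines). *)

(* Defs.v *)
From mathcomp Require Import all_boot all_order all_algebra.
From mathcomp Require Import classical_sets cardinality reals.
From mathcomp Require Import complex mpoly.

Set Implicit Arguments.
Unset Strict Implicit.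
Unset Printing Implicit Defensive.

Import Order.TTheory GRing.Theory Num.Theory.
Local Open Scope ring_scope.
Local Open Scope complex_scope.
Local Open Scope classical_set_scope.
Local Open Scope card_scope.

(* Points and lines of P^3(C), with C = R[i], are the linear subspaces of C^4
   of dimension 1 and 2.  {vspace _} is a canonical representation of subspaces,
   so Leibniz equality is equality of points and lines. *)
Definition proj_point (R : realType) : Type :=
  {P : {vspace 'rV[R[i]]_4} | \dim P == 1%N}.

Definition proj_line (R : realType) : Type :=
  {l : {vspace 'rV[R[i]]_4} | \dim l == 2%N}.

Definition line_points (R : realType) (l : proj_line R) : set (proj_point R) :=
  [set P | (val P <= val l)%VS].

Definition cubic_vector (K : fieldType) (s t : K) : 'rV[K]_4 :=
  \row_(j < 4) (s ^+ (3 - j) * t ^+ j).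

Definition standard_twisted_cubic (R : realType) : set (proj_point R) :=
  [set P | exists s t : R[i],
    (s, t) != (0, 0) /\ val P = <[cubic_vector s t]>%VS].

Definition projective_image (R : realType) (g : 'M[R[i]]_4)
    (X : set (proj_point R)) : set (proj_point R) :=
  [set Q | exists2 P : proj_point R,
    X P & val Q = (linfun (mulmxr g : 'rV[R[i]]_4 -> 'rV[R[i]]_4) @: val P)%VS].

Definition is_twisted_cubic (R : realType) (C : set (proj_point R)) : Prop :=
  exists2 g : 'M[R[i]]_4,
    g \in unitmx & C = projective_image g (@standard_twisted_cubic R).

Definition vanishes_at (R : realType) (f : {mpoly R[4]}) (P : proj_point R) :
    Prop :=
  forall v : 'rV[R[i]]_4, v \in val P ->
    (map_mpoly (real_complex R) f).@[fun j => v ord0 j] = 0.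

(* The equations cut X out set-theoretically; since the ideal of a reduced,
   conjugation-stable X is generated by real forms, nothing is lost. *)
Definition real_locus (R : realType) (X : set (proj_point R)) : Prop :=
  exists F : set {mpoly R[4]},
    (forall f, F f -> exists d : nat, f \is d.-homog) /\
    X = [set P | forall f, F f -> vanishes_at f P].

Definition real_point (R : realType) (P : proj_point R) : Prop :=
  exists v : 'rV[R]_4, val P = <[map_mx (real_complex R) v]>%VS.

Definition conjugate_points (R : realType) (P Q : proj_point R) : Prop :=
  exists v : 'rV[R[i]]_4,
    val P = <[v]>%VS /\ val Q = <[map_mx (@conjc R) v]>%VS.

Definition is_secant (R : realType) (C : set (proj_point R))
    (l : proj_line R) : Prop :=
  exists P Q : proj_point R,
    [/\ P <> Q, (C `&` line_points l) P & (C `&` line_points l) Q].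

Definition common_secants (R : realType) (C1 C2 : set (proj_point R)) :
    set (proj_line R) :=
  [set l | is_secant C1 l /\ is_secant C2 l].

Definition real_line (R : realType) (l : proj_line R) : Prop :=
  real_locus (line_points l).

Definition meets_in_real_pair (R : realType) (C : set (proj_point R))
    (l : proj_line R) : Prop :=
  exists P Q : proj_point R,
    [/\ P <> Q, real_point P, real_point Q &
        C `&` line_points l = [set P; Q]].

Definition meets_in_conjugate_pair (R : realType) (C : set (proj_point R))
    (l : proj_line R) : Prop :=
  exists P Q : proj_point R,
    [/\ ~ real_point P, ~ real_point Q, conjugate_points P Q &
        C `&` line_points l = [set P; Q]].

Definition totally_real (R : realType) (C1 C2 : set (proj_point R))
    (l : proj_line R) : Prop :=
  meets_in_real_pair C1 l /\ meets_in_real_pair C2 l.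

Definition partially_real (R : realType) (C1 C2 : set (proj_point R))
    (l : proj_line R) : Prop :=
  (meets_in_real_pair C1 l /\ meets_in_conjugate_pair C2 l) \/
  (meets_in_conjugate_pair C1 l /\ meets_in_real_pair C2 l).

Definition minimally_real (R : realType) (C1 C2 : set (proj_point R))
    (l : proj_line R) : Prop :=
  meets_in_conjugate_pair C1 l /\ meets_in_conjugate_pair C2 l.

Definition realize (R : realType) (C1 C2 : set (proj_point R))
    (nt np nm : nat) : Prop :=
  let L := common_secants C1 C2 in
  [/\ L #= `I_10,
      L `&` [set l | real_line l /\ totally_real C1 C2 l] #= `I_nt,
      L `&` [set l | real_line l /\ partially_real C1 C2 l] #= `I_np,
      L `&` [set l | real_line l /\ minimally_real C1 C2 l] #= `I_nm &
      L `&` [set l | ~ real_line l] #= `I_(10 - (nt + np + nm))].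

Definition admissible (nt np nm : nat) : bool :=
  [&& (nt <= 10)%N, (np <= 10)%N, (nm <= 10)%N,
      ~~ odd (nt + np + nm) & (nt + np + nm <= 10)%N].

(* Main.v *)
From HB Require Import structures.
From Stdlib Require Import ZArith.
Require Import Defs.
From mathcomp Require Import all_boot all_order all_algebra.
From mathcomp Require Import boolp classical_sets functions cardinality reals complex.
From mathcomp Require Import ring lra zify ssrZ.
From mathcomp Require interval_inference topology normedtype sequences mpoly.
Set Implicit Arguments.
Unset Strict Implicit.
Unset Printing Implicit Defensive.
(* [%Z] is the scope of [int]; the binary integers get their own delimiter. *)
Delimit Scope Z_scope with ZZ.
Import Order.TTheory GRing.Theory Num.Theory.
Local Open Scope ring_scope.
Local Open Scope complex_scope.
Local Open Scope classical_set_scope.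
Local Open Scope card_scope.

(** Take the standard cubic for the first curve, and for the second its image under an invertible
integer matrix G. A line meeting the standard cubic in the points with parameters x1 and x2
is recorded by the monic quadratic X^2 + u X + v with roots x1, x2: it is the left kernel of the
4 x 2 matrix [secant_mx v u 1], whose columns hold the coefficients of the quadratic and of its
product by X. This line is also a secant of the second cubic when it is the image under G of the
line of some quadratic X^2 + w X + z, which means that
[G *m secant_mx v u 1 = secant_mx z w 1 *m T] for some matrix T. If u, v, w, z are real, the signs
of u^2 - 4 v and w^2 - 4 z say on each curve whether the two points are real or conjugate, and a
nonreal pair (u, v) gives a nonreal line ([real_secant_line_coef]). So it suffices to find, for
each triple, a matrix G whose system has exactly ten solutions, with the right signs.

At most ten: a common secant makes four binary quartics linearly dependent, and the dependency N in
C^4 satisfies a_2 + u a_1 + v a_0 = 0, where a_k = N A_k and the 4 x 5 matrices A_k depend on G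
only. Wedging with a_0 and a_1 eliminates the third vector; since a_i /\ a_j is linear in the ten
products N_r N_s, the vector of these products is a joint eigenvector, with eigenvalues u and v, of
two 10 x 10 matrices, provided that the matrix expressing a_1 /\ a_0 is invertible
([syzygy_bound]). A single determinant thus bounds the number of common secants, including the ones
through the points at infinity of the parametrization.

At least ten: elimination of two entries of T leaves six quadratic equations in six unknowns, and
Newton's method shows that near a good approximate solution there is an exact one, which is real if
the approximate one is ([quadrics_newton]). Nonreal solutions are obtained in the same way from
the real and imaginary parts of the equations; only one of each conjugate pair has to be found.
The approximations are precise enough to separate the solutions and to give the signs of the
discriminants.

All hypotheses of these two arguments are inequalities between integers, gathered in the boolean
[check]. The theorem follows ([check_sound]) by evaluating [check] on a table with one matrix and
its ten approximate solutions for each of the 108 triples. *)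

(** * At most ten common secants *)

(** The bad values of [c] are among the roots of a nonzero polynomial, the product over all
pairs of distinct points of the difference of their projections. *)
Lemma separating_projection (K : numFieldType) (s : seq (K * K)) :
  exists c : nat, {in s &, injective (fun x : K * K => x.1 + c%:R * x.2)}.
Proof.
pose P : {poly K} := \prod_(x <- s) \prod_(y <- s | y != x)
  ((x.1 - y.1)%:P + (x.2 - y.2) *: 'X).
have P0 : P != 0.
  rewrite prodf_seq_neq0; apply/allP => x _; apply/implyP => _.
  rewrite prodf_seq_neq0; apply/allP => y _; apply/implyP; apply: contraNneq => /polyP e.
  have := e 0%N; have := e 1%N; rewrite !(coefD, coefZ, coefC, coefX, coef0) /=.
  rewrite mulr1 mulr0 add0r addr0 => /eqP; rewrite subr_eq0 => /eqP e2 /eqP.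
  by rewrite subr_eq0 => /eqP e1; rewrite [x]surjective_pairing e1 e2 -surjective_pairing.
pose rs : seq K := [seq n%:R | n <- iota 0 (size P)].
have /allPn[_ /mapP[c _ ->] Pc] : ~~ all (root P) rs.
  apply/negP => roots_rs; have := max_poly_roots P0 roots_rs.
  rewrite map_inj_uniq ?iota_uniq ?size_map ?size_iota ?ltnn; first by move/(_ isT).
  by move=> m n /eqP; rewrite eqr_nat => /eqP.
exists c => x y xs ys /= exy; apply/eqP; apply: contraNT Pc => xy.
rewrite /root /P horner_prod (big_rem x) //= horner_prod (big_rem y) //=.
rewrite [y == x]eq_sym xy hornerD hornerZ hornerC hornerX.
have -> : x.1 - y.1 + (x.2 - y.2) * c%:R = (x.1 + c%:R * x.2) - (y.1 + c%:R * y.2) by ring.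
by rewrite exy subrr !mul0r.
Qed.

(** For a separating [c], the projections are distinct roots of the characteristic polynomial of
M + c N. *)
Lemma joint_eigenvalues_bound (K : numFieldType) (n : nat) (M N : 'M[K]_n)
    (s : seq (K * K)) :
  uniq s ->
  {in s, forall x, exists v : 'rV[K]_n,
     [/\ v != 0, v *m M = x.1 *: v & v *m N = x.2 *: v]} ->
  (size s <= n)%N.
Proof.
move=> us eig; have [c injc] := separating_projection s.
pose e (x : K * K) := x.1 + c%:R * x.2.
have roots_e : all (root (char_poly (M + c%:R *: N))) (map e s).
  apply/allP => _ /mapP[x xs ->]; rewrite -eigenvalue_root_char.
  have [v [v0 vM vN]] := eig x xs; apply/eigenvalueP; exists v => //.
  by rewrite mulmxDr -scalemxAr vM vN scalerA -scalerDl.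
have := max_poly_roots (monic_neq0 (char_poly_monic _)) roots_e.
by rewrite size_char_poly size_map ltnS map_inj_in_uniq //; apply.
Qed.

Definition shift_col (K : pzRingType) (f : nat -> K) (c : nat) : K :=
  if c is c'.+1 then f c' else 0.

(** Row r of the matrix A_k. Substituting a point of the second curve into the two linear
equations of the line of a quadratic q gives two binary cubics c_0 and c_1. The rows of
q0 A_0 + q1 A_1 + q2 A_2 are the coefficients of the quartics s c_0, t c_0, s c_1 and t c_1. *)
Definition syzygy_pencil (K : pzRingType) (g : nat -> nat -> K) (k r c : nat) : K :=
  match r with
  | 0 => g c k
  | 1 => shift_col (g^~ k) c
  | 2 => g c k.+1
  | _ => shift_col (g^~ k.+1) c
  end.

Definition quadratic_indices : seq (nat * nat) :=
  [:: (0, 0); (0, 1); (0, 2); (0, 3); (1, 1); (1, 2); (1, 3); (2, 2); (2, 3); (3, 3)]%N.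

Definition minor_indices : seq (nat * nat) :=
  [:: (0, 1); (0, 2); (0, 3); (0, 4); (1, 2); (1, 3); (1, 4); (2, 3); (2, 4); (3, 4)]%N.

Definition minor (K : pzRingType) (a b : nat -> nat -> K) (i j c d : nat) : K :=
  a i c * b j d - a i d * b j c.

(** The coefficient of N_i N_j in the minor (c, d) of the 2 x 5 matrix with rows N a and N b. *)
Definition wedge_coef (K : pzRingType) (a b : nat -> nat -> K) (m p : nat) : K :=
  let: (i, j) := nth (0, 0)%N quadratic_indices m in
  let: (c, d) := nth (0, 0)%N minor_indices p in
  if i == j then minor a b i j c d else minor a b i j c d + minor a b j i c d.

Definition wedge_mx (K : pzRingType) (a b : nat -> nat -> K) : 'M[K]_10 :=
  \matrix_(m, p) wedge_coef a b m p.

Definition veronese (K : pzRingType) (N : nat -> K) : 'rV[K]_10 :=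
  \row_m (N (nth (0, 0)%N quadratic_indices m).1 * N (nth (0, 0)%N quadratic_indices m).2).

Definition contract (K : pzRingType) (N : nat -> K) (a : nat -> nat -> K) (c : nat) : K :=
  \sum_(r < 4) N r * a r c.

Lemma syzygy_pencil_morph (K L : pzRingType) (f : {rmorphism K -> L}) (g : nat -> nat -> K) (k r c : nat) :
  f (syzygy_pencil g k r c) = syzygy_pencil (fun i j => f (g i j)) k r c.
Proof. by case: r => [|[|[|r]]] //=; case: c => [|c] //=; rewrite rmorph0. Qed.

Lemma wedge_coef_morph (K L : pzRingType) (f : {rmorphism K -> L}) (g : nat -> nat -> K) (i j m p : nat) :
  f (wedge_coef (syzygy_pencil g i) (syzygy_pencil g j) m p) =
  wedge_coef (syzygy_pencil (fun i j => f (g i j)) i) (syzygy_pencil (fun i j => f (g i j)) j) m p.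
Proof.
rewrite /wedge_coef; case: (nth _ _ m) => k l; case: (nth _ _ p) => c d.
by rewrite /minor; case: ifP => _; rewrite !(rmorphD, rmorphN, rmorphM) !syzygy_pencil_morph.
Qed.

Lemma veronese_wedge (K : comPzRingType) (N : nat -> K) (a b : nat -> nat -> K) (p : 'I_10) :
  (veronese N *m wedge_mx a b) ord0 p =
  let: (c, d) := nth (0, 0)%N minor_indices p in
  contract N a c * contract N b d - contract N a d * contract N b c.
Proof.
rewrite mxE; under eq_bigr do rewrite !mxE /wedge_coef.
case: (nth _ minor_indices p) => c d.
rewrite /contract !big_ord_recr !big_ord0 /= /minor; ring.
Qed.

Lemma veronese_neq0 (K : idomainType) (N : nat -> K) (r : nat) :
  (r < 4)%N -> N r != 0 -> veronese N != 0.
Proof.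
move=> r4 Nr; apply/rV0Pn.
have [m [m10 mE]] : exists m, (m < 10)%N /\ nth (0, 0)%N quadratic_indices m = (r, r).
  by case: r r4 {Nr} => [|[|[|[|//]]]] _; [exists 0%N|exists 4%N|exists 7%N|exists 9%N].
by exists (Ordinal m10); rewrite mxE mE /= mulf_neq0.
Qed.

(** A linear dependency between the four quartics attached to the quadratic (q0, q1, q2). *)
Definition syzygy (K : pzRingType) (g : nat -> nat -> K) (q0 q1 q2 : K) : Prop :=
  exists2 N : nat -> K, exists2 r, (r < 4)%N & N r != 0 &
    forall c, (c < 5)%N ->
      q0 * contract N (syzygy_pencil g 0) c + q1 * contract N (syzygy_pencil g 1) c
      + q2 * contract N (syzygy_pencil g 2) c = 0.

Section SyzygyBound.
Variables (K : numFieldType) (g : nat -> nat -> K).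
Let W (i j : nat) := wedge_mx (syzygy_pencil g i) (syzygy_pencil g j).
Hypothesis W10_unit : W 1 0 \in unitmx.

Lemma minor_indices_lt (p : 'I_10) :
  let: (c, d) := nth (0, 0)%N minor_indices p in (c < 5)%N && (d < 5)%N.
Proof. by case: p; do 10?[case=> //]. Qed.

(** If q2 = 0 then N A_0 and N A_1 are proportional, so that their wedge vanishes; this puts the
vector of the products N_i N_j, which is not zero, into the kernel of an invertible matrix. *)
Lemma syzygy_monic (q0 q1 q2 : K) :
  syzygy g q0 q1 q2 -> (q0, q1, q2) != (0, 0, 0) -> q2 != 0.
Proof.
case=> N [r r4 Nr] NA q_neq0; apply: contraNneq (veronese_neq0 r4 Nr) => q20.
have {}NA c : (c < 5)%N -> q0 * contract N (syzygy_pencil g 0) c + q1 * contract N (syzygy_pencil g 1) c = 0.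
  by move=> c5; rewrite -[RHS](NA c c5) q20 mul0r addr0.
suff VW0 : veronese N *m W 1 0 = 0 by rewrite -(mulmxK W10_unit (veronese N)) VW0 mul0mx.
have q_or : q0 != 0 \/ q1 != 0.
  apply/orP; apply: contraNT q_neq0; rewrite negb_or !negbK => /andP[/eqP-> /eqP->].
  by rewrite q20.
apply/rowP => p; rewrite [RHS]mxE veronese_wedge.
have := minor_indices_lt p; case: (nth _ _ _) => c d /andP[/NA ec /NA ed].
set a0c := contract N _ c in ec *; set a1c := contract N _ c in ec *.
set a0d := contract N _ d in ed *; set a1d := contract N _ d in ed *.
case: q_or => q_n0; apply: (mulfI q_n0); rewrite mulr0.
  have -> : q0 * (a1c * a0d - a1d * a0c) = a1c * (q0 * a0d + q1 * a1d) - a1d * (q0 * a0c + q1 * a1c) by ring.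
  by rewrite ec ed !mulr0 subrr.
have -> : q1 * (a1c * a0d - a1d * a0c) = a0d * (q0 * a0c + q1 * a1c) - a0c * (q0 * a0d + q1 * a1d) by ring.
by rewrite ec ed !mulr0 subrr.
Qed.

(** With a_k = N A_k, the relation a_2 = - v a_0 - u a_1 makes a_2 /\ a_0 and a_2 /\ a_1 the
multiples of a_1 /\ a_0 by - u and v. The entries of the three wedges are the images of the vector
of the N_i N_j under the matrices [W 2 0], [W 2 1] and [W 1 0]. *)
Lemma syzygy_bound (s : seq (K * K)) :
  uniq s -> {in s, forall x, syzygy g x.2 x.1 1} -> (size s <= 10)%N.
Proof.
move=> us sz; apply: (@joint_eigenvalues_bound K 10
  (- (W 2 0 *m invmx (W 1 0))) (W 2 1 *m invmx (W 1 0)) s us) => x xs.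
have [N [r r4 Nr] NA] := sz x xs; exists (veronese N).
have wedgeE i j (l : K) (e : forall c d, (c < 5)%N -> (d < 5)%N ->
    contract N (syzygy_pencil g i) c * contract N (syzygy_pencil g j) d
    - contract N (syzygy_pencil g i) d * contract N (syzygy_pencil g j) c
    = l * (contract N (syzygy_pencil g 1) c * contract N (syzygy_pencil g 0) d
    - contract N (syzygy_pencil g 1) d * contract N (syzygy_pencil g 0) c)) :
    veronese N *m (W i j *m invmx (W 1 0)) = l *: veronese N.
  have -> : veronese N *m (W i j *m invmx (W 1 0)) = l *: (veronese N *m W 1 0) *m invmx (W 1 0).
    rewrite mulmxA; congr (_ *m _); apply/rowP => p; rewrite [RHS]mxE !veronese_wedge.
    have := minor_indices_lt p; case: (nth _ _ _) => c d /andP[c5 d5]; exact: e.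
  by rewrite -scalemxAl mulmxK.
have a2 c : (c < 5)%N ->
    contract N (syzygy_pencil g 2) c = - (x.2 * contract N (syzygy_pencil g 0) c + x.1 * contract N (syzygy_pencil g 1) c).
  by move=> c5; apply/eqP; rewrite -addr_eq0 addrC; have := NA c c5; rewrite mul1r => ->.
split; first exact: veronese_neq0 Nr.
- rewrite mulmxN (@wedgeE 2 0 (- x.1)) ?scaleNr ?opprK // => c d c5 d5.
  by rewrite !a2 //; ring.
- apply: wedgeE => c d c5 d5; rewrite !a2 //; ring.
Qed.

End SyzygyBound.

(** * Secant lines of twisted cubics *)

(** The columns are the coefficients of a + b X + c X^2 and of its product by X. *)
Definition secant_mx (K : pzRingType) (a b c : K) : 'M[K]_(4, 2) :=
  \matrix_(i, j) (if (j <= i)%N then [:: a; b; c]`_(i - j) else 0).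

(** So the left kernel of the secant matrix meets the cubic at the roots of the quadratic. *)
Lemma cubic_vector_secant_mx (K : fieldType) (a b c s t : K) :
  cubic_vector s t *m secant_mx a b c =
  (a * s ^+ 2 + b * (s * t) + c * t ^+ 2) *: \row_(j < 2) [:: s; t]`_j.
Proof.
apply/rowP => j; rewrite !mxE !big_ord_recl big_ord0 !mxE /=.
by case: j => [[|[|//]] lt_j] /=; ring.
Qed.

Lemma scale_secant_mx (K : comPzRingType) (l a b c : K) :
  secant_mx (l * a) (l * b) (l * c) = l *: secant_mx a b c.
Proof.
apply/matrixP => i j; rewrite !mxE; case: ifP => _; last by rewrite mulr0.
by case: (i - j)%N => [|[|[|k]]] //=; rewrite !nth_nil mulr0.
Qed.

Definition secant_left_inverse (K : pzRingType) (b : K) : 'M[K]_(2, 4) :=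
  \matrix_(i, j) (nth [::] [:: [:: 0; 0; 1; - b]; [:: 0; 0; 0; 1]] i)`_j.

Lemma secant_mxK (K : comPzRingType) (a b : K) :
  secant_left_inverse b *m secant_mx a b 1 = 1%:M.
Proof.
apply/matrixP => i j; rewrite !mxE !big_ord_recl big_ord0 !mxE /=.
by case: i j => [[|[|//]] ?] [[|[|//]] ?] /=; rewrite -?val_eqE /=; ring.
Qed.

Definition annihilator (K : fieldType) (M : 'M[K]_(4, 2)) : {vspace 'rV[K]_4} :=
  lker (linfun (mulmxr M)).

Lemma mem_annihilator (K : fieldType) (M : 'M[K]_(4, 2)) (v : 'rV[K]_4) :
  (v \in annihilator M) = (v *m M == 0).
Proof. by rewrite memv_ker lfunE. Qed.

Lemma dim_annihilator (K : fieldType) (L : 'M[K]_(2, 4)) (M : 'M[K]_(4, 2)) :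
  L *m M = 1%:M -> \dim (annihilator M) = 2%N.
Proof.
move=> LM; have := limg_ker_dim (linfun (mulmxr M : 'rV[K]_4 -> 'rV[K]_2)) fullv.
have -> : limg (linfun (mulmxr M : 'rV[K]_4 -> 'rV[K]_2)) = fullv.
  apply/eqP; rewrite eqEsubv subvf; apply/subvP => w _.
  by apply/memv_imgP; exists (w *m L); rewrite ?memvf // lfunE /= -mulmxA LM mulmx1.
by rewrite capfv !dimvf /dim /= !mul1n => /(canRL (addnK 2)).
Qed.

(** Together with the next vector, the reduced echelon basis of the line of (a, b): the first
values of the two solutions of the recurrence x_(k+2) = - b x_(k+1) - a x_k. *)
Definition secant_basis0 (K : pzRingType) (a b : K) : 'rV[K]_4 :=
  \row_j [:: 1; 0; - a; a * b]`_j.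
Definition secant_basis1 (K : pzRingType) (a b : K) : 'rV[K]_4 :=
  \row_j [:: 0; 1; - b; b ^+ 2 - a]`_j.

(** A line has one reduced echelon basis, hence determines its quadratic. *)
Lemma secant_basisP (K : fieldType) (a b a' b' : K) :
  secant_basis0 a b \in annihilator (secant_mx a' b' 1) /\
  secant_basis1 a b \in annihilator (secant_mx a' b' 1) <-> a = a' /\ b = b'.
Proof.
rewrite !mem_annihilator; split=> [[/eqP/rowP/(_ ord0) e0 /eqP/rowP/(_ ord0)]|[<- <-]].
  move: e0; rewrite !mxE !big_ord_recl !big_ord0 !mxE /= => e0 e1.
  split; apply/eqP; rewrite eq_sym -subr_eq0; apply/eqP; [rewrite -[RHS]e0|rewrite -[RHS]e1];
    ring.
by split; apply/eqP/rowP => j; rewrite !mxE !big_ord_recl big_ord0 !mxE /=;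
  case: j => [[|[|//]] ?] /=; ring.
Qed.

Lemma annihilator_scale (K : fieldType) (l : K) (M : 'M[K]_(4, 2)) :
  l != 0 -> annihilator (l *: M) = annihilator M.
Proof.
move=> l0; apply/vspaceP => v; rewrite !mem_annihilator -scalemxAr scaler_eq0.
by rewrite (negPf l0).
Qed.

Lemma cubic_vector_neq0 (K : fieldType) (s t : K) : (s, t) != (0, 0) -> cubic_vector s t != 0.
Proof.
apply: contraNneq => /rowP v0; have := v0 ord0; have := v0 ord_max.
rewrite !mxE /= !expr0 mulr1 mul1r => /eqP; rewrite expf_eq0 /= => /eqP-> /eqP.
by rewrite expf_eq0 /= => /eqP->.
Qed.

Lemma mulmx_unit_neq0 (K : fieldType) (g : 'M[K]_4) (v : 'rV[K]_4) :
  g \in unitmx -> v != 0 -> v *m g != 0.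
Proof.
by move=> ug; apply: contraNneq => vg0; rewrite -[v](mulmxK ug) vg0 mul0mx.
Qed.

Section Geometry.
Variable R : realType.
Local Notation C := R[i].

Fact secant_line_subproof (a b : C) : \dim (annihilator (secant_mx a b 1)) == 2%N.
Proof. by apply/eqP/dim_annihilator/secant_mxK. Qed.

Definition secant_line (a b : C) : proj_line R :=
  exist (fun l : {vspace 'rV[C]_4} => \dim l == 2%N) _ (secant_line_subproof a b).

Fact span_point_subproof (v : 'rV[C]_4) : v != 0 -> \dim <[v]> == 1%N.
Proof. by move=> v0; rewrite dim_vline v0. Qed.

Definition span_point (v : 'rV[C]_4) (v0 : v != 0) : proj_point R :=
  exist (fun P : {vspace 'rV[C]_4} => \dim P == 1%N) _ (span_point_subproof v0).

Definition twisted_cubic (g : 'M[C]_4) : set (proj_point R) :=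
  projective_image g (@standard_twisted_cubic R).

Lemma twisted_cubicP (g : 'M[C]_4) (P : proj_point R) : g \in unitmx ->
  twisted_cubic g P <->
  exists s t : C, (s, t) != (0, 0) /\ val P = <[cubic_vector s t *m g]>%VS.
Proof.
move=> ug; split=> [[Q [s [t [st QE]]] ->]|[s [t [st PE]]]].
  by exists s, t; rewrite QE limg_line lfunE.
exists (span_point (cubic_vector_neq0 st)); first by exists s, t.
by rewrite limg_line lfunE.
Qed.

(** The line of (a, b) is the image under [g] of the line of (a', b'). *)
Definition secant_transfer (g : 'M[C]_4) (a b a' b' : C) : Prop :=
  exists T : 'M[C]_2, g *m secant_mx a b 1 = secant_mx a' b' 1 *m T.

Lemma transfer_unit (g : 'M[C]_4) (a b a' b' : C) (T : 'M[C]_2) :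
  g \in unitmx -> g *m secant_mx a b 1 = secant_mx a' b' 1 *m T -> T \in unitmx.
Proof.
move=> ug e.
have /mulmx1_unit[] // : secant_left_inverse b *m invmx g *m secant_mx a' b' 1 *m T = 1%:M.
by rewrite -mulmxA -e -mulmxA mulKmx // secant_mxK.
Qed.

(** By the transfer equation, the parameters of the intersection of the line of (a, b) with the
image of the cubic under [g] are those of the line of (a', b') with the cubic itself. *)
Lemma twisted_cubic_secantP (g : 'M[C]_4) (a b a' b' : C) (P : proj_point R) :
  g \in unitmx -> secant_transfer g a b a' b' ->
  (twisted_cubic g `&` line_points (secant_line a b)) P <->
  exists s t : C, [/\ (s, t) != (0, 0), val P = <[cubic_vector s t *m g]>%VS &
                      a' * s ^+ 2 + b' * (s * t) + t ^+ 2 = 0].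
Proof.
move=> ug [T gT].
have uT := transfer_unit ug gT.
have on_line s t : (cubic_vector s t *m g \in annihilator (secant_mx a b 1)) =
    (a' * s ^+ 2 + b' * (s * t) + t ^+ 2 == 0) || ((s, t) == (0, 0)).
  rewrite mem_annihilator -mulmxA gT mulmxA cubic_vector_secant_mx mul1r -scalemxAl.
  rewrite scaler_eq0; congr (_ || _); rewrite -[RHS](_ : (\row_(j < 2) [:: s; t]`_j == 0) = _).
    apply/eqP/eqP => [rT|->]; last by rewrite mul0mx.
    by rewrite -[LHS](mulmxK uT) rT mul0mx.
  apply/eqP/eqP => [/rowP r0|[-> ->]].
    by have := r0 ord0; have := r0 ord_max; rewrite !mxE /= => -> ->.
  by apply/rowP => -[[|[|//]] ?]; rewrite !mxE.
split=> [[/(twisted_cubicP _ ug)[s [t [st PE]]]]|[s [t [st PE st0]]]].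
  rewrite /line_points /= PE -memvE on_line (negPf st) orbF => /eqP st0.
  by exists s, t.
split; first by apply/(twisted_cubicP _ ug); exists s, t.
by rewrite /line_points /= PE -memvE on_line st0 eqxx.
Qed.

End Geometry.

Lemma vlineZ (K : fieldType) (vT : vectType K) (k : K) (v : vT) :
  k != 0 -> <[k *: v]>%VS = <[v]>%VS.
Proof.
move=> k0; apply/eqP; rewrite eqEdim !dim_vline scaler_eq0 negb_or k0 leqnn andbT.
by rewrite -memvE memvZ ?memv_line.
Qed.

Lemma cubic_vector_scale (K : fieldType) (s x : K) : cubic_vector s (s * x) = s ^+ 3 *: cubic_vector 1 x.
Proof.
apply/rowP => j; rewrite !mxE expr1n mul1r exprMn mulrA -exprD subnK //.
by rewrite -ltnS.
Qed.

Lemma cubic_line_scale (K : fieldType) (g : 'M[K]_4) (s x : K) : s != 0 ->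
  <[cubic_vector s (s * x) *m g]>%VS = <[cubic_vector 1 x *m g]>%VS.
Proof. by move=> s0; rewrite cubic_vector_scale -scalemxAl vlineZ ?expf_neq0. Qed.

(** The parameter of a point is the ratio of its first two coordinates. *)
Lemma cubic_vector_proportional (K : fieldType) (k x : K) (v : 'rV[K]_4) :
  cubic_vector 1 x = k *: v -> k * v ord0 ord0 = 1 /\ x = k * v ord0 (inord 1).
Proof.
move=> /rowP e; have := e ord0; have := e (inord 1).
by rewrite !mxE inordK // !expr1n !mul1r expr1 expr0 => <- <-.
Qed.

Lemma cubic_line_inj (K : fieldType) (g : 'M[K]_4) (x y : K) : g \in unitmx ->
  <[cubic_vector 1 x *m g]>%VS = <[cubic_vector 1 y *m g]>%VS -> x = y.
Proof.
move=> ug e; have : cubic_vector 1 x *m g \in <[cubic_vector 1 y *m g]>%VS by rewrite -e memv_line.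
case/vlineP => k; rewrite scalemxAl => /(congr1 (mulmx^~ (invmx g))).
rewrite !mulmxK // => /cubic_vector_proportional[].
by rewrite !mxE inordK // !expr1n !mul1r mulr1 expr1 => -> ->; rewrite mul1r.
Qed.

Lemma map_cubic_vector (K L : fieldType) (f : {rmorphism K -> L}) (s t : K) :
  map_mx f (cubic_vector s t) = cubic_vector (f s) (f t).
Proof. by apply/rowP => j; rewrite !mxE rmorphM !rmorphXn. Qed.

Section Pairs.
Variable R : realType.
Local Notation C := R[i].

Lemma twisted_cubic_secant_roots (g : 'M[C]_4) (a b x1 x2 : C) :
  g \in unitmx -> x1 != x2 -> secant_transfer g a b (x1 * x2) (- (x1 + x2)) ->
  exists P Q : proj_point R,
    [/\ P <> Q, val P = <[cubic_vector 1 x1 *m g]>%VS,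
        val Q = <[cubic_vector 1 x2 *m g]>%VS &
        twisted_cubic g `&` line_points (secant_line a b) = [set P; Q]].
Proof.
move=> ug x12 tr.
have nz x : cubic_vector (1 : C) x *m g != 0.
  by rewrite mulmx_unit_neq0 // cubic_vector_neq0 // xpair_eqE oner_eq0.
exists (span_point (nz x1)), (span_point (nz x2)); split; [|by []|by []|].
  by move=> /(congr1 val) /= /(cubic_line_inj ug)/eqP; rewrite (negPf x12).
apply/seteqP; split=> P.
  move=> /(twisted_cubic_secantP _ ug tr)[s [t [st PE]]].
  have -> : x1 * x2 * s ^+ 2 + - (x1 + x2) * (s * t) + t ^+ 2 = (t - s * x1) * (t - s * x2) by ring.
  have s0 x : t = s * x -> s != 0.
    by move=> tE; apply: contraNneq st; rewrite tE => ->; rewrite mul0r.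
  have PsE x : t = s * x -> val P = <[cubic_vector 1 x *m g]>%VS.
    by move=> tE; rewrite PE tE cubic_line_scale ?(s0 x).
  by move=> /eqP; rewrite mulf_eq0 !subr_eq0 => /orP[]/eqP/PsE e; [left|right]; exact: val_inj.
have pt x : (1, x) != (0 : C, 0 : C) by rewrite xpair_eqE oner_eq0.
by case=> ->; apply/(twisted_cubic_secantP _ ug tr); [exists 1, x1|exists 1, x2];
  split=> //; ring.
Qed.

Variable g : 'M[R]_4.
Hypothesis ug : g \in unitmx.
Let gC : 'M[C]_4 := map_mx (real_complex R) g.

Lemma map_unitC : gC \in unitmx. Proof. by rewrite map_unitmx. Qed.

Lemma map_cubic_point (r : R) :
  map_mx (real_complex R) (cubic_vector 1 r *m g) = cubic_vector 1 r%:C *m gC.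
Proof.
rewrite map_mxM; congr (_ *m _); rewrite map_cubic_vector; congr cubic_vector.
Qed.

Lemma meets_in_real_pairP (a b : C) (r1 r2 : R) :
  r1 != r2 -> secant_transfer gC a b (r1 * r2)%:C (- (r1 + r2))%:C ->
  meets_in_real_pair (twisted_cubic gC) (secant_line a b).
Proof.
move=> r12; rewrite (rmorphM (real_complex R)) rmorphN rmorphD => tr.
have c12 : r1%:C != r2%:C by rewrite (inj_eq (@complexI R)).
have [P [Q [PQ PE QE XE]]] := twisted_cubic_secant_roots map_unitC c12 tr.
rewrite /meets_in_real_pair XE.
exists P, Q; split=> //; [exists (cubic_vector 1 r1 *m g)|exists (cubic_vector 1 r2 *m g)].
  by rewrite PE -map_cubic_point.
by rewrite QE -map_cubic_point.
Qed.

(** The parameter of a real point of a real cubic is a ratio of real coordinates. *)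
Lemma nonreal_cubic_point (x : C) (P : proj_point R) :
  x != x^* -> val P = <[cubic_vector 1 x *m gC]>%VS -> ~ real_point P.
Proof.
move=> xx PE [w]; rewrite PE => e; case/eqP: xx.
have : cubic_vector 1 x *m gC \in <[map_mx (real_complex R) w]>%VS by rewrite -e memv_line.
case/vlineP => k /(congr1 (mulmx^~ (invmx gC))); rewrite mulmxK ?map_unitC //.
rewrite -map_invmx -scalemxAl -map_mxM => /cubic_vector_proportional[].
set y := w *m invmx g; rewrite mxE [X in x = _ * X]mxE => ky0 ->.
have <- := mulr1_eq (etrans (mulrC _ _) ky0).
by rewrite rmorphM fmorphV /= !oppr0.
Qed.

Lemma meets_in_conjugate_pairP (a b x : C) :
  x != x^* -> secant_transfer gC a b (x * x^*) (- (x + x^*)) ->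
  meets_in_conjugate_pair (twisted_cubic gC) (secant_line a b).
Proof.
move=> xx tr.
have [P [Q [PQ PE QE XE]]] := twisted_cubic_secant_roots map_unitC xx tr.
rewrite /meets_in_conjugate_pair XE.
exists P, Q; split=> //.
- exact: nonreal_cubic_point PE.
- by apply: nonreal_cubic_point QE; rewrite conjcK eq_sym.
exists (cubic_vector 1 x *m gC); split=> //.
rewrite QE map_mxM map_cubic_vector rmorph1; congr (<[_ *m _]>)%VS.
by apply/matrixP => i j; rewrite !mxE /= oppr0.
Qed.

Lemma is_secant_transfer (a b a' b' : C) :
  b' ^+ 2 - 4 * a' != 0 -> secant_transfer gC a b a' b' ->
  is_secant (twisted_cubic gC) (secant_line a b).
Proof.
move=> disc0 tr; pose d := sqrtc (b' ^+ 2 - 4 * a').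
have dd : d ^+ 2 = b' ^+ 2 - 4 * a' by exact: sqr_sqrtc.
have d0 : d != 0 by apply: contraNneq disc0 => d0; rewrite -dd d0 expr0n.
pose x1 := (- b' + d) / 2; pose x2 := (- b' - d) / 2.
have x12 : x1 != x2.
  by rewrite -subr_eq0 (_ : x1 - x2 = d) // /x1 /x2; field.
have e1 : a' = x1 * x2.
  have -> : x1 * x2 = (b' ^+ 2 - d ^+ 2) / 4 by rewrite /x1 /x2; field.
  by rewrite dd; field.
have e2 : b' = - (x1 + x2) by rewrite /x1 /x2; field.
rewrite e1 e2 in tr; have [P [Q [PQ _ _ XE]]] := twisted_cubic_secant_roots map_unitC x12 tr.
by exists P, Q; rewrite XE; split=> //; [left|right].
Qed.

Lemma meets_in_real_pair_disc (a b : C) (a' b' : R) :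
  0 < b' ^+ 2 - 4 * a' -> secant_transfer gC a b a'%:C b'%:C ->
  meets_in_real_pair (twisted_cubic gC) (secant_line a b).
Proof.
move=> disc0 tr; pose d := Num.sqrt (b' ^+ 2 - 4 * a').
have dd : d ^+ 2 = b' ^+ 2 - 4 * a' by rewrite sqr_sqrtr // ltW.
have d0 : d != 0 by rewrite gt_eqF // sqrtr_gt0.
apply: (@meets_in_real_pairP a b ((- b' + d) / 2) ((- b' - d) / 2)).
  by rewrite -subr_eq0 (_ : _ - _ = d) //; field.
have -> : - ((- b' + d) / 2 + (- b' - d) / 2) = b' by field.
have -> : (- b' + d) / 2 * ((- b' - d) / 2) = (b' ^+ 2 - d ^+ 2) / 4 by field.
by have -> : (b' ^+ 2 - d ^+ 2) / 4 = a' by rewrite dd; field.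
Qed.

Lemma meets_in_conjugate_pair_disc (a b : C) (a' b' : R) :
  b' ^+ 2 - 4 * a' < 0 -> secant_transfer gC a b a'%:C b'%:C ->
  meets_in_conjugate_pair (twisted_cubic gC) (secant_line a b).
Proof.
move=> disc0 tr; pose d := Num.sqrt (4 * a' - b' ^+ 2).
have disc1 : 0 < 4 * a' - b' ^+ 2 by rewrite -opprB oppr_gt0.
have dd : d ^+ 2 = 4 * a' - b' ^+ 2 by rewrite sqr_sqrtr // ltW.
have d0 : d != 0 by rewrite gt_eqF // sqrtr_gt0.
(* one of the two conjugate roots *)
pose x : C := (- b' / 2) +i* (d / 2).
apply: (@meets_in_conjugate_pairP a b x).
  by rewrite eq_complex /= eqxx /= -subr_eq0 opprK -splitr.
have -> : x * x^* = a'%:C.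
  apply/eqP; rewrite eq_complex /=; apply/andP; split; apply/eqP; last by ring.
  have -> : - b' / 2 * (- b' / 2) - d / 2 * - (d / 2) = (b' ^+ 2 + d ^+ 2) / 4 by field.
  by rewrite dd; field.
have -> : - (x + x^*) = b'%:C by apply/eqP; rewrite eq_complex /=; apply/andP; split; apply/eqP; field.
exact: tr.
Qed.

End Pairs.

Section SyzygyOfSecant.
Variable K : fieldType.
Variable g : nat -> nat -> K.
Hypothesis g4 : forall k, g 4 k = 0.
Let G : 'M[K]_4 := \matrix_(i, j) g i j.

Lemma syzygyZ (l q0 q1 q2 : K) : l != 0 ->
  syzygy g (l * q0) (l * q1) (l * q2) -> syzygy g q0 q1 q2.
Proof.
move=> l0 [N Nr NA]; exists N => // c /NA e; apply: (mulfI l0).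
by rewrite mulr0 -[RHS]e !mulrDr !mulrA.
Qed.

Definition syzygy_mx (q0 q1 q2 : K) : 'M[K]_(4, 5) :=
  \matrix_(r, c) (q0 * syzygy_pencil g 0 r c + q1 * syzygy_pencil g 1 r c
                  + q2 * syzygy_pencil g 2 r c).

Lemma syzygy_rank (q0 q1 q2 : K) :
  (\rank (syzygy_mx q0 q1 q2) <= 3)%N -> syzygy g q0 q1 q2.
Proof.
move=> rk; have : kermx (syzygy_mx q0 q1 q2) != 0.
  by rewrite -mxrank_eq0 mxrank_ker subn_eq0 -ltnNge ltnS.
case/rowV0Pn => v /sub_kermxP vA v0; exists (fun r => v ord0 (inord r)).
  have /rV0Pn[r vr] := v0; exists r => //.
  by rewrite inord_val.
move=> c c5; have /rowP/(_ (Ordinal c5)) := vA; rewrite !mxE => <-.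
rewrite /contract !mulr_sumr -!big_split /=; apply: eq_bigr => r _.
by rewrite inord_val mxE /=; ring.
Qed.

Definition quartic_mx (s t s' t' : K) : 'M[K]_(5, 2) :=
  \matrix_(c, j) (if j == ord0 then s ^+ (4 - c) * t ^+ c else s' ^+ (4 - c) * t' ^+ c).

(** The values of binary quartics at two distinct points of the projective line are independent:
a fourth power of a linear form can vanish at one of them and not at the other. *)
Lemma rank_quartic_mx (s t s' t' : K) :
  s * t' != s' * t -> (1 < \rank (quartic_mx s t s' t'))%N.
Proof.
move=> d0.
pose d := s * t' - s' * t; have dn0 : d != 0 by rewrite subr_eq0.
(* rows: the coefficients of the fourth powers of the linear forms vanishing at
   the second, respectively the first, point *)
pose E : 'M[K]_(2, 5) := \matrix_(i, c)
  ((if i == ord0 then t' else t) ^+ (4 - c) * (- (if i == ord0 then s' else s)) ^+ c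
   * [:: 1; 4; 6; 4; 1]`_c).
have EW : E *m quartic_mx s t s' t' = (d ^+ 4)%:M.
  apply/matrixP => i j; rewrite !mxE !big_ord_recl big_ord0 !mxE /= /bump /= /d.
  by case: i j => [[|[|//]] ?] [[|[|//]] ?] /=; rewrite -?val_eqE /=; ring.
have rk2 : \rank (E *m quartic_mx s t s' t') = 2%N.
  by rewrite EW -scalemx1 mxrank_scale_nz ?mxrank1 // expf_neq0.
by have := mxrankM_maxr E (quartic_mx s t s' t'); rewrite rk2.
Qed.

(** The two points are common zeros of the cubics c_0 and c_1, so the four quartics s c_0, t c_0,
s c_1, t c_1 lie in a space of dimension three. *)
Lemma cubic_zeros_syzygy (q0 q1 q2 s t s' t' : K) :
  s * t' != s' * t ->
  cubic_vector s t *m G *m secant_mx q0 q1 q2 = 0 ->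
  cubic_vector s' t' *m G *m secant_mx q0 q1 q2 = 0 ->
  syzygy g q0 q1 q2.
Proof.
move=> d0 z z'; apply: syzygy_rank.
have AW : syzygy_mx q0 q1 q2 *m quartic_mx s t s' t' = 0.
  have entry (x y : K) (j : 'I_2) :
      cubic_vector x y *m G *m secant_mx q0 q1 q2 = 0 ->
      \sum_(c < 4) x ^+ (3 - c) * y ^+ c * (q0 * g c j + q1 * g c j.+1 + q2 * g c j.+2) = 0.
    move=> /rowP/(_ j) e; rewrite [RHS]mxE in e; rewrite -[RHS]e mxE.
    rewrite !big_ord_recr !big_ord0 !mxE !big_ord_recr !big_ord0 !mxE /=.
    by case: j {e} => [[|[|//]] ?] /=; ring.
  apply/matrixP => r j; rewrite !mxE.
  pose x := if j == ord0 then s else s'; pose y := if j == ord0 then t else t'.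
  have zj : cubic_vector x y *m G *m secant_mx q0 q1 q2 = 0 by rewrite /x /y; case: (j == ord0).
  have -> : \sum_j0 syzygy_mx q0 q1 q2 r j0 * quartic_mx s t s' t' j0 j =
    \sum_(c < 5) (q0 * syzygy_pencil g 0 r c + q1 * syzygy_pencil g 1 r c
                  + q2 * syzygy_pencil g 2 r c) * (x ^+ (4 - c) * y ^+ c).
    by apply: eq_bigr => c _; rewrite !mxE /x /y; case: (j == ord0).
  have := entry x y ord0 zj; have := entry x y ord_max zj.
  rewrite !big_ord_recr !big_ord0 /= => e1 e0.
  by case: r => [[|[|[|[|//]]]] ?] /=; rewrite /shift_col ?g4;
    [rewrite -[RHS](mulr0 x) -[X in _ = _ * X]e0|rewrite -[RHS](mulr0 y) -[X in _ = _ * X]e0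
    |rewrite -[RHS](mulr0 x) -[X in _ = _ * X]e1|rewrite -[RHS](mulr0 y) -[X in _ = _ * X]e1]; ring.
have := mulmx0_rank_max AW; have := rank_quartic_mx d0.
by move=> rk2 rk5; rewrite -(leq_add2r 2); apply: leq_trans rk5; rewrite leq_add2l.
Qed.

End SyzygyOfSecant.

Lemma cubic_line_dep (K : fieldType) (s t s' t' : K) :
  (s, t) != (0, 0) -> (s', t') != (0, 0) -> s * t' = s' * t ->
  <[cubic_vector s t]>%VS = <[cubic_vector s' t']>%VS.
Proof.
move=> st st' e; suff [k k0 [-> ->]] : exists2 k, k != 0 & s' = k * s /\ t' = k * t.
  have -> : cubic_vector (k * s) (k * t) = k ^+ 3 *: cubic_vector s t.
    apply/rowP => j; rewrite !mxE !exprMn.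
    rewrite (_ : k ^+ 3 = k ^+ (3 - j) * k ^+ j); first by ring.
    by rewrite -exprD subnK // -ltnS.
  by rewrite vlineZ // expf_neq0.
have kP k : s' = k * s -> t' = k * t -> exists2 k, k != 0 & s' = k * s /\ t' = k * t.
  move=> es et; exists k => //; apply: contraNneq st' => k0.
  by rewrite es et k0 !mul0r.
have [s0|s0] := eqVneq s 0; last first.
  by apply: (kP (s' / s)); [rewrite divfK|apply: (mulfI s0); rewrite e; field].
have t0 : t != 0 by apply: contraNneq st => ->; rewrite s0.
apply: (kP (t' / t)); last by rewrite divfK.
by move/eqP: e; rewrite s0 mul0r eq_sym mulf_eq0 (negPf t0) orbF mulr0 => /eqP.
Qed.

Section CommonSecants.
Variable R : realType.
Local Notation C := R[i].

Lemma line_sum_of_points (l : proj_line R) (P Q : proj_point R) :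
  P <> Q -> line_points l P -> line_points l Q -> val l = (val P + val Q)%VS.
Proof.
move=> PQ Pl Ql; apply/esym/eqP; rewrite eqEdim subv_add (Pl : (val P <= val l)%VS).
rewrite (Ql : (val Q <= val l)%VS) /= (eqP (valP l)) ltnNge; apply/negP => dim1.
have eqPQ (X : proj_point R) : (val X <= val P + val Q)%VS -> val X = (val P + val Q)%VS.
  by move=> sub; apply/eqP; rewrite eqEdim sub (eqP (valP X)).
case: PQ; apply: val_inj; apply: etrans (eqPQ P (addvSl _ _)) _.
exact/esym/eqPQ/addvSr.
Qed.

Lemma is_secant_points (g : 'M[C]_4) (l : proj_line R) :
  g \in unitmx -> is_secant (twisted_cubic g) l ->
  exists s t s' t' : C, [/\ s * t' != s' * t,
    val l = (<[cubic_vector s t *m g]> + <[cubic_vector s' t' *m g]>)%VS,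
    cubic_vector s t *m g \in val l & cubic_vector s' t' *m g \in val l].
Proof.
move=> ug [P [Q [PQ [/(twisted_cubicP _ ug)[s [t [st PE]]] Pl]
                    [/(twisted_cubicP _ ug)[s' [t' [st' QE]]] Ql]]]].
exists s, t, s', t'; rewrite -PE -QE; split; last 2 first.
- by apply: (subvP Pl); rewrite PE memv_line.
- by apply: (subvP Ql); rewrite QE memv_line.
- apply/eqP => e; case: PQ; apply: val_inj.
  have lg v : <[v *m g]>%VS = (linfun (mulmxr g : 'rV[C]_4 -> 'rV[C]_4) @: <[v]>)%VS.
    by rewrite limg_line lfunE.
  by rewrite PE QE !lg (cubic_line_dep st st' e).
exact: line_sum_of_points.
Qed.

Variable g : nat -> nat -> R.
Hypothesis g4 : forall k, g 4 k = 0.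
Let G : 'M[R]_4 := \matrix_(i, j) g i j.
Hypothesis uG : G \in unitmx.
Let gC (i j : nat) : C := (g i j)%:C.
Let GC : 'M[C]_4 := map_mx (real_complex R) G.
Hypothesis uW : wedge_mx (syzygy_pencil gC 1) (syzygy_pencil gC 0) \in unitmx.

Lemma GC_unit : GC \in unitmx. Proof. by rewrite map_unitmx. Qed.

Lemma GC_E : GC = \matrix_(i, j) gC i j.
Proof. by apply/matrixP => i j; rewrite !mxE. Qed.

Lemma gC4 k : gC 4 k = 0. Proof. by rewrite /gC g4. Qed.

(** The quadratic whose roots are the parameters of the two points on the first cubic need not be
monic a priori: one of the points may be at infinity. This is excluded by [syzygy_monic]. *)
Lemma common_secant_syzygy (l : proj_line R) :
  common_secants (twisted_cubic 1%:M) (twisted_cubic GC) l ->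
  exists u v : C, l = secant_line v u /\ syzygy gC v u 1.
Proof.
case=> /(is_secant_points (unitmx1 _ _))[s [t [s' [t' [d0 lE _ _]]]]].
case/(is_secant_points GC_unit)=> [x [y [x' [y' [d1 _ xl yl]]]]].
(* the quadratic with roots t / s and t' / s', up to the factor s s' *)
pose q0 := t * t'; pose q1 := - (s * t' + s' * t); pose q2 := s * s'.
have lq w : w \in val l -> w *m secant_mx q0 q1 q2 = 0.
  rewrite lE !mulmx1 => /memv_addP[_ /vlineP[k ->] [_ /vlineP[k' ->] ->]].
  rewrite mulmxDl -!scalemxAl !cubic_vector_secant_mx.
  have -> : q0 * s ^+ 2 + q1 * (s * t) + q2 * t ^+ 2 = 0 by rewrite /q0 /q1 /q2; ring.
  have -> : q0 * s' ^+ 2 + q1 * (s' * t') + q2 * t' ^+ 2 = 0 by rewrite /q0 /q1 /q2; ring.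
  by rewrite !scale0r !scaler0 addr0.
have sy : syzygy gC q0 q1 q2.
  move: (lq _ xl) (lq _ yl); rewrite GC_E; exact: (cubic_zeros_syzygy gC4 d1).
have q20 : q2 != 0.
  apply: (syzygy_monic uW sy); apply: contra d0 => /eqP[/eqP e0 e1 /eqP e2].
  have d2 : (s * t' - s' * t) ^+ 2 = q1 ^+ 2 - 4 * q0 * q2 by rewrite /q0 /q1 /q2; ring.
  move/eqP: d2; rewrite (eqP e0 : q0 = 0) (e1 : q1 = 0) mulr0 mul0r expr0n subrr.
  by rewrite expf_eq0 /= subr_eq0.
exists (q1 / q2), (q0 / q2); split; last first.
  by apply: (syzygyZ q20); rewrite mulr1 ![q2 * _]mulrC !divfK.
apply: val_inj; apply/eqP; rewrite eqEdim (eqP (valP l)) (eqP (valP (secant_line _ _))) leqnn andbT.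
apply/subvP => w /lq wq; rewrite /= -(annihilator_scale _ q20) -scale_secant_mx mulr1.
by rewrite ![q2 * _]mulrC !divfK // mem_annihilator wq.
Qed.

(** The transfer equation factors c_0 and c_1 as the quadratic of (a', b') times two linear forms
l_0 and l_1, whose coefficients are the columns of T; the relation is l_1 c_0 - l_0 c_1 = 0. *)
Lemma transfer_syzygy (a b a' b' : C) :
  secant_transfer GC a b a' b' -> syzygy gC a b 1.
Proof.
case=> T GT; have uT := transfer_unit GC_unit GT.
(* l_1 and - l_0, in the order of the rows s c_0, t c_0, s c_1, t c_1 *)
pose N := nth 0 [:: T ord0 ord_max; T ord_max ord_max; - T ord0 ord0; - T ord_max ord0].
have row (c : 'I_4) (j : 'I_2) :
    a * gC c j + b * gC c j.+1 + gC c j.+2 =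
    secant_mx a' b' 1 c ord0 * T ord0 j + secant_mx a' b' 1 c ord_max * T ord_max j.
  move/matrixP: GT => /(_ c j); rewrite GC_E [RHS]mxE !big_ord_recr big_ord0 /= add0r.
  rewrite (_ : widen_ord _ _ = ord0) => [<-|]; last exact: val_inj.
  rewrite mxE !big_ord_recr big_ord0 !mxE /=.
  by case: j => [[|[|//]] ?] /=; ring.
exists N => [|c].
  have T0 : T != 0.
    by apply: contraTneq uT => ->; rewrite unitmxE det0 unitr0.
  have {T0}/matrix0Pn[i [j ij]] := T0.
  have [r [r4 Nr]] : exists r, (r < 4)%N /\ (N r = T i j \/ N r = - T i j).
    case: i j {ij} => [[|[|//]] ?] [[|[|//]] ?]; [exists 2%N|exists 0%N|exists 3%N|exists 1%N];
      split=> //=; [right|left|right|left]; rewrite ?opprK; try congr (- _); congr (T _ _); exact: val_inj.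
  by exists r => //; case: Nr => ->; rewrite ?oppr_eq0.
have r0 c4 j := row (Ordinal (c4 : (_ < 4)%N)) j.
rewrite mul1r /contract !big_ord_recr !big_ord0 /= /N /= => c5.
have := r0 0%N isT ord0; have := r0 0%N isT ord_max.
have := r0 1%N isT ord0; have := r0 1%N isT ord_max.
have := r0 2%N isT ord0; have := r0 2%N isT ord_max.
have := r0 3%N isT ord0; have := r0 3%N isT ord_max.
rewrite !mxE /= => e31 e30 e21 e20 e11 e10 e01 e00.
pose F (f : nat -> C) j := a * f j + b * f j.+1 + f j.+2.
transitivity (T ord0 ord_max * F (gC c) 0%N + T ord_max ord_max * F (fun k => shift_col (gC^~ k) c) 0%N
  - T ord0 ord0 * F (gC c) 1%N - T ord_max ord0 * F (fun k => shift_col (gC^~ k) c) 1%N).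
  by rewrite /F /=; ring.
rewrite /F /=; case: c c5 => [|[|[|[|[|//]]]]] _ /=;
  rewrite ?gC4 ?e00 ?e01 ?e10 ?e11 ?e20 ?e21 ?e30 ?e31; ring.
Qed.

End CommonSecants.

(** * Real equations *)

Section RealLoci.
Import mpoly.
Variable R : realType.
Local Notation C := R[i].

Definition linear_form (u : 'cV[R]_4) : {mpoly R[4]} := \sum_i u i ord0 *: 'X_i.

Definition evalC (f : {mpoly R[4]}) (v : 'rV[C]_4) : C :=
  (map_mpoly (real_complex R) f).@[fun j => v ord0 j].

Lemma evalCB f h v : evalC (f - h) v = evalC f v - evalC h v.
Proof. by rewrite /evalC rmorphB mevalB. Qed.

Lemma evalCM f h v : evalC (f * h) v = evalC f v * evalC h v.
Proof. by rewrite /evalC rmorphM mevalM. Qed.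

Lemma evalC_linear_form u v : evalC (linear_form u) v = (v *m map_mx (real_complex R) u) ord0 ord0.
Proof.
rewrite /evalC /linear_form (rmorph_sum (map_mpoly (real_complex R))) rmorph_sum mxE; apply: eq_bigr => i _.
by rewrite /= map_mpolyZ map_mpolyX mevalZ mevalXU !mxE mulrC.
Qed.

Lemma linear_form_homog u : linear_form u \is 1.-homog.
Proof. by apply: rpred_sum => i _; apply: rpredZ; rewrite dhomogX /= mdeg1. Qed.

Lemma evalC_conj f v : evalC f (map_mx (@conjc R) v) = (evalC f v)^*.
Proof.
rewrite /evalC !mevalE rmorph_sum; apply: eq_bigr => m _.
rewrite rmorphM rmorph_prod mcoeff_map_mpoly /=; congr (_ * _); first by rewrite oppr0.
by apply: eq_bigr => i _; rewrite mxE rmorphXn.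
Qed.

(** The 2 x 2 minors of the matrix with rows L_0, L_1, L_2 and L_1, L_2, L_3, where the L_j are
the coordinates after the change of basis [h]: the quadrics containing a twisted cubic. *)
Definition scroll_minors (h : 'M[R]_4) : set {mpoly R[4]} :=
  let L j := linear_form (col (inord j) h) in
  [set f | [\/ f = L 0%N * L 2%N - L 1%N * L 1%N, f = L 0%N * L 3%N - L 1%N * L 2%N
             | f = L 1%N * L 3%N - L 2%N * L 2%N]].

Lemma scroll_minors_zero (y : 'rV[C]_4) : y != 0 ->
  y ord0 (inord 0) * y ord0 (inord 2) = y ord0 (inord 1) * y ord0 (inord 1) ->
  y ord0 (inord 0) * y ord0 (inord 3) = y ord0 (inord 1) * y ord0 (inord 2) ->
  y ord0 (inord 1) * y ord0 (inord 3) = y ord0 (inord 2) * y ord0 (inord 2) ->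
  exists s t k : C, [/\ (s, t) != (0, 0), k != 0 & y = k *: cubic_vector s t].
Proof.
move=> y0 e1 e2 e3.
have rowE (z : 'rV[C]_4) : (forall k, (k < 4)%N -> y ord0 (inord k) = z ord0 (inord k)) -> y = z.
  by move=> yz; apply/rowP => j; rewrite -[j]inord_val yz.
have [y00|y00] := eqVneq (y ord0 (inord 0)) 0; last first.
  exists 1, (y ord0 (inord 1) / y ord0 (inord 0)), (y ord0 (inord 0)).
  split=> //; first by rewrite xpair_eqE oner_eq0.
  have y2 : y ord0 (inord 2) = y ord0 (inord 1) ^+ 2 / y ord0 (inord 0).
    by apply: (mulfI y00); rewrite e1; field.
  have y3 : y ord0 (inord 3) = y ord0 (inord 1) ^+ 3 / y ord0 (inord 0) ^+ 2.
    by apply: (mulfI y00); rewrite e2 y2; field.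
  apply: rowE => -[|[|[|[|//]]]] _; rewrite !mxE inordK // expr1n mul1r ?y2 ?y3; by field.
move: e1 e2 e3; rewrite y00 !mul0r => /esym/eqP; rewrite mulf_eq0 orbb => /eqP y1 _.
rewrite y1 mul0r => /esym/eqP; rewrite mulf_eq0 orbb => /eqP y2.
have yE : y = y ord0 (inord 3) *: cubic_vector 0 1.
  apply: rowE => -[|[|[|[|//]]]] _; rewrite !mxE inordK // ?y00 ?y1 ?y2 /= expr1n mulr1;
    by rewrite ?expr0 ?mulr1 // expr0n /= mulr0.
exists 0, 1, (y ord0 (inord 3)); split=> //; first by rewrite xpair_eqE oner_eq0 andbF.
by apply: contraNneq y0 => y30; rewrite yE y30 scale0r.
Qed.

Lemma real_locus_twisted_cubic (g : 'M[R]_4) : g \in unitmx ->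
  real_locus (twisted_cubic (map_mx (real_complex R) g)).
Proof.
move=> ug; have ugC : map_mx (real_complex R) g \in unitmx by rewrite map_unitmx.
exists (scroll_minors (invmx g)); split=> [f fF|].
  have hom2 u v u' v' : linear_form u * linear_form v - linear_form u' * linear_form v' \is 2.-homog.
    by apply: rpredB; apply: (@dhomogM _ _ _ 1 _ 1); exact: linear_form_homog.
  by exists 2%N; case: fF => ->; exact: hom2.
have evL j (y : 'rV[C]_4) : (j < 4)%N ->
    evalC (linear_form (col (inord j) (invmx g))) (y *m map_mx (real_complex R) g) = y ord0 (inord j).
  by move=> j4; rewrite evalC_linear_form map_col map_invmx colE mulmxA mulmxK // -colE mxE.
apply/seteqP; split=> P.
  case/(twisted_cubicP _ ugC)=> s [t [_ PE]] f fF v; rewrite PE => /vlineP[k ->].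
  rewrite -/(evalC _ _) scalemxAl.
  case: fF => ->; rewrite evalCB !evalCM !evL // !mxE !inordK //; ring.
move=> Pz; apply/(twisted_cubicP _ ugC).
pose x := vpick (val P); pose y := x *m invmx (map_mx (real_complex R) g).
have x0 : x != 0 by rewrite vpick0 -dimv_eq0 (eqP (valP P)).
have PE : val P = <[x]>%VS.
  apply/esym/eqP; rewrite eqEdim dim_vline x0 (eqP (valP P)) leqnn andbT.
  by rewrite -memvE memv_pick.
have xE : x = y *m map_mx (real_complex R) g by rewrite mulmxKV.
have y0 : y != 0 by apply: contraNneq x0 => y0; rewrite xE y0 mul0mx.
have ev f : scroll_minors (invmx g) f -> evalC f (y *m map_mx (real_complex R) g) = 0.
  by move=> /Pz; apply; rewrite -xE memv_pick.
have eqs i j k l : (i < 4)%N -> (j < 4)%N -> (k < 4)%N -> (l < 4)%N ->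
    let L j := linear_form (col (inord j) (invmx g)) in
    scroll_minors (invmx g) (L i * L j - L k * L l) ->
    y ord0 (inord i) * y ord0 (inord j) = y ord0 (inord k) * y ord0 (inord l).
  move=> i4 j4 k4 l4 L /ev /eqP; rewrite evalCB !evalCM !evL // subr_eq0 => /eqP.
  by [].
have [|||s [t [k [st k0 yE]]]] := scroll_minors_zero y0.
- by apply: eqs => //; apply: Or31.
- by apply: eqs => //; apply: Or32.
- by apply: eqs => //; apply: Or33.
by exists s, t; split=> //; rewrite PE xE yE -scalemxAl vlineZ.
Qed.

Lemma real_secant_line (a b : R) : real_line (secant_line a%:C b%:C).
Proof.
pose u j : 'cV[R]_4 := col j (secant_mx a b 1).
exists [set f | exists j, f = linear_form (u j)]; split=> [f [j ->]|].
  by exists 1%N; exact: linear_form_homog.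
have mxE' : map_mx (real_complex R) (secant_mx a b 1) = secant_mx a%:C b%:C 1.
  apply/matrixP => i j; rewrite !mxE; case: ifP => // _.
  by case: (i - j)%N => [|[|[|k]]] //=; rewrite !nth_nil.
apply/seteqP; split=> P.
  move=> Pl f [j ->] v vP; rewrite -/(evalC _ _) evalC_linear_form map_col mxE' colE mulmxA -colE mxE.
  have : v \in annihilator (secant_mx a%:C b%:C 1) by exact: (subvP Pl).
  by rewrite mem_annihilator => /eqP ->; rewrite mxE.
move=> Pz; apply/subvP => v vP; rewrite mem_annihilator; apply/eqP/rowP => j.
have : evalC (linear_form (u j)) v = 0 by apply: Pz => //; exists j.
by rewrite evalC_linear_form map_col mxE' colE mulmxA -colE !mxE.
Qed.

(** Real equations have conjugate values at conjugate points. *)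
Lemma real_line_conj (l : proj_line R) (v : 'rV[C]_4) :
  real_line l -> v \in val l -> map_mx (@conjc R) v \in val l.
Proof.
case=> F [_ lE] vl; have [->|v0] := eqVneq v 0; first by rewrite map_mx0 mem0v.
have w0 : map_mx (@conjc R) v != 0 by rewrite map_mx_eq0.
have: line_points l (span_point v0) by rewrite /line_points /= -memvE.
rewrite lE => vz; suff : line_points l (span_point w0) by rewrite /line_points /= -memvE.
rewrite lE => f /vz fv w /vlineP[k ->].
have -> : k *: map_mx (@conjc R) v = map_mx (@conjc R) (k^* *: v).
  by apply/rowP => j; rewrite !mxE rmorphM /= conjcK.
by rewrite -/(evalC _ _) evalC_conj /evalC fv ?rmorph0 // memvZ // memv_line.
Qed.

(** The conjugate of the echelon basis lies in the line and is again an echelon basis. *)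
Lemma real_secant_line_coef (a b : C) : real_line (secant_line a b) -> a^* = a /\ b^* = b.
Proof.
move=> rl; apply/secant_basisP.
have [e f] := (secant_basisP a b a b).2 (conj erefl erefl).
have -> : secant_basis0 a^* b^* = map_mx (@conjc R) (secant_basis0 a b).
  apply/rowP => j; rewrite !mxE; case: j => [[|[|[|[|//]]]] j4]; apply/esym;
    [exact: rmorph1|exact: rmorph0|exact: rmorphN|exact: rmorphM].
have -> : secant_basis1 a^* b^* = map_mx (@conjc R) (secant_basis1 a b).
  apply/rowP => j; rewrite !mxE; case: j => [[|[|[|[|//]]]] j4]; apply/esym;
    [exact: rmorph0|exact: rmorph1|exact: rmorphN|].
  by rewrite [LHS]rmorphB rmorphXn.
by split; [exact: (real_line_conj rl e)|exact: (real_line_conj rl f)].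
Qed.

End RealLoci.

(** * Counting the common secants of each kind *)

Lemma card_image_seq (T : eqType) (U : Type) (F : T -> U) (s : seq T) (A : set U) :
  uniq s -> {in s &, injective F} -> (forall l, A l <-> exists2 x, x \in s & F x = l) ->
  A #= `I_(size s).
Proof.
case: s => [|x0 s'].
  move=> us injF AE; rewrite (_ : A = set0) ?II0 ?card_eqxx //.
  by apply/seteqP; split=> // l /AE[].
move: (x0 :: s') => s us injF AE.
have -> : A = [set F (nth x0 s i) | i in `I_(size s)].
  apply/seteqP; split=> l.
    case/AE=> x xs <-; exists (index x s); first by have := xs; rewrite -index_mem.
    by rewrite nth_index.
  by case=> i /= is_ <-; apply/AE; exists (nth x0 s i); rewrite ?mem_nth.
apply: inj_card_eq => i j; rewrite !inE /= => is_ js /injF e.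
by apply/eqP; rewrite -(nth_uniq x0 is_ js us); apply/eqP/e; apply: mem_nth.
Qed.

(** A curve never meets a line both in a real and in a conjugate pair, so knowing one of the two
for each curve decides which of the three kinds the line is. *)
Lemma exclusive_kinds (p1 q1 p2 q2 : Prop) (r1 r2 : bool) :
  (p1 -> q1 -> False) -> (p2 -> q2 -> False) ->
  (if r1 then p1 else q1) -> (if r2 then p2 else q2) ->
  [/\ p1 /\ p2 <-> Some (r1, r2) == Some (true, true),
      (p1 /\ q2) \/ (q1 /\ p2) <-> r1 (+) r2 &
      q1 /\ q2 <-> Some (r1, r2) == Some (false, false)].
Proof. by case: r1 r2 => [] [] e1 e2 m1 m2; split; split=> //; tauto. Qed.

Section Counting.
Variable R : realType.
Local Notation C := R[i].

Lemma secant_line_inj (a b a' b' : C) :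
  secant_line a b = secant_line a' b' -> a = a' /\ b = b'.
Proof.
move=> e; apply/secant_basisP.
have [x y] : _ /\ _ := (secant_basisP a b a b).2 (conj erefl erefl).
by move/(congr1 val): e => /= <-.
Qed.

Lemma real_conjugate_pair_exclusive (X : set (proj_point R)) (l : proj_line R) :
  meets_in_real_pair X l -> meets_in_conjugate_pair X l -> False.
Proof.
case=> P [Q [_ rP _ XE]] [P' [Q' [nP' nQ' _]]]; rewrite XE => /seteqP[/(_ P)].
by case=> [|PP' _|PQ' _]; [left|apply: nP'; rewrite -PP'|apply: nQ'; rewrite -PQ'].
Qed.

Lemma secant_transfer1 (a b : C) : secant_transfer 1%:M a b a b.
Proof. by exists 1%:M; rewrite mul1mx mulmx1. Qed.

Definition disc_sign (r : bool) (a b : R) : Prop :=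
  if r then 0 < b ^+ 2 - 4 * a else b ^+ 2 - 4 * a < 0.

(** A common secant given by (u, v). The first component is [None] for a nonreal line;
otherwise it says for each of the two curves whether the line meets it in real points. *)
Definition solution_data : Type := option (bool * bool) * (C * C).

Definition secant_solution (G : 'M[R]_4) (x : solution_data) : Prop :=
  exists w z : C,
    [/\ secant_transfer (map_mx (real_complex R) G) x.2.2 x.2.1 z w,
        x.2.1 ^+ 2 - 4 * x.2.2 != 0, w ^+ 2 - 4 * z != 0 &
        if x.1 is Some (r1, r2) then
          exists u0 v0 w0 z0 : R,
            [/\ x.2 = (u0%:C, v0%:C), (w, z) = (w0%:C, z0%:C),
                disc_sign r1 v0 u0 & disc_sign r2 z0 w0]
        else ~ (conjc x.2.2 = x.2.2 /\ conjc x.2.1 = x.2.1)].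

Definition total_kind (x : solution_data) := x.1 == Some (true, true).
Definition partial_kind (x : solution_data) := if x.1 is Some (r1, r2) then r1 (+) r2 else false.
Definition minimal_kind (x : solution_data) := x.1 == Some (false, false).

Variable g : nat -> nat -> R.
Hypothesis g4 : forall k, g 4 k = 0.
Let G : 'M[R]_4 := \matrix_(i, j) g i j.
Hypothesis uG : G \in unitmx.
Hypothesis uW : wedge_mx (syzygy_pencil g 1) (syzygy_pencil g 0) \in unitmx.

Let gC (i j : nat) : C := (g i j)%:C.
Let GC : 'M[C]_4 := map_mx (real_complex R) G.
Let C1 : set (proj_point R) := twisted_cubic 1%:M.
Let C2 : set (proj_point R) := twisted_cubic GC.

Lemma wedge_unitC : wedge_mx (syzygy_pencil gC 1) (syzygy_pencil gC 0) \in unitmx.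
Proof.
have -> : wedge_mx (syzygy_pencil gC 1) (syzygy_pencil gC 0) =
    map_mx (real_complex R) (wedge_mx (syzygy_pencil g 1) (syzygy_pencil g 0)).
  by apply/matrixP => i j; rewrite !mxE (wedge_coef_morph (real_complex R)).
by rewrite map_unitmx.
Qed.

(** By [syzygy_bound] ten solutions are all of them: an eleventh common secant would give eleven
distinct joint eigenvalues. The cardinals of the statement become counts in a list. *)
Lemma realize_of_solutions (sols : seq solution_data) :
  size sols = 10%N -> uniq (map snd sols) ->
  {in sols, forall x, secant_solution G x} ->
  realize C1 C2 (count total_kind sols) (count partial_kind sols) (count minimal_kind sols).
Proof.
move=> sz us ok; have us' := map_uniq us.
pose F (x : solution_data) : proj_line R := secant_line x.2.2 x.2.1.
have u1 : (1%:M : 'M[R]_4) \in unitmx by rewrite unitmx1.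
have C1E : C1 = twisted_cubic (map_mx (real_complex R) 1%:M) by rewrite map_mx1.
have tr1 a b : secant_transfer (map_mx (real_complex R) 1%:M) a b a b.
  by rewrite map_mx1; exact: secant_transfer1.
have injF : {in sols &, injective F}.
  move=> x y xs ys /secant_line_inj[e2 e1].
  have e : x.2 = y.2 by rewrite [x.2]surjective_pairing e1 e2 -surjective_pairing.
  rewrite -(nth_index x xs) -(nth_index x ys); congr nth; apply/eqP.
  rewrite -(nth_uniq x.2 _ _ us) ?size_map ?index_mem //.
  by rewrite !(nth_map x) ?index_mem // !nth_index // e.
have LE l : common_secants C1 C2 l <-> exists2 x, x \in sols & F x = l.
  split=> [/(common_secant_syzygy g4 uG wedge_unitC)[u [v [-> sy]]]|[x xs <-]].
    have [/mapP[x xs xE]|uv] := boolP ((u, v) \in map snd sols).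
      by exists x; rewrite // /F -xE.
    have : (size ((u, v) :: map snd sols) <= 10)%N.
      apply: (syzygy_bound wedge_unitC); first by rewrite /= uv.
      move=> y; rewrite inE => /orP[/eqP->//|/mapP[x /ok[w [z [tr _ _ _]]] ->]].
      exact: (transfer_syzygy g4 uG tr).
    by rewrite /= size_map sz.
  have [w [z [tr d1 d2 _]]] := ok x xs.
  split; first by rewrite C1E; exact: (is_secant_transfer u1 d1).
  exact: (is_secant_transfer uG d2 tr).
have kindP x : x \in sols ->
    if x.1 is Some (r1, r2) then
      [/\ real_line (F x),
          if r1 then meets_in_real_pair C1 (F x) else meets_in_conjugate_pair C1 (F x) &
          if r2 then meets_in_real_pair C2 (F x) else meets_in_conjugate_pair C2 (F x)]
    else ~ real_line (F x).
  case/ok=> w [z [tr _ _]]; case: (x.1) => [[r1 r2]|]; last first.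
    by move=> nr /real_secant_line_coef.
  case=> u0 [v0 [w0 [z0 [xE [wE zE] s1 s2]]]]; rewrite /F xE /=.
  split; first exact: real_secant_line.
    by rewrite C1E; case: r1 s1 => s1;
      [apply: (meets_in_real_pair_disc u1 s1)|apply: (meets_in_conjugate_pair_disc u1 s1)].
  move: tr; rewrite xE wE zE /= => tr.
  by case: r2 s2 => s2; [apply: (meets_in_real_pair_disc uG s2)|apply: (meets_in_conjugate_pair_disc uG s2)].
have card_kind (A : set (proj_line R)) (p : pred solution_data) :
    (forall x, x \in sols -> A (F x) <-> p x) ->
    common_secants C1 C2 `&` A #= `I_(count p sols).
  move=> Ap; rewrite -size_filter.
  apply: (card_image_seq (F := F)); first exact: filter_uniq.
    by move=> x y; rewrite !mem_filter => /andP[_ xs] /andP[_ ys]; exact: injF.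
  move=> l; split=> [[/LE[x xs <-] /(Ap x xs) px]|[x]].
    by exists x; rewrite // mem_filter px.
  by rewrite mem_filter => /andP[px xs] <-; split; [apply/LE; exists x|apply/(Ap x xs)].
have kinds x r1 r2 : x \in sols -> x.1 = Some (r1, r2) ->
    [/\ real_line (F x), totally_real C1 C2 (F x) <-> total_kind x,
        partially_real C1 C2 (F x) <-> partial_kind x &
        minimally_real C1 C2 (F x) <-> minimal_kind x].
  move=> /kindP + e; rewrite /total_kind /partial_kind /minimal_kind e => -[rl m1 m2].
  have [] := exclusive_kinds (@real_conjugate_pair_exclusive C1 (F x))
    (@real_conjugate_pair_exclusive C2 (F x)) m1 m2.
  by split.
have nonreal x (A : proj_line R -> Prop) (p : pred solution_data) :
    x \in sols -> x.1 = None -> p x = false -> real_line (F x) /\ A (F x) <-> p x.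
  by move=> /kindP + e; rewrite e => nr ->; split=> // -[/nr].
split.
- rewrite -[`I_10](congr1 (fun n => `I_n) sz).
  exact: card_image_seq us' injF LE.
- apply: card_kind => x xs; case e: (x.1) => [[r1 r2]|]; last by apply: nonreal; rewrite // /total_kind e.
  by have [rl kt _ _] := kinds x r1 r2 xs e; split=> [[_ /kt]|/kt].
- apply: card_kind => x xs; case e: (x.1) => [[r1 r2]|]; last by apply: nonreal; rewrite // /partial_kind e.
  by have [rl _ kt _] := kinds x r1 r2 xs e; split=> [[_ /kt]|/kt].
- apply: card_kind => x xs; case e: (x.1) => [[r1 r2]|]; last by apply: nonreal; rewrite // /minimal_kind e.
  by have [rl _ _ kt] := kinds x r1 r2 xs e; split=> [[_ /kt]|/kt].
have -> : (10 - (count total_kind sols + count partial_kind sols + count minimal_kind sols))%N =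
    count (fun x : solution_data => ~~ isSome x.1) sols.
  rewrite -sz -(count_predC (fun x : solution_data => isSome x.1)).
  suff -> : (count total_kind sols + count partial_kind sols + count minimal_kind sols)%N =
    count (fun x : solution_data => isSome x.1) sols by rewrite addKn.
  elim: (sols) => //= -[k x] s <-; rewrite /total_kind /partial_kind /minimal_kind /=.
  by case: k => [[[] []]|] /=; lia.
apply: card_kind => x /kindP; case: (x.1) => [[r1 r2]|] // [rl _ _]; split=> //.
Qed.

End Counting.

(** * A zero of a system of quadrics near an approximate one *)

(** In a vector of the kernel, the row of the largest coordinate contradicts the inequality. *)
Lemma diag_dominant_unit (R : realFieldType) n (M : 'M[R]_n) :
  (forall k, \sum_j `|(k == j)%:R - M k j| < 1) -> M \in unitmx.
Proof.
move=> dom; rewrite -unitmx_tr unitmxE unitfE; apply/negP => /det0P[v v0 vM].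
have /rV0Pn[k vk] := v0.
pose m := [arg max_(j > k) `|v ord0 j|]%O.
have vm j : `|v ord0 j| <= `|v ord0 m|.
  by rewrite /m; case: arg_maxP => // i _; apply.
have vm0 : 0 < `|v ord0 m| by apply: lt_le_trans (vm k); rewrite normr_gt0.
have: `|v ord0 m| <= \sum_j `|(m == j)%:R - M m j| * `|v ord0 m|.
  have {1}-> : v ord0 m = \sum_j ((m == j)%:R - M m j) * v ord0 j.
    under eq_bigr do rewrite mulrBl.
    rewrite sumrB (bigD1 m) //= eqxx mul1r big1 ?addr0; last first.
      by move=> j; rewrite eq_sym => /negPf->; rewrite mul0r.
    move/rowP: vM => /(_ m); rewrite !mxE => vM.
    rewrite [X in _ - X](_ : _ = 0) ?subr0 // -[RHS]vM.
    by apply: eq_bigr => j _; rewrite mxE mulrC.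
  apply: le_trans (ler_norm_sum _ _ _) _; apply: ler_sum => j _.
  by rewrite normrM ler_wpM2l.
by rewrite -mulr_suml leNgt gtr_pMl // dom.
Qed.

Section BanachFixpoint.
Import interval_inference topology normedtype sequences.
Import numFieldNormedType.Exports.

(** Joins the complete and the normed structures of matrices, as Banach's theorem requires. *)
HB.instance Definition _ (R : realType) (m n : nat) := Complete.on 'M[R]_(m, n).

(** With ratio 1/2, moving the centre by at most half the radius keeps the ball stable, so that
Banach's theorem applies to the ball. *)
Lemma contraction_fixpoint_in_ball (R : realType)
    (V : completeNormedModType R) (T : V -> V) (x0 : V) (r : R) :
    0 <= r ->
    (forall x y, `|x - x0| <= r -> `|y - x0| <= r ->
       `|T x - T y| <= 2^-1 * `|x - y|) ->
    `|T x0 - x0| <= 2^-1 * r ->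
  exists2 x, `|x - x0| <= r & T x = x.
Proof.
move=> r0 lipT Tx0.
pose U : set V := [set x | `|x - x0| <= r]%classic.
have UT : set_fun U U T.
  move=> x Ux; rewrite /U /=.
  have -> : T x - x0 = (T x - T x0) + (T x0 - x0) by rewrite addrA subrK.
  apply: le_trans (ler_normD _ _) _.
  rewrite -[leRHS]mul1r [1]splitr mulrDl mul1r lerD //.
  apply: le_trans (lipT x x0 _ _) _ => //; first by rewrite subrr normr0.
  by rewrite ler_wpM2l // invr_ge0.
have closedU : closed U.
  apply: (preimage_closed _ (@closed_le _ r)) => x _.
  by apply: cvg_norm; apply: cvgB; [exact: cvg_id|exact: cvg_cst].
have half_itv : (0 <= (2^-1 : R)) by rewrite invr_ge0.
have contrT : is_contraction (mkfun_fun UT).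
  exists (NngNum half_itv); split=> /=; first by rewrite invf_lt1 ?ltr1n.
  by move=> [x y] [/= Ux Uy]; exact: lipT.
have [||x Ux xE] := banach_fixed_point contrT; first exact: closedU.
  by exists x0; rewrite /U /= subrr normr0.
by exists x.
Qed.

Lemma row_norm_leP (R : realType) (n : nat) (x : 'rV[R]_n) (r : R) :
  0 <= r -> reflect (forall j, `|x ord0 j| <= r) (`|x| <= r).
Proof.
move=> r0; rewrite [`|x|]mx_normrE; apply: (iffP (bigmax_leP _ _ _ _)).
  by case=> _ xr j; exact: (xr (ord0, j)).
by move=> xr; split=> // -[i j] _; rewrite /= (ord1 i).
Qed.

(** The sup norm is the norm of row vectors; spelled out, all the hypotheses are inequalities
between real numbers. *)
Lemma sup_contraction_fixpoint (R : realType) (n : nat)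
    (T : 'rV[R]_n -> 'rV[R]_n) (x0 : 'rV[R]_n) (r : R) :
    0 <= r ->
    (forall (x y : 'rV[R]_n) (d : R), (forall j, `|x ord0 j - x0 ord0 j| <= r) ->
       (forall j, `|y ord0 j - x0 ord0 j| <= r) ->
       (forall j, `|x ord0 j - y ord0 j| <= d) ->
       forall j, `|T x ord0 j - T y ord0 j| <= 2^-1 * d) ->
    (forall j, `|T x0 ord0 j - x0 ord0 j| <= 2^-1 * r) ->
  exists2 x : 'rV[R]_n, forall j, `|x ord0 j - x0 ord0 j| <= r & T x = x.
Proof.
move=> r0 lipT Tx0.
have coord (x y : 'rV[R]_n) d : 0 <= d ->
    `|x - y| <= d <-> forall j, `|x ord0 j - y ord0 j| <= d.
  move=> d0; split=> [/(row_norm_leP _ d0) xy j|xy].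
    by have := xy j; rewrite !mxE.
  by apply/row_norm_leP => // j; rewrite !mxE.
have [x y xr yr||x xr Tx] := @contraction_fixpoint_in_ball R 'rV[R]_n T x0 r r0.
- apply/coord; first by rewrite mulr_ge0 ?invr_ge0.
  by apply: lipT; [exact/coord|exact/coord|exact/coord].
- by apply/coord => //; rewrite mulr_ge0 ?invr_ge0.
- by exists x => //; exact/coord.
Qed.

End BanachFixpoint.

(** The table and the check use the binary integers, which compute fast. *)
Definition ZtoR (R : pzRingType) (z : Z) : R := (int_of_Z z)%:~R.

Section ZtoR.
Variable R : pzRingType.
Lemma ZtoR0 : ZtoR R 0%ZZ = 0. Proof. by []. Qed.
Lemma ZtoRD a b : ZtoR R (a + b)%ZZ = ZtoR R a + ZtoR R b.
Proof. by rewrite /ZtoR (rmorphD int_of_Z) rmorphD. Qed.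
Lemma ZtoRM a b : ZtoR R (a * b)%ZZ = ZtoR R a * ZtoR R b.
Proof. by rewrite /ZtoR (rmorphM int_of_Z) rmorphM. Qed.
Lemma ZtoRN a : ZtoR R (- a)%ZZ = - ZtoR R a.
Proof. by rewrite /ZtoR (rmorphN int_of_Z) rmorphN. Qed.
Lemma ZtoRB a b : ZtoR R (a - b)%ZZ = ZtoR R a - ZtoR R b.
Proof. by rewrite /Z.sub ZtoRD ZtoRN. Qed.
End ZtoR.

Lemma ltr_ZtoR (R : numDomainType) (a b : Z) :
  (ZtoR R a < ZtoR R b) = (a <? b)%ZZ.
Proof. by rewrite /ZtoR ltr_int; zify. Qed.
Lemma ler_ZtoR (R : numDomainType) (a b : Z) :
  (ZtoR R a <= ZtoR R b) = (a <=? b)%ZZ.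
Proof. by rewrite /ZtoR ler_int; zify. Qed.
Lemma ZtoR_norm (R : numDomainType) a : ZtoR R (Z.abs a) = `|ZtoR R a|.
Proof.
rewrite /ZtoR -intr_norm; congr (_%:~R); case: a => //= p; rewrite NegzE normrN.
by rewrite prednK //; apply/ssrnat.ltP/Pos2Nat.is_pos.
Qed.

(** The coefficient c and the indices (i, j) of c x_i x_j. *)
Definition monomial : Type := Z * (nat * nat).
Definition quadric : Type := seq monomial.

(** The bilinear form given by the monomials as they are written, without symmetrization. Only
[polar q x x], the value of the quadratic form at [x], does not depend on this choice. *)
Definition polar (R : pzRingType) (q : quadric) (x y : nat -> R) : R :=
  \sum_(m <- q) ZtoR R m.1 * (x m.2.1 * y m.2.2).

Definition jacobian (R : pzRingType) (q : quadric) (x : nat -> R) (j : nat) : R :=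
  \sum_(m <- q) ZtoR R m.1 * ((m.2.1 == j)%:R * x m.2.2 + (m.2.2 == j)%:R * x m.2.1).

(** The factor that bounds [polar q x y] by the product of the sup norms of [x] and [y]. *)
Definition weight (R : numDomainType) (q : quadric) : R := \sum_(m <- q) `|ZtoR R m.1|.

Lemma polar_sub (R : comPzRingType) (q : quadric) (x y : nat -> R) :
  polar q x x - polar q y y =
  polar q (fun i => x i - y i) y + polar q x (fun i => x i - y i).
Proof.
rewrite /polar -sumrB -big_split /=; apply: eq_bigr => m _; ring.
Qed.

(** A quadratic form has a constant second derivative, so the error made by replacing a
difference quotient by the derivative at the centre of a box is at most linear in its radius. This
spares any differential calculus. *)
Lemma polar_linearization (R : realDomainType) (n : nat) (q : quadric)
    (x0 x y e : nat -> R) (r d : R) :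
    (forall i, `|x i - x0 i| <= r) -> (forall i, `|y i - x0 i| <= r) ->
    (forall i, `|e i| <= d) -> (forall i, (n <= i)%N -> e i = 0) ->
  `|polar q e y + polar q x e - \sum_(j < n) jacobian q x0 j * e j|
    <= 2 * r * weight R q * d.
Proof.
move=> xr yr er e0.
have pick (i : nat) (c : R) : \sum_(j < n) (i == j)%:R * c * e j = c * e i.
  have [lt_in|le_ni] := ltnP i n.
    rewrite (bigD1 (Ordinal lt_in)) //= eqxx mul1r big1 ?addr0 // => j.
    by rewrite -val_eqE eq_sym /= => /negPf->; rewrite !mul0r.
  rewrite e0 // mulr0 big1 // => j _.
  by rewrite (_ : (i == j) = false) ?mul0r // gtn_eqF // (leq_trans (ltn_ord j)).
have -> : \sum_(j < n) jacobian q x0 j * e j = polar q e x0 + polar q x0 e.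
  under eq_bigr do rewrite /jacobian mulr_suml.
  rewrite exchange_big /polar -big_split /=; apply: eq_bigr => m _.
  under eq_bigr do rewrite -mulrA mulrDl mulrDr.
  by rewrite big_split /= -!mulr_sumr !pick; ring.
rewrite /polar -!big_split -sumrB /= /weight mulr_sumr mulr_suml.
apply: le_trans (ler_norm_sum _ _ _) _; apply: ler_sum => m _.
have -> (c a b a' b' a0 b0 : R) :
  c * (a * b') + c * (a' * b) - (c * (a * b0) + c * (a0 * b)) = c * (a * (b' - b0) + (a' - a0) * b) by ring.
rewrite normrM mulrAC [leRHS]mulrC ler_wpM2l //.
apply: le_trans (ler_normD _ _) _; rewrite !normrM.
have -> : 2 * r * d = d * r + r * d by ring.
by apply: lerD; apply: ler_pM.
Qed.

(** The simplified Newton map x - (A / D) F(x), for an approximate inverse A / D of the Jacobian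
at [x0], contracts the box of radius [r] by 1/2 (first inequality) and preserves it (second one).
Its fixed point is a zero of F because A is invertible: A times the Jacobian is close to D times
the identity. The coordinates from [n] on are parameters; one of them will homogenize the equations. *)
Theorem quadrics_newton (R : realType) (n : nat) (Q : nat -> quadric)
    (A : nat -> nat -> R) (D r : R) (x0 : nat -> R) :
    0 < D -> 0 <= r ->
    (forall k, (k < n)%N ->
       2 * (\sum_(j < n) `|D * (k == j)%:R - \sum_(l < n) A k l * jacobian (Q l) x0 j|
            + 2 * r * \sum_(l < n) `|A k l| * weight R (Q l)) <= D) ->
    (forall k, (k < n)%N ->
       2 * `|\sum_(l < n) A k l * polar (Q l) x0 x0| <= r * D) ->
  exists x : nat -> R,
    [/\ forall k, `|x k - x0 k| <= r, forall k, (n <= k)%N -> x k = x0 k &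
        forall l, (l < n)%N -> polar (Q l) x x = 0].
Proof.
move=> D0 r0 contr small.
have Dn : `|D^-1| = D^-1 by rewrite ger0_norm // invr_ge0 ltW.
pose F (l : nat) (x : nat -> R) := polar (Q l) x x.
pose coord (x : 'rV[R]_n) (i : nat) : R := if insub i is Some j then x ord0 j else x0 i.
have coordE (x : 'rV[R]_n) (j : 'I_n) : coord x j = x ord0 j by rewrite /coord valK.
have coord_ge x i : (n <= i)%N -> coord x i = x0 i.
  by move=> ni; rewrite /coord insubF // ltnNge ni.
pose T (x : 'rV[R]_n) : 'rV[R]_n :=
  \row_k (x ord0 k - D^-1 * \sum_(l < n) A k l * F l (coord x)).
pose v0 : 'rV[R]_n := \row_k x0 k.
have coord_near (x : 'rV[R]_n) s i : 0 <= s ->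
    (forall j, `|x ord0 j - v0 ord0 j| <= s) -> `|coord x i - x0 i| <= s.
  move=> s0 xs; have [lt_in|le_ni] := ltnP i n; last by rewrite coord_ge // subrr normr0.
  by have := xs (Ordinal lt_in); rewrite -coordE mxE.
have coord_v0 i : coord v0 i = x0 i.
  apply/eqP; rewrite -subr_eq0 -normr_le0; apply: coord_near => // j.
  by rewrite subrr normr0.
have F_v0 l : F l (coord v0) = F l x0 by apply: eq_bigr => m _; rewrite !coord_v0.
have Anonneg k : 0 <= \sum_(l < n) `|A k l| * weight R (Q l).
  by apply: sumr_ge0 => l _; rewrite mulr_ge0 // sumr_ge0.
have [||x xr Tx] := @sup_contraction_fixpoint R n T v0 r r0.
- move=> x y d xr yr xyd k.
  have d0 : 0 <= d by apply: le_trans (xyd k).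
  set e := fun i => coord x i - coord y i.
  have ed i : `|e i| <= d.
    rewrite /e; have [lt_in|le_ni] := ltnP i n; last by rewrite !coord_ge // subrr normr0.
    by have := xyd (Ordinal lt_in); rewrite -!coordE.
  have e_ge i : (n <= i)%N -> e i = 0 by move=> ni; rewrite /e !coord_ge // subrr.
  rewrite !mxE.
  have -> : x ord0 k - D^-1 * (\sum_(l < n) A k l * F l (coord x)) -
      (y ord0 k - D^-1 * (\sum_(l < n) A k l * F l (coord y))) =
      D^-1 * (\sum_(j < n) (D * (k == j)%:R - \sum_(l < n) A k l * jacobian (Q l) x0 j) * e j
       - \sum_(l < n) A k l * (polar (Q l) e (coord y) + polar (Q l) (coord x) e
            - \sum_(j < n) jacobian (Q l) x0 j * e j)).
    have -> : \sum_(l < n) A k l * (polar (Q l) e (coord y) + polar (Q l) (coord x) e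
            - \sum_(j < n) jacobian (Q l) x0 j * e j) =
        \sum_(l < n) A k l * F l (coord x) - \sum_(l < n) A k l * F l (coord y)
        - \sum_(j < n) (\sum_(l < n) A k l * jacobian (Q l) x0 j) * e j.
      under [X in _ = _ - X]eq_bigr do rewrite mulr_suml.
      rewrite exchange_big -!sumrB; apply: eq_bigr => l _ /=.
      rewrite -polar_sub mulrBr mulr_sumr -mulrBr; congr (_ - _).
      by apply: eq_bigr => j _; rewrite mulrA.
    under [X in _ = _ * (X - _)]eq_bigr do rewrite mulrBl.
    rewrite [X in _ = _ * (X - _)]sumrB.
    have -> : \sum_(j < n) D * (k == j)%:R * e j = D * e k.
      rewrite (bigD1 k) //= eqxx mulr1 big1 ?addr0 // => j.
      by rewrite eq_sym => /negPf ->; rewrite mulr0 mul0r.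
    rewrite /e !coordE; field; exact: lt0r_neq0.
  rewrite normrM Dn [leLHS]mulrC ler_pdivrMr //.
  apply: le_trans (ler_normB _ _) _.
  have := contr k (ltn_ord k); rewrite -ler_pdivlMl // => /(ler_wpM2r d0).
  rewrite [X in _ <= X -> _]mulrAC; apply: le_trans.
  rewrite [leRHS]mulrDl; apply: lerD.
    rewrite mulr_suml; apply: le_trans (ler_norm_sum _ _ _) _.
    by apply: ler_sum => j _; rewrite normrM ler_wpM2l // ed.
  apply: le_trans (ler_norm_sum _ _ _) _.
  rewrite mulr_sumr mulr_suml; apply: ler_sum => l _; rewrite normrM.
  have -> : 2 * r * (`|A k l| * weight R (Q l)) * d = `|A k l| * (2 * r * weight R (Q l) * d) by ring.
  by apply: ler_wpM2l => //; apply: polar_linearization => // i; exact: coord_near.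
- move=> k; rewrite !mxE.
  rewrite addrAC subrr sub0r normrN normrM Dn [leLHS]mulrC ler_pdivrMr //.
  rewrite -mulrA ler_pdivlMl //; apply: le_trans (small k (ltn_ord k)).
  by under eq_bigr => l _ do rewrite F_v0.
exists (coord x); split=> [k|k|l ln]; [exact: coord_near|exact: coord_ge|].
pose MA : 'M[R]_n := \matrix_(k, l) (D^-1 * A k l).
pose MJ : 'M[R]_n := \matrix_(l, j) jacobian (Q l) x0 j.
have unitA : MA \in unitmx.
  suff : MA *m MJ \in unitmx by rewrite unitmx_mul => /andP[].
  apply: diag_dominant_unit => k.
  apply: (@le_lt_trans _ _ (2^-1)); last by rewrite invf_lt1 ?ltr1n.
  have -> : \sum_(j < n) `|(k == j)%:R - (MA *m MJ) k j| =
     D^-1 * \sum_(j < n) `|D * (k == j)%:R - \sum_(l < n) A k l * jacobian (Q l) x0 j|.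
    rewrite mulr_sumr; apply: eq_bigr => j _.
    rewrite -[X in _ = X * _]Dn -normrM mulrBr mulrA mulVf ?lt0r_neq0 // mul1r mxE mulr_sumr.
    by congr (`|_ - _|); apply: eq_bigr => l' _; rewrite !mxE mulrA.
  rewrite [leLHS]mulrC ler_pdivrMr // ler_pdivlMl //.
  apply: le_trans (contr k (ltn_ord k)); rewrite ler_wpM2l // lerDl.
  by rewrite mulr_ge0 ?mulr_ge0.
pose vF : 'cV[R]_n := \col_l F l (coord x).
have AF : MA *m vF = 0.
  apply/colP => k; rewrite !mxE.
  have /rowP/(_ k) := Tx; rewrite mxE => /eqP.
  rewrite -subr_eq0 addrAC subrr sub0r oppr_eq0 => /eqP Ek; rewrite -[RHS]Ek.
  by rewrite mulr_sumr; apply: eq_bigr => l' _; rewrite !mxE mulrA.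
have vF0 : vF = 0 by rewrite -[vF](mulKmx unitA) AF mulmx0.
have /colP/(_ (Ordinal ln)) := vF0; by rewrite !mxE.
Qed.

(** * The numerical check *)

Section Checker.
Local Open Scope nat_scope.

Definition sumZ (s : seq Z) : Z := foldr Z.add 0%ZZ s.
Definition entry (s : seq Z) (i : nat) : Z := nth 0%ZZ s i.
Definition entry2 (M : seq (seq Z)) (i j : nat) : Z := entry (nth [::] M i) j.

(** Numbers of binary digits after the point, during the elimination and in its result. *)
Definition precision : Z := 22%ZZ.
Definition inverse_precision : Z := 15%ZZ.

Definition pivot_tail (r : seq Z) : seq Z :=
  let q := (Z.shiftl 1 (2 * precision) / head 0 r)%ZZ in
  [seq (if x =? 0 then 0 else Z.shiftr (x * q) precision)%ZZ | x <- behead r].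

Definition eliminate (p r : seq Z) : seq Z :=
  let h := head 0%ZZ r in
  if (h =? 0)%ZZ then behead r
  else [seq (if xy.2 =? 0 then xy.1 else xy.1 - Z.shiftr (h * xy.2) precision)%ZZ | xy <- zip (behead r) p].

Fixpoint largest_first (rows : seq (seq Z)) : seq (seq Z) :=
  if rows is r :: rows' then
    match largest_first rows' with
    | r' :: rows'' =>
      if (Z.abs (head 0 r) <? Z.abs (head 0 r'))%ZZ then r' :: r :: rows'' else r :: r' :: rows''
    | [::] => [:: r]
    end
  else [::].

(** Fixed-point arithmetic gives only an approximate inverse; its quality is measured afterwards
by [defect], so that nothing has to be proved about the elimination. The first [keep] pivots are
taken in the given order, the columns of the entries of T having large pivots there already. *)
Fixpoint gauss_jordan (keep todo : nat) (rest done : seq (seq Z)) : seq (seq Z) :=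
  if todo is n.+1 then
    match (if keep is 0 then largest_first rest else rest) with
    | r :: rest' =>
      let p := pivot_tail r in
      gauss_jordan keep.-1 n (map (eliminate p) rest') (rcons (map (eliminate p) done) p)
    | [::] => done
    end
  else done.

Definition approx_inverse (keep n : nat) (sc : Z) (M : seq (seq Z)) : seq (seq Z) :=
  let rows := [seq [seq (Z.shiftl (entry2 M i j) precision / sc)%ZZ | j <- iota 0 n] ++
     [seq (if i == j then Z.shiftl 1 precision else 0)%ZZ | j <- iota 0 n] | i <- iota 0 n] in
  [seq [seq Z.shiftr x (precision - inverse_precision) | x <- r] | r <- gauss_jordan keep n rows [::]].

Definition dotZ (n : nat) (f g : nat -> Z) : Z := sumZ [seq (f i * g i)%ZZ | i <- iota 0 n].

(** Compared with D, tells how far A / D is from an inverse of M, in the sup norm. *)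
Definition defect (n : nat) (D : Z) (A M : seq (seq Z)) (k : nat) : Z :=
  sumZ [seq
    Z.abs ((if k == j then D else 0) - dotZ n (entry (nth [::] A k)) (entry2 M ^~ j))%ZZ | j <- iota 0 n].

Definition invertible_check (n : nat) (M : seq (seq Z)) : bool :=
  let D := Z.shiftl 1 inverse_precision in
  let A := approx_inverse 0 n 1 M in
  all (fun k => (defect n D A M k <? D)%ZZ) (iota 0 n).

Definition polarZ (q : quadric) (x : seq Z) : Z :=
  sumZ [seq (m.1 * (entry x m.2.1 * entry x m.2.2))%ZZ | m <- q].
Definition jacobianZ (q : quadric) (x : seq Z) (j : nat) : Z :=
  sumZ [seq (m.1 * ((if m.2.1 == j then entry x m.2.2 else 0)
                   + (if m.2.2 == j then entry x m.2.1 else 0)))%ZZ | m <- q].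
Definition weightZ (q : quadric) : Z := sumZ [seq Z.abs m.1 | m <- q].

Definition newton_check (keep : nat) (Q : seq quadric) (x : seq Z) (sc r : Z) : bool :=
  let n := size Q in
  let J := [seq [seq jacobianZ q x j | j <- iota 0 n] | q <- Q] in
  let F := [seq polarZ q x | q <- Q] in
  let w := [seq weightZ q | q <- Q] in
  let D := Z.shiftl sc inverse_precision in
  let A := approx_inverse keep n sc J in
  [&& (0 <? D)%ZZ, (0 <=? r)%ZZ &
      all (fun k => let a := nth [::] A k in
        (2 * (defect n D A J k + 2 * r * sumZ [seq Z.abs (entry a l) * entry w l | l <- iota 0 n]) <=? D)%ZZ
        && (2 * Z.abs (dotZ n (entry a) (entry F)) <=? r * D)%ZZ) (iota 0 n)].

(** The product of x_i, of the sign s and of the entry (j, h) of G S, where S is the secant matrix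
of (v, u, 1). The unknowns are x_0, x_1 (the first row of T), x_2 = u, x_3 = v, x_4 = w, x_5 = z;
all are multiplied by the scale x_6, which makes the equations homogeneous. *)
Definition linear_monomials (G : seq (seq Z)) (h j i : nat) (s : Z) : quadric :=
  [:: ((s * entry2 G j h)%ZZ, (3, i)); ((s * entry2 G j h.+1)%ZZ, (2, i));
      ((s * entry2 G j h.+2)%ZZ, (6, i))].

(** The entries of G S = S' T, where S' is the secant matrix of (z, w, 1). The last row says that
the second row of T is the last row of G S, which eliminates it from the other rows. *)
Definition secant_forms (G : seq (seq Z)) : seq quadric :=
  [:: linear_monomials G 0 2 6 1%ZZ ++ ((-1)%ZZ, (0, 6)) :: linear_monomials G 0 3 4 (-1)%ZZ;
      linear_monomials G 1 2 6 1%ZZ ++ ((-1)%ZZ, (1, 6)) :: linear_monomials G 1 3 4 (-1)%ZZ;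
      linear_monomials G 0 0 6 1%ZZ ++ [:: ((-1)%ZZ, (0, 5))];
      linear_monomials G 0 1 6 1%ZZ ++ ((-1)%ZZ, (0, 4)) :: linear_monomials G 0 3 5 (-1)%ZZ;
      linear_monomials G 1 0 6 1%ZZ ++ [:: ((-1)%ZZ, (1, 5))];
      linear_monomials G 1 1 6 1%ZZ ++ ((-1)%ZZ, (1, 4)) :: linear_monomials G 1 3 5 (-1)%ZZ].

(** The real and imaginary parts of unknown i become the unknowns 2 i and 2 i + 1. *)
Definition real_part (q : quadric) : quadric :=
  flatten [seq [:: (m.1, (m.2.1.*2, m.2.2.*2)); ((- m.1)%ZZ, (m.2.1.*2.+1, m.2.2.*2.+1))] | m <- q].
Definition imag_part (q : quadric) : quadric :=
  flatten [seq [:: (m.1, (m.2.1.*2, m.2.2.*2.+1)); (m.1, (m.2.1.*2.+1, m.2.2.*2))] | m <- q].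

(** The matrix G, the scale, the real solutions and one nonreal solution of each conjugate pair,
multiplied by the scale and rounded. *)
Definition certificate : Type := seq (seq Z) * Z * seq (seq Z) * seq (seq Z).

(** The distance allowed between a rounded solution and the exact one. *)
Definition radius : Z := 2%ZZ.

Definition discZ (sc b a : Z) : Z := (b * b - 4 * sc * a)%ZZ.
(** Bounds the variation of [discZ] when its arguments move by at most [radius]. *)
Definition disc_error (sc b : Z) : Z := (2 * Z.abs b * radius + radius * radius + 4 * sc * radius)%ZZ.

Definition real_check (G : seq (seq Z)) (sc : Z) (x : seq Z) : bool :=
  [&& size x == 6, newton_check 2 (secant_forms G) (rcons x sc) sc radius,
      (disc_error sc (entry x 2) <? Z.abs (discZ sc (entry x 2) (entry x 3)))%ZZ &
      (disc_error sc (entry x 4) <? Z.abs (discZ sc (entry x 4) (entry x 5)))%ZZ].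

Definition complex_disc_check (sc b1 b2 a1 a2 : Z) : bool :=
  let e := (2 * (Z.abs b1 + Z.abs b2) * radius + 2 * radius * radius + 4 * sc * radius)%ZZ in
  (e <? Z.abs (b1 * b1 - b2 * b2 - 4 * sc * a1))%ZZ || (e <? Z.abs (2 * b1 * b2 - 4 * sc * a2))%ZZ.

Definition complex_check (G : seq (seq Z)) (sc : Z) (x : seq Z) : bool :=
  [&& size x == 12,
      newton_check 4 (flatten [seq [:: real_part q; imag_part q] | q <- secant_forms G])
        (rcons x sc) sc radius,
      complex_disc_check sc (entry x 4) (entry x 5) (entry x 6) (entry x 7),
      complex_disc_check sc (entry x 8) (entry x 9) (entry x 10) (entry x 11) &
      (radius <? entry x 5)%ZZ].

(** Exact solutions within the radius of two separated approximations are distinct. *)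
Definition separated (idx : seq nat) (x y : seq Z) : bool :=
  has (fun i => (2 * radius <? Z.abs (entry x i - entry y i))%ZZ) idx.

Definition wedge_table (G : seq (seq Z)) : seq (seq Z) :=
  let A := syzygy_pencil (entry2 G : nat -> nat -> Z) in
  [seq [seq wedge_coef (A 1) (A 0) m p | p <- iota 0 10] | m <- iota 0 10].

Definition check (c : certificate) : bool :=
  let: (G, sc, rs, cs) := c in
  [&& (radius <? sc)%ZZ, size G == 4,
      size rs + size cs * 2 == 10,
      invertible_check 4 G, invertible_check 10 (wedge_table G),
      all (real_check G sc) rs, all (complex_check G sc) cs,
      pairwise (separated [:: 2; 3]) rs & pairwise (separated [:: 4; 5; 6; 7]) cs].

Definition real_signs (sc : Z) (x : seq Z) : bool * bool :=
  ((0 <? discZ sc (entry x 2) (entry x 3))%ZZ, (0 <? discZ sc (entry x 4) (entry x 5))%ZZ).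

Definition kinds (c : certificate) : nat * nat * nat :=
  let: (G, sc, rs, cs) := c in
  let t := [seq real_signs sc x | x <- rs] in
  (count_mem (true, true) t, count (fun p => p.1 (+) p.2) t, count_mem (false, false) t).

End Checker.

(** * Soundness of the check *)

HB.instance Definition _ (R : pzRingType) :=
  GRing.RMorphism.copy (ZtoR R) (intr \o int_of_Z : Z -> R).

Section Casts.
Variable R : pzRingType.

Lemma ZtoR_sumZ (T : Type) (f : T -> Z) (s : seq T) :
  ZtoR R (sumZ [seq f x | x <- s]) = \sum_(x <- s) ZtoR R (f x).
Proof. by elim: s => [|x s IHs]; rewrite ?big_nil ?big_cons //= ZtoRD IHs. Qed.

Lemma ZtoR_sumZ_iota (f : nat -> Z) (n : nat) :
  ZtoR R (sumZ [seq f i | i <- iota 0 n]) = \sum_(i < n) ZtoR R (f i).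
Proof. by rewrite ZtoR_sumZ -(big_mkord xpredT (ZtoR R \o f)) /index_iota subn0. Qed.

Lemma ZtoR_dotZ (n : nat) (f g : nat -> Z) :
  ZtoR R (dotZ n f g) = \sum_(i < n) ZtoR R (f i) * ZtoR R (g i).
Proof. by rewrite ZtoR_sumZ_iota; apply: eq_bigr => i _; rewrite ZtoRM. Qed.

Lemma ZtoR_if (b : bool) (x : Z) : ZtoR R (if b then x else 0%ZZ) = b%:R * ZtoR R x.
Proof. by case: b; rewrite ?mul1r ?mul0r. Qed.

End Casts.

Lemma ZtoR_defect (R : numDomainType) (n : nat) (D : Z) (A M : seq (seq Z)) (k : nat) :
  ZtoR R (defect n D A M k) =
  \sum_(j < n) `|ZtoR R D * (k == j)%:R
                 - \sum_(l < n) ZtoR R (entry2 A k l) * ZtoR R (entry2 M l j)|.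
Proof.
rewrite ZtoR_sumZ_iota; apply: eq_bigr => j _.
by rewrite ZtoR_norm ZtoRB ZtoR_dotZ ZtoR_if mulrC.
Qed.

(** A product of two square matrices close to a multiple of the identity makes both invertible. *)
Lemma invertible_check_sound (R : realFieldType) (n : nat) (M : seq (seq Z)) :
  invertible_check n M -> (\matrix_(i < n, j < n) ZtoR R (entry2 M i j)) \in unitmx.
Proof.
rewrite /invertible_check; set A := approx_inverse _ _ _ _; set D := Z.shiftl _ _.
move=> /allP dom.
have D0 : 0 < ZtoR R D by rewrite -[0](ZtoR0 R) ltr_ZtoR.
pose MA : 'M[R]_n := \matrix_(k, l) ((ZtoR R D)^-1 * ZtoR R (entry2 A k l)).
suff : MA *m \matrix_(i < n, j < n) ZtoR R (entry2 M i j) \in unitmx.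
  by rewrite unitmx_mul => /andP[].
apply: diag_dominant_unit => k.
have := dom k; rewrite mem_iota /= add0n => /(_ (ltn_ord k)).
rewrite -(ltr_ZtoR R) ZtoR_defect -[X in _ < X]mulr1 -ltr_pdivrMl // mulr_sumr.
apply: le_lt_trans; apply: ler_sum => j _.
have Dn : `|(ZtoR R D)^-1| = (ZtoR R D)^-1 by rewrite gtr0_norm ?invr_gt0.
rewrite -[X in _ <= X * _]Dn -normrM mulrBr mulrA mulVf ?lt0r_neq0 // mul1r.
rewrite mxE mulr_sumr.
under eq_bigr => l _ do rewrite !mxE -mulrA.
by rewrite lexx.
Qed.

Lemma ZtoR_polarZ (R : pzRingType) (q : quadric) (x : seq Z) :
  ZtoR R (polarZ q x) = polar q (fun i => ZtoR R (entry x i)) (fun i => ZtoR R (entry x i)).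
Proof. by rewrite ZtoR_sumZ; apply: eq_bigr => m _; rewrite !ZtoRM. Qed.

Lemma ZtoR_jacobianZ (R : pzRingType) (q : quadric) (x : seq Z) (j : nat) :
  ZtoR R (jacobianZ q x j) = jacobian q (fun i => ZtoR R (entry x i)) j.
Proof. by rewrite ZtoR_sumZ; apply: eq_bigr => m _; rewrite ZtoRM ZtoRD !ZtoR_if. Qed.

Lemma ZtoR_weightZ (R : numDomainType) (q : quadric) : ZtoR R (weightZ q) = weight R q.
Proof. by rewrite ZtoR_sumZ; apply: eq_bigr => m _; rewrite ZtoR_norm. Qed.

Lemma newton_check_sound (R : realType) (keep : nat) (Q : seq quadric) (x : seq Z) (sc r : Z) :
  newton_check keep Q x sc r ->
  exists y : nat -> R,
    [/\ forall k, `|y k - ZtoR R (entry x k)| <= ZtoR R r,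
        forall k, (size Q <= k)%N -> y k = ZtoR R (entry x k) &
        {in Q, forall q, polar q y y = 0}].
Proof.
rewrite /newton_check; set n := size Q.
set J := [seq [seq jacobianZ q x j | j <- iota 0 n] | q <- Q].
set F := [seq polarZ q x | q <- Q]; set w := [seq weightZ q | q <- Q].
set A := approx_inverse _ _ _ _; set D := Z.shiftl _ _.
have JE l j : (l < n)%N -> (j < n)%N -> entry2 J l j = jacobianZ (nth [::] Q l) x j.
  move=> ln jn; rewrite /entry2 /J (nth_map [::]) // /entry (nth_map 0%N) ?size_iota //.
  by rewrite nth_iota.
have FE l : (l < n)%N -> entry F l = polarZ (nth [::] Q l) x.
  by move=> ln; rewrite /entry /F (nth_map [::]).
have wE l : (l < n)%N -> entry w l = weightZ (nth [::] Q l).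
  by move=> ln; rewrite /entry /w (nth_map [::]).
case/and3P => D0 r0 /allP ok.
have [||||y [yr yn yQ]] := @quadrics_newton R n (nth [::] Q) (fun k l => ZtoR R (entry2 A k l))
   (ZtoR R D) (ZtoR R r) (fun i => ZtoR R (entry x i)).
- by rewrite -[0](ZtoR0 R) ltr_ZtoR.
- by rewrite -[0](ZtoR0 R) ler_ZtoR.
- move=> k kn; have /ok/andP[+ _] : k \in iota 0 n by rewrite mem_iota.
  rewrite -(ler_ZtoR R) ZtoRM ZtoRD ZtoR_defect !ZtoRM ZtoR_sumZ_iota.
  congr (_ * (_ + _ * _) <= _).
    apply: eq_bigr => j _; congr (`|_ - _|); apply: eq_bigr => l _.
    by rewrite JE // ZtoR_jacobianZ.
  by apply: eq_bigr => l _; rewrite ZtoRM ZtoR_norm wE // ZtoR_weightZ.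
- move=> k kn; have /ok/andP[_] : k \in iota 0 n by rewrite mem_iota.
  rewrite -(ler_ZtoR R) !ZtoRM ZtoR_norm ZtoR_dotZ.
  congr (_ * `|_| <= _); apply: eq_bigr => l _.
  by rewrite FE // ZtoR_polarZ.
exists y; split=> // q /(nthP [::])[l ln <-]; exact: yQ.
Qed.

Local Arguments Z.mul : simpl never.

Section Transfer.
Variables (K : fieldType) (G : seq (seq Z)).
Let g (i j : nat) : K := ZtoR K (entry2 G i j).

Lemma ZtoR1 : ZtoR K 1%ZZ = 1. Proof. by []. Qed.
Lemma ZtoRN1 : ZtoR K (-1)%ZZ = -1. Proof. by []. Qed.

(** Dividing the homogeneous equations by the square of the scale gives the transfer equation. *)
Lemma secant_forms_transfer (y : nat -> K) :
  y 6%N != 0 -> {in secant_forms G, forall q, polar q y y = 0} ->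
  exists T : 'M[K]_2,
    (\matrix_(i < 4, j < 4) g i j) *m secant_mx (y 3%N / y 6%N) (y 2%N / y 6%N) 1 =
    secant_mx (y 5%N / y 6%N) (y 4%N / y 6%N) 1 *m T.
Proof.
move=> s0 z.
have eqn l : (l < 6)%N -> polar (nth [::] (secant_forms G) l) y y = 0.
  by move=> l6; apply: z; rewrite mem_nth.
pose row j k := g j k * y 3%N + g j k.+1 * y 2%N + g j k.+2 * y 6%N.
have eA k : (k < 2)%N -> row 2 k * y 6%N - y k * y 6%N - row 3 k * y 4%N = 0.
  case: k => [|[|//]] _; [rewrite -[RHS](eqn 0%N isT)|rewrite -[RHS](eqn 1%N isT)];
    rewrite /polar /= !big_cons big_nil /= !ZtoRM ZtoR1 ?ZtoRN1 /row /g; ring.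
have eB k : (k < 2)%N -> row 0 k * y 6%N - y k * y 5%N = 0.
  case: k => [|[|//]] _; [rewrite -[RHS](eqn 2%N isT)|rewrite -[RHS](eqn 4%N isT)];
    rewrite /polar /= !big_cons big_nil /= !ZtoRM ZtoR1 ?ZtoRN1 /row /g; ring.
have eC k : (k < 2)%N -> row 1 k * y 6%N - y k * y 4%N - row 3 k * y 5%N = 0.
  case: k => [|[|//]] _; [rewrite -[RHS](eqn 3%N isT)|rewrite -[RHS](eqn 5%N isT)];
    rewrite /polar /= !big_cons big_nil /= !ZtoRM ZtoR1 ?ZtoRN1 /row /g; ring.
exists (\matrix_(i, j) if i == ord0 then y j / y 6%N else row 3 j / y 6%N).
apply/matrixP => i j; rewrite !mxE !big_ord_recr !big_ord0 /= !mxE /=.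
have lhs : 0 + g i 0 * (if (j <= 0)%N then [:: y 3%N / y 6%N; y 2%N / y 6%N; 1]`_(0 - j) else 0)
   + g i 1 * (if (j <= 1)%N then [:: y 3%N / y 6%N; y 2%N / y 6%N; 1]`_(1 - j) else 0)
   + g i 2 * (if (j <= 2)%N then [:: y 3%N / y 6%N; y 2%N / y 6%N; 1]`_(2 - j) else 0)
   + g i 3 * (if (j <= 3)%N then [:: y 3%N / y 6%N; y 2%N / y 6%N; 1]`_(3 - j) else 0)
   = row i j / y 6%N.
  by case: j => [[|[|//]] ?] /=; rewrite /row; field.
rewrite lhs.
have a : row 2%N j * y 6%N = y j * y 6%N + row 3%N j * y 4%N.
  by apply/eqP; rewrite -subr_eq0 opprD addrA; apply/eqP/eA.
have b : row 0%N j * y 6%N = y j * y 5%N by apply/eqP; rewrite -subr_eq0; apply/eqP/eB.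
have c : row 1%N j * y 6%N = y j * y 4%N + row 3%N j * y 5%N.
  by apply/eqP; rewrite -subr_eq0 opprD addrA; apply/eqP/eC.
have div (p q : K) : p * y 6%N = q -> p / y 6%N = q / (y 6%N * y 6%N) by move=> <-; field.
case: i {lhs} => [[|[|[|[|//]]]] ?] /=; rewrite ?(div _ _ a) ?(div _ _ b) ?(div _ _ c); by field.
Qed.

End Transfer.

Section Complexify.
Variable R : realType.
Local Notation C := R[i].

Lemma ZtoR_complex (z : Z) : (ZtoR R z)%:C = ZtoR C z.
Proof. by rewrite /ZtoR rmorph_int. Qed.

Lemma polar_real (q : quadric) (y : nat -> R) :
  polar q (fun i => (y i)%:C) (fun i => (y i)%:C) = (polar q y y)%:C.
Proof.
rewrite /polar rmorph_sum; apply: eq_bigr => m _.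
by rewrite !(rmorphM (real_complex R)) /= ZtoR_complex.
Qed.

Definition complex_point (y : nat -> R) (i : nat) : C := y i.*2 +i* y i.*2.+1.

Lemma polar_complex (q : quadric) (y : nat -> R) :
  polar q (complex_point y) (complex_point y) =
  polar (real_part q) y y +i* polar (imag_part q) y y.
Proof.
elim: q => [|m q IHq]; first by rewrite /polar /= !big_nil.
rewrite /polar /= !big_cons -/(polar _ _ _) -/(real_part q) -/(imag_part q).
rewrite -!/(polar _ _ _) IHq -ZtoR_complex /complex_point /= ZtoRN.
by apply/eqP; rewrite eq_complex /=; apply/andP; split; apply/eqP; ring.
Qed.

End Complexify.

Section Solutions.
Variables (R : realType) (G : seq (seq Z)) (sc : Z).
Local Notation C := R[i].
Let g (i j : nat) : R := ZtoR R (entry2 G i j).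
Let GR : 'M[R]_4 := \matrix_(i, j) g i j.
Local Notation s := (ZtoR R sc).
Local Notation rad := (ZtoR R radius).
Hypothesis sc_gt : (radius <? sc)%ZZ.

Lemma scale_gt0 : 0 < s.
Proof.
apply: lt_trans (_ : rad < s); last by rewrite ltr_ZtoR.
by rewrite -[0](ZtoR0 R) ltr_ZtoR.
Qed.

Lemma ZtoR_radius : rad = 2. Proof. by []. Qed.

Lemma sqr_near (x y : R) : `|x - y| <= rad -> `|x ^+ 2 - y ^+ 2| <= 2 * `|y| * rad + rad * rad.
Proof.
move=> xy; have -> : x ^+ 2 - y ^+ 2 = 2 * y * (x - y) + (x - y) * (x - y) by ring.
apply: le_trans (ler_normD _ _) _; rewrite !normrM (ger0_norm (_ : 0 <= 2)) //.
by apply: lerD; [apply: ler_wpM2l => //; rewrite mulr_ge0|apply: ler_pM].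
Qed.

Lemma disc_near (b a : R) (b0 a0 : Z) :
  `|b - ZtoR R b0| <= rad -> `|a - ZtoR R a0| <= rad ->
  `|(b ^+ 2 - 4 * s * a) - ZtoR R (discZ sc b0 a0)| <= ZtoR R (disc_error sc b0).
Proof.
move=> bb aa; rewrite /discZ /disc_error !(ZtoRB, ZtoRD, ZtoRM) ZtoR_norm.
have -> : ZtoR R 4%ZZ = 4 by [].
have -> : ZtoR R 2%ZZ = 2 by [].
have s4 : 0 <= 4 * s by rewrite mulr_ge0 // ltW // scale_gt0.
set b1 := ZtoR R b0 in bb *; set a1 := ZtoR R a0 in aa *.
have -> : b ^+ 2 - 4 * s * a - (b1 * b1 - 2 * 2 * s * a1) = (b ^+ 2 - b1 ^+ 2) - 4 * s * (a - a1) by ring.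
apply: le_trans (ler_normB _ _) _; apply: lerD; first exact: sqr_near.
by rewrite normrM (ger0_norm s4) ler_wpM2l.
Qed.

Lemma sign_of_near (x y e : R) : `|x - y| <= e -> e < `|y| -> if 0 < y then 0 < x else x < 0.
Proof.
rewrite ler_distl => /andP[x1 x2]; case: ifPn => [y0|]; first by rewrite gtr0_norm // => ?; lra.
by rewrite -leNgt => y0; rewrite ler0_norm // => ?; lra.
Qed.

(** The rounding error is smaller than the computed discriminant, so the signs agree. *)
Lemma disc_signP (b a : R) (b0 a0 : Z) :
  `|b - ZtoR R b0| <= rad -> `|a - ZtoR R a0| <= rad ->
  (disc_error sc b0 <? Z.abs (discZ sc b0 a0))%ZZ ->
  disc_sign (0 <? discZ sc b0 a0)%ZZ (a / s) (b / s).
Proof.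
move=> bb aa; rewrite -(ltr_ZtoR R) ZtoR_norm => /(sign_of_near (disc_near bb aa)).
rewrite -[X in X < _](ZtoR0 R) ltr_ZtoR /disc_sign.
have s0 := scale_gt0; have sn := lt0r_neq0 s0.
have -> : (b / s) ^+ 2 - 4 * (a / s) = (b ^+ 2 - 4 * s * a) / s ^+ 2 by field.
by case: ifP => _; rewrite ?pmulr_lgt0 ?pmulr_llt0 // invr_gt0 exprn_gt0.
Qed.

Definition near_data (x : seq Z) (i : nat) (c : R) : Prop := `|c * s - ZtoR R (entry x i)| <= rad.

Lemma map_GR : map_mx (real_complex R) GR = \matrix_(i < 4, j < 4) ZtoR C (entry2 G i j).
Proof. by apply/matrixP => i j; rewrite !mxE /g ZtoR_complex. Qed.

Lemma real_check_sound (x : seq Z) : real_check G sc x ->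
  exists uv : R * R, [/\ near_data x 2 uv.1, near_data x 3 uv.2 &
    secant_solution GR (Some (real_signs sc x), (uv.1%:C, uv.2%:C))].
Proof.
case/and4P => sz /(newton_check_sound R)[y [yr yn yQ]] d1 d2.
have s0 := scale_gt0; have sn := lt0r_neq0 s0.
have y6 : y 6%N = s by rewrite yn // /entry nth_rcons (eqP sz).
have near i : (i < 6)%N -> `|y i - ZtoR R (entry x i)| <= rad.
  by move=> i6; have := yr i; rewrite {1}/entry nth_rcons (eqP sz) i6.
pose yC i : C := (y i)%:C.
have y6C : yC 6%N != 0 by rewrite /yC y6 -(rmorph0 (real_complex R)) (inj_eq (@complexI R)).
have [q qQ|T GT] := @secant_forms_transfer C G yC y6C; first by rewrite polar_real yQ.
have div i : yC i / yC 6%N = (y i / s)%:C.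
  by rewrite /yC y6 (rmorphM (real_complex R)) (fmorphV (real_complex R)).
rewrite !div -map_GR in GT.
have S1 := disc_signP (near 2%N isT) (near 3%N isT) d1.
have S2 := disc_signP (near 4%N isT) (near 5%N isT) d2.
have discC (b a : R) r : disc_sign r a b -> (b%:C) ^+ 2 - 4 * (a%:C) != 0 :> C.
  move=> dr; have -> : (b%:C) ^+ 2 - 4 * (a%:C) = (b ^+ 2 - 4 * a)%:C :> C.
    by rewrite rmorphB (rmorphXn (real_complex R)) (rmorphM (real_complex R) 4) rmorph_nat.
  rewrite -(rmorph0 (real_complex R)) (inj_eq (@complexI R)).
  by case: r dr => /= dr; [rewrite gt_eqF|rewrite lt_eqF].
exists (y 2%N / s, y 3%N / s); split; [by rewrite /near_data /= divfK ?near..|].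
exists (y 4%N / s)%:C, (y 5%N / s)%:C; split; first by exists T.
- exact: discC S1.
- exact: discC S2.
by exists (y 2%N / s), (y 3%N / s), (y 4%N / s), (y 5%N / s).
Qed.

(** One of the real and imaginary parts of the computed discriminant exceeds the error. *)
Lemma complex_disc_checkP (b a : C) (b1 b2 a1 a2 : Z) :
  `|complex.Re b - ZtoR R b1| <= rad -> `|complex.Im b - ZtoR R b2| <= rad ->
  `|complex.Re a - ZtoR R a1| <= rad -> `|complex.Im a - ZtoR R a2| <= rad ->
  complex_disc_check sc b1 b2 a1 a2 -> (b / s%:C) ^+ 2 - 4 * (a / s%:C) != 0.
Proof.
move=> bb1 bb2 aa1 aa2 chk; have s0 := scale_gt0; have sn := lt0r_neq0 s0.
have sC : s%:C != 0 :> C by rewrite -(rmorph0 (real_complex R)) (inj_eq (@complexI R)).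
have -> : (b / s%:C) ^+ 2 - 4 * (a / s%:C) = (b ^+ 2 - 4 * s%:C * a) / s%:C ^+ 2.
  by move: (s%:C) sC => t t0; field.
apply: mulf_neq0; last by rewrite invr_eq0 expf_neq0.
apply/negP => /eqP disc0.
have s4 : 0 <= 4 * s by rewrite mulr_ge0 // ltW.
have far (x y : R) : x = 0 -> `|x - y| < `|y| -> False.
  by move=> ->; rewrite sub0r normrN ltxx.
move: disc0; case: b a bb1 bb2 aa1 aa2 => [b1' b2'] [a1' a2'] /= bb1 bb2 aa1 aa2.
rewrite expr2 => /eqP; rewrite eq_complex /= => /andP[/eqP re0 /eqP im0].
have E : ZtoR R (2 * (Z.abs b1 + Z.abs b2) * radius + 2 * radius * radius + 4 * sc * radius)%ZZ =
   2 * (`|ZtoR R b1| + `|ZtoR R b2|) * rad + 2 * rad * rad + 4 * s * rad.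
  by rewrite !(ZtoRD, ZtoRM) !ZtoR_norm.
have da1 : `|4 * s * (a1' - ZtoR R a1)| <= 4 * s * rad by rewrite normrM (ger0_norm s4) ler_wpM2l.
have da2 : `|4 * s * (a2' - ZtoR R a2)| <= 4 * s * rad by rewrite normrM (ger0_norm s4) ler_wpM2l.
case/orP: chk; rewrite -(ltr_ZtoR R) E ZtoR_norm !(ZtoRB, ZtoRM) => lt;
  [apply: (far _ _ re0)|apply: (far _ _ im0)];
  apply: le_lt_trans lt.
  have -> : ZtoR R 4%ZZ = 4 by [].
  set p := ZtoR R b1 in bb1 *; set q := ZtoR R b2 in bb2 *; set a0 := ZtoR R a1 in da1 *.
  rewrite [X in `|X| <= _](_ : _ =
    (b1' ^+ 2 - p ^+ 2) - (b2' ^+ 2 - q ^+ 2) - 4 * s * (a1' - a0)); last by ring.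
  apply: le_trans (ler_normB _ _) _; apply: lerD => //.
  apply: le_trans (ler_normB _ _) _.
  have := sqr_near bb1; have := sqr_near bb2; lra.
have -> : ZtoR R 4%ZZ = 4 by [].
have -> : ZtoR R 2%ZZ = 2 by [].
set p := ZtoR R b1 in bb1 *; set q := ZtoR R b2 in bb2 *; set a0 := ZtoR R a2 in da2 *.
rewrite [X in `|X| <= _](_ : _ =
  2 * (q * (b1' - p) + p * (b2' - q) + (b1' - p) * (b2' - q)) - 4 * s * (a2' - a0)); last by ring.
apply: le_trans (ler_normB _ _) _; apply: lerD => //.
rewrite normrM (ger0_norm (_ : 0 <= 2)) //.
have h1 : `|q * (b1' - p)| <= `|q| * rad by rewrite normrM ler_wpM2l.
have h2 : `|p * (b2' - q)| <= `|p| * rad by rewrite normrM ler_wpM2l.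
have h3 : `|(b1' - p) * (b2' - q)| <= rad * rad by rewrite normrM ler_pM.
have h4 := ler_normD (q * (b1' - p) + p * (b2' - q)) ((b1' - p) * (b2' - q)).
have h5 := ler_normD (q * (b1' - p)) (p * (b2' - q)).
move: h1 h2 h3; rewrite ZtoR_radius => h1 h2 h3; lra.
Qed.

(** G is real, so the transfer equation can be conjugated. *)
Lemma secant_solution_conj (u v : C) : secant_solution GR (None, (u, v)) ->
  secant_solution GR (None, (conjc u, conjc v)).
Proof.
case=> w [z [/= [T GT] d1 d2 nr]]; exists (conjc w), (conjc z); split=> /=.
- exists (map_mx (@conjc R) T); move/(congr1 (map_mx (@conjc R))): GT; rewrite !map_mxM.
  have conj_secant (a b : C) : map_mx (@conjc R) (secant_mx a b 1) = secant_mx (conjc a) (conjc b) 1.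
    apply/matrixP => i j; rewrite !mxE; case: ifP => _; last by rewrite rmorph0.
    by case: (i - j)%N => [|[|[|k]]] //=; rewrite ?nth_nil /= ?oppr0.
  have -> : map_mx (@conjc R) (map_mx (real_complex R) GR) = map_mx (real_complex R) GR.
    by apply/matrixP => i j; rewrite !mxE /= oppr0.
  by rewrite !conj_secant.
- have -> : conjc u ^+ 2 - 4 * conjc v = conjc (u ^+ 2 - 4 * v).
    by rewrite rmorphB (rmorphXn (@conjc R)) (rmorphM (@conjc R) 4) rmorph_nat.
  by rewrite conjc_eq0.
- have -> : conjc w ^+ 2 - 4 * conjc z = conjc (w ^+ 2 - 4 * z).
    by rewrite rmorphB (rmorphXn (@conjc R)) (rmorphM (@conjc R) 4) rmorph_nat.
  by rewrite conjc_eq0.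
by rewrite !conjcK => -[e1 e2]; apply: nr.
Qed.

(** The bound on the imaginary part of u makes the line nonreal; its sign also tells the solution
from the conjugates of all the others. *)
Lemma complex_check_sound (x : seq Z) : complex_check G sc x ->
  exists uv : C * C, [/\ near_data x 4 (complex.Re uv.1), near_data x 5 (complex.Im uv.1),
    near_data x 6 (complex.Re uv.2), near_data x 7 (complex.Im uv.2) &
    0 < complex.Im uv.1 /\ secant_solution GR (None, uv)].
Proof.
case/and5P => sz /(newton_check_sound R)[y [yr yn yQ]] d1 d2 im_pos.
have s0 := scale_gt0; have sn := lt0r_neq0 s0.
have yn' k : (12 <= k)%N -> y k = ZtoR R (entry (rcons x sc) k).
  by move=> k12; apply: yn.
have y12 : y 12%N = s by rewrite yn' // /entry nth_rcons (eqP sz).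
have y13 : y 13%N = 0 by rewrite yn' // /entry nth_rcons (eqP sz).
have near i : (i < 12)%N -> `|y i - ZtoR R (entry x i)| <= rad.
  by move=> i12; have := yr i; rewrite {1}/entry nth_rcons (eqP sz) i12.
pose yC := complex_point y.
have y6C : yC 6%N = s%:C by rewrite /yC /complex_point /= y12 y13.
have sC : s%:C != 0 :> C by rewrite -(rmorph0 (real_complex R)) (inj_eq (@complexI R)).
have y6C0 : yC 6%N != 0 by rewrite y6C.
have [q qQ|T GT] := @secant_forms_transfer C G yC y6C0.
  have zero p : p \in [:: real_part q; imag_part q] -> polar p y y = 0.
    move=> pq; apply: yQ; apply/flattenP; exists [:: real_part q; imag_part q] => //.
    exact: (map_f (fun q => [:: real_part q; imag_part q]) qQ).
  by rewrite polar_complex !zero ?inE ?eqxx ?orbT.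
rewrite y6C -map_GR in GT.
have divE (c : C) : c / s%:C = (complex.Re c / s) +i* (complex.Im c / s).
  case: c => c1 c2 /=; rewrite -(fmorphV (real_complex R)) /=.
  by apply/eqP; rewrite eq_complex /= !mulr0 subr0 add0r !eqxx.
have im_gt0 : 0 < complex.Im (yC 2%N / s%:C).
  rewrite divE /= divr_gt0 //.
  have := near 5%N isT; move: im_pos; rewrite -(ltr_ZtoR R) ler_distl => p /andP[q _].
  by apply: lt_le_trans q; rewrite subr_gt0.
exists (yC 2%N / s%:C, yC 3%N / s%:C); split; try by rewrite /near_data !divE /= divfK ?near.
split; first exact: im_gt0.
exists (yC 4%N / s%:C), (yC 5%N / s%:C); split; first by exists T.
- by apply: complex_disc_checkP d1; exact: near.
- by apply: complex_disc_checkP d2; exact: near.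
case=> _ /(congr1 (@complex.Im R)) e; move: im_gt0.
by case: (yC 2%N / s%:C) e => c1 c2 /= e; lra.
Qed.

End Solutions.

Lemma near_separated (R : realType) (sc : Z) (x y : seq Z) (i : nat) (a b : R) :
  near_data sc x i a -> near_data sc y i b ->
  (2 * radius <? Z.abs (entry x i - entry y i))%ZZ -> a <> b.
Proof.
rewrite /near_data => ax bx; rewrite -(ltr_ZtoR R) ZtoRM ZtoR_norm ZtoRB => lt e; subst b.
suff : ZtoR R 2 * ZtoR R radius < ZtoR R 2 * ZtoR R radius by rewrite ltxx.
apply: lt_le_trans lt _.
have -> : ZtoR R (entry x i) - ZtoR R (entry y i) =
  (a * ZtoR R sc - ZtoR R (entry y i)) - (a * ZtoR R sc - ZtoR R (entry x i)) by ring.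
apply: le_trans (ler_normB _ _) _.
by move: ax bx; rewrite ZtoR_radius => ax bx; lra.
Qed.

Lemma uniq_map_separated (T : eqType) (idx : seq nat) (F : seq Z -> T) (s : seq (seq Z)) :
  pairwise (separated idx) s ->
  {in s &, forall x y, separated idx x y -> F x <> F y} -> uniq (map F s).
Proof.
move=> sep neq; rewrite uniq_pairwise pairwise_map.
apply: (@sub_in_pairwise _ (mem s) (separated idx)) sep; last exact/allP.
by move=> x y xs ys /(neq x y xs ys) /eqP.
Qed.

Lemma choose_in (T : eqType) (U : Type) (u0 : U) (s : seq T) (P : T -> U -> Prop) :
  {in s, forall x, exists u, P x u} -> exists f : T -> U, {in s, forall x, P x (f x)}.
Proof.
move=> ex; suff /boolp.choice[f fP] : forall x, exists u, x \in s -> P x u by exists f => x /fP.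
move=> x.
by have [/ex[u Pu]|_] := boolP (x \in s); [exists u|exists u0].
Qed.

(** The ten solutions are distinct: within a group because their approximations are separated,
and across the three groups because the imaginary part of u is zero for the real ones, positive
for the nonreal ones of the table and negative for their conjugates. *)
Lemma check_sound (R : realType) (c : certificate) : check c ->
  exists C1 C2 : set (proj_point R),
    [/\ is_twisted_cubic C1, real_locus C1, is_twisted_cubic C2, real_locus C2 &
        realize C1 C2 (kinds c).1.1 (kinds c).1.2 (kinds c).2].
Proof.
case: c => [[[G sc] rs] cs]; rewrite /check => /and5P[sc_gt sG sz invG].
case/and5P=> invW /allP okr /allP okc sepr sepc.
pose g (i j : nat) : R := ZtoR R (entry2 G i j).
have g4 k : g 4%N k = 0 by rewrite /g /entry2 nth_default ?(eqP sG) // /entry nth_nil.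
pose GR : 'M[R]_4 := \matrix_(i, j) g i j.
have uG : GR \in unitmx := invertible_check_sound R invG.
have uW : wedge_mx (syzygy_pencil g 1) (syzygy_pencil g 0) \in unitmx.
  have := invertible_check_sound R invW; congr (_ \in unitmx); apply/matrixP => i j.
  rewrite !mxE /entry2 /wedge_table (nth_map 0%N) ?size_iota // nth_iota //.
  rewrite /entry (nth_map 0%N) ?size_iota // nth_iota //.
  exact: (wedge_coef_morph (ZtoR R)).
have uG' : map_mx (real_complex R) GR \in unitmx by rewrite map_unitmx.
exists (twisted_cubic 1%:M), (twisted_cubic (map_mx (real_complex R) GR)); split.
- by exists 1%:M; rewrite ?unitmx1.
- by rewrite -(map_mx1 (real_complex R)); apply: real_locus_twisted_cubic; rewrite unitmx1.
- by exists (map_mx (real_complex R) GR).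
- exact: real_locus_twisted_cubic.
have [f fP] := choose_in (0, 0) (fun x xs => real_check_sound R sc_gt (okr x xs)).
have [h hP] := choose_in (0, 0) (fun x xs => complex_check_sound R sc_gt (okc x xs)).
pose reals := [seq (Some (real_signs sc x), ((f x).1%:C, (f x).2%:C)) | x <- rs].
pose nonreal := [seq (None, h x) | x <- cs] : seq (solution_data R).
pose conjs := [seq (None, (conjc (h x).1, conjc (h x).2)) | x <- cs] : seq (solution_data R).
have none (p : pred (solution_data R)) F :
    (forall z, p (None, z) = false) -> count p [seq (None, F x) | x <- cs] = 0%N.
  by move=> pN; rewrite count_map; elim: (cs) => //= ? ? ->; rewrite pN.
have sols := @realize_of_solutions R g g4 uG uW (reals ++ nonreal ++ conjs).
have -> : (kinds (G, sc, rs, cs)).1.1 = count (@total_kind R) (reals ++ nonreal ++ conjs).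
  by rewrite !count_cat !none // !addn0 /= !count_map; apply: eq_count => x.
have -> : (kinds (G, sc, rs, cs)).1.2 = count (@partial_kind R) (reals ++ nonreal ++ conjs).
  by rewrite !count_cat !none // !addn0 /= !count_map; apply: eq_count => x.
have -> : (kinds (G, sc, rs, cs)).2 = count (@minimal_kind R) (reals ++ nonreal ++ conjs).
  by rewrite !count_cat !none // !addn0 /= !count_map; apply: eq_count => x.
apply: sols; first by rewrite !size_cat !size_map addnn -muln2 (eqP sz).
  have im_pos x : x \in cs -> 0 < complex.Im (h x).1 by case/hP=> _ _ _ _ [].
  have uniq_reals : uniq (map snd reals).
    rewrite -map_comp; apply: uniq_map_separated sepr _ => x y /fP[x2 x3 _] /fP[y2 y3 _] sep [e2 e3].
    by case/hasP: sep => i; rewrite !inE => /orP[]/eqP-> sep;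
      [apply: near_separated x2 y2 sep e2|apply: near_separated x3 y3 sep e3].
  have uniq_nonreal : uniq (map snd nonreal).
    rewrite -map_comp; apply: uniq_map_separated sepc _ => x y /hP[x4 x5 x6 x7 _] /hP[y4 y5 y6 y7 _] sep e.
    case/hasP: sep => i; rewrite !inE => /or4P[]/eqP-> => sep.
    - by apply: (near_separated x4 y4 sep); rewrite [h x]e.
    - by apply: (near_separated x5 y5 sep); rewrite [h x]e.
    - by apply: (near_separated x6 y6 sep); rewrite [h x]e.
    - by apply: (near_separated x7 y7 sep); rewrite [h x]e.
  pose conj2 (z : R[i] * R[i]) := (conjc z.1, conjc z.2).
  have conjsE : map snd conjs = map conj2 (map snd nonreal) by rewrite -!map_comp.
  have conj2K : involutive conj2 by case=> a b; rewrite /conj2 /= !conjcK.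
  rewrite !map_cat conjsE !cat_uniq uniq_reals uniq_nonreal (map_inj_uniq (inv_inj conj2K)) uniq_nonreal.
  have pos z : z \in map snd nonreal -> 0 < complex.Im z.1.
    by rewrite -map_comp => /mapP[x /im_pos p ->].
  have real0 z : z \in map snd reals -> complex.Im z.1 = 0.
    by rewrite -map_comp => /mapP[x _ ->].
  rewrite has_cat negb_or !andbT /=; apply/andP; split; first (apply/andP; split); apply/hasPn => z.
  - by move=> /pos zp; apply/negP => /real0 z0; rewrite z0 ltxx in zp.
  - case/mapP=> z' /pos zp ->; apply/negP => /real0 /=; move: zp.
    by case: (z'.1) => a b /= bp /eqP; rewrite oppr_eq0 gt_eqF.
  - case/mapP=> z' /pos zp ->; apply/negP => /pos /=; move: zp.
    by case: (z'.1) => a b /= bp bn; have := addr_gt0 bp bn; rewrite subrr ltxx.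
move=> x; rewrite !mem_cat => /or3P[] /mapP[y ys ->].
- by case: (fP y ys).
- by case: (hP y ys) => _ _ _ _ []; rewrite [X in (None, X)]surjective_pairing.
- by case: (hP y ys) => _ _ _ _ []; rewrite [h y]surjective_pairing => _ /secant_solution_conj.
Qed.

(** * The table of matrices and solutions *)

Section Certificates.
Local Open Scope Z_scope.

(** The integers come from a numerical search and carry no structure: [check] establishes all
that is used about them. *)
Definition certificates : seq certificate := [::
  ([:: [:: 27; -3; -6; 0]; [:: 0; 1; -8; 1]; [:: 0; -4; -1; 2]; [:: 1; 0; 0; -3]], 1000,
   [::],
   [:: [:: -5695; -6744; -1197; 1407; 165; 2009; 2145; -793; 1850; 81; -1384; 6457];
    [:: 6119; 128; -4917; 4296; -7298; 10917; -3647; 1749; -9602; 7403; -13441; 2645];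
    [:: 3943; -497; -2888; -1735; -1302; 326; -121; 361; -2225; 12; -1616; 2023];
    [:: -5800; -5745; -1356; 971; 2517; 609; -482; -2277; -922; -2509; 7769; 3220];
    [:: -3596; -3486; 3905; -5166; 568; 860; 110; 182; 971; -1193; 355; -992]]);
  ([:: [:: -38; -1; 2; 2]; [:: -1; 5; -9; 0]; [:: 0; -2; 0; -1]; [:: 0; 1; 0; -2]], 1000,
   [:: [:: -4517; 603; 1051; 696; 2297; 5647];
    [:: -6395; -308; -2478; 3818; -4580; 21990]],
   [:: [:: -1475; -3671; 685; -369; 809; 1456; -356; 453; 356; 296; 2994; 5208];
    [:: 8428; -517; -201; -194; 429; 2183; 2218; 1247; -2502; 3762; -9416; -6458];
    [:: -2972; -1481; 943; -3583; 534; 802; -12; 43; 989; -1717; -196; 911];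
    [:: 4832; 235; -5103; 4425; -25; 2160; 24; 27; -2082; 2238; 201; -667]]);
  ([:: [:: -39; -3; 7; 3]; [:: -2; 8; 1; 2]; [:: 4; 1; 4; 2]; [:: 1; 2; 0; -3]], 1600,
   [:: [:: -5018; -1406; -3044; 2800; -9528; 28343];
    [:: -16503; 1009; 2503; 4187; 7336; 15475];
    [:: 4686; -5470; -947; 300; -1974; 799];
    [:: 6176; 10021; 666; 91; 1409; 1467]],
   [:: [:: -13358; -3163; 253; -7183; -676; 2858; -688; -319; -370; -4702; -4646; 638];
    [:: -5527; -1817; -2228; 9637; -1717; 3856; 817; -114; 108; -2875; 4661; 528];
    [:: 8551; -1945; 520; -528; -421; 71; 666; -467; -755; 44; -3131; 2655]]);
  ([:: [:: -50; 0; 9; 0]; [:: 0; -6; 0; -16]; [:: -5; 0; -7; 0]; [:: 0; 8; 0; -32]], 7400,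
   [:: [:: -265273; 72234; 15506; 11582; 9280; 14296];
    [:: -265273; -72234; -15506; 11582; -9280; 14296];
    [:: -277725; 37114; 12471; 18130; 10033; 22379];
    [:: -277725; -37114; -12471; 18130; -10033; 22379];
    [:: -62152; 0; 0; 2070; 0; 4396];
    [:: -174820; 0; 0; 24604; 0; 49254]],
   [:: [:: -43548; 0; 0; 113827; 0; 3288; 1558; 0; 0; 4514; 1924; 0];
    [:: -364494; 0; 0; -733214; 0; 83799; -6166; 0; 0; -3792; -7612; 0]]);
  ([:: [:: -62; -1; 13; 1]; [:: 1; -8; -1; 0]; [:: -8; 0; -4; -1]; [:: 0; 10; 1; -29]], 10800,
   [:: [:: -93329; 141396; 3617; 2792; 6390; 4203];
    [:: -98066; -166576; -6003; 3029; -6721; 4556];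
    [:: -322335; 162730; 16718; 8996; 12572; 14543];
    [:: -343336; -207907; -20217; 9558; -12623; 13588];
    [:: -373133; 33519; 10169; 23548; 13589; 38488];
    [:: -423801; -63975; -14770; 24480; -14576; 34723];
    [:: -62218; 10113; -601; 2339; 688; 698];
    [:: -267692; -1850; 453; 27513; 3090; 63175]],
   [:: [:: -537938; -3540; -39796; -624662; 866; 69401; -10278; -1551; 500; -8964; -15598; -435]]);
  ([:: [:: -30; -9; 3; -2]; [:: 0; 7; 2; 2]; [:: 0; -1; 2; 0]; [:: 1; 1; 1; -3]], 1000,
   [:: [:: -18492; -2193; 4892; 3223; 1711; 7448];
    [:: 3231; -5377; -705; 194; -1074; 1090]],
   [:: [:: 7447; 3572; 2874; 684; 1048; 1015; 950; -2415; -1192; -2087; -497; 8742];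
    [:: -6378; 5817; -3566; -2247; 1944; 1973; -1002; 175; -506; -3452; -3130; 754];
    [:: -3429; 4971; 3285; 3931; 2604; 2105; -153; -1071; 188; -2106; 3289; 921];
    [:: 1284; -747; 2307; 2032; -153; 165; 142; -114; 906; 543; -584; 1173]]);
  ([:: [:: -32; 0; -2; 7]; [:: 3; -13; 0; 2]; [:: -6; 0; -4; -1]; [:: 2; 0; 0; -6]], 1200,
   [:: [:: -19551; 2439; -556; 2307; 236; 4679];
    [:: -23782; -771; 5076; 1614; 3456; 2728];
    [:: -18682; 1990; 1189; 1691; 1324; 3631];
    [:: -6013; 6259; 655; 138; 1680; 1359]],
   [:: [:: -15931; 6948; -2933; 2748; -7593; 1750; -3237; -622; -5351; 1625; -5853; -4053];
    [:: -3886; 809; -4240; 4843; -172; 198; -214; -95; -622; 939; -1130; -1178];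
    [:: -22813; -12028; 3440; 3604; -5473; 4687; 2410; -2432; -2875; 3725; 1584; -4930]]);
  ([:: [:: -2; 0; 7; -1]; [:: 1; 5; -1; -10]; [:: 6; 0; -1; 0]; [:: 0; 4; 0; -33]], 4100,
   [:: [:: 28585; 63765; 4898; 7584; 2682; 1941];
    [:: 10923; -91980; -10305; 9823; -4368; 3398];
    [:: -8230; 72726; 18170; 21315; 7447; 6939];
    [:: -13779; -26020; -9076; 32258; -22952; 10657];
    [:: -12683; 44494; 15131; 28861; 12312; 9382];
    [:: 5371; -94979; -12533; 11753; -4993; 3964]],
   [:: [:: -83456; -4915; 8517; -161049; 270; 11305; -6157; -696; 158; -3842; -2012; 50];
    [:: 47157; -32489; 13058; 5111; 501; 544; 8580; -5355; 573; 108; 245; 1100]]);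
  ([:: [:: -5; 0; 8; 0]; [:: -1; 5; 0; -8]; [:: 7; -1; 0; 2]; [:: 0; 6; -1; -34]], 5100,
   [:: [:: 9754; 105739; 7930; 6990; 3751; 3060];
    [:: 19134; -88008; -6084; 6044; -3587; 2820];
    [:: -27359; 120803; 16268; 14055; 6035; 5494];
    [:: -4695; -105598; -12560; 9053; -5111; 4853];
    [:: -44659; 53104; 14036; 27046; 14178; 10784];
    [:: -33357; -31596; -10752; 26322; -16731; 13884];
    [:: 53876; -16290; -67; 7803; -753; 169];
    [:: 96537; -14687; 546; 13901; -619; -1516]],
   [:: [:: -126905; 3869; 3353; -202920; 869; 14454; -6251; 1549; -433; -4839; -2903; 223]]);
  ([:: [:: -1; 0; 6; 5]; [:: 0; 5; -1; 12]; [:: 3; -1; 7; -1]; [:: 0; 1; 0; 0]], 900,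
   [:: [:: 3593; 8689; 1394; 80; 1004; 1333];
    [:: 8777; -14913; -2020; 917; -1022; 460]],
   [:: [:: 599; -653; 2930; -359; 1542; 965; 1131; 1357; 4154; -405; 3947; 2262];
    [:: 606; 2964; -143; 1296; -224; 97; -1983; 961; -156; 641; 159; -2209];
    [:: 669; 326; -2574; -283; -2361; 305; 2607; -442; -6023; -33; 3271; -1000];
    [:: -1885; -368; -736; -1417; -100; 767; -1850; 227; -87; -3201; -3314; 755]]);
  ([:: [:: -41; 1; 4; 1]; [:: 1; 7; 2; 4]; [:: 0; -2; 5; 4]; [:: 1; 1; 1; -4]], 900,
   [:: [:: -21433; 2288; 3472; 4603; 1904; 7627];
    [:: 5455; 608; -454; 227; -64; -1018];
    [:: 6403; -5163; -1010; -33; -733; 553];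
    [:: 3377; 6733; 137; 73; 688; 203]],
   [:: [:: 9811; 4566; -101; -192; -216; 372; 1992; -1567; -703; -2099; -3637; 7621];
    [:: -5539; 1708; -1839; -2268; 731; 2104; -338; 55; -239; -3719; -2705; -809];
    [:: -4036; 936; 1041; 4133; 831; 2299; 327; -48; 163; -2599; 2108; -460]]);
  ([:: [:: -38; -2; 5; 1]; [:: -2; 7; 0; 2]; [:: 5; 0; 3; 2]; [:: 0; 1; 0; -3]], 1000,
   [:: [:: -5875; -1040; -3460; 3896; -8195; 23169];
    [:: -6430; 334; 3090; 4125; 9724; 24562];
    [:: 4720; 305; -164; 359; -456; -1761];
    [:: 2866; -3422; -548; 117; -1310; 577];
    [:: 3068; 5329; 377; 70; 751; 515];
    [:: 7099; 412; -172; 837; -496; -3727]],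
   [:: [:: -7913; -1196; 403; -3974; -358; 2513; -528; -151; -288; -3251; -3198; 391];
    [:: -4865; -1349; -652; 5496; -746; 3985; 631; -42; -224; -2723; 3676; 290]]);
  ([:: [:: -5; -1; 8; 0]; [:: -1; 5; 0; -10]; [:: 5; 0; 3; 2]; [:: 0; 5; -1; -33]], 4100,
   [:: [:: 24378; 69053; 4056; 3720; 1653; 1706];
    [:: 19293; -74725; -5046; 5215; -2668; 2501];
    [:: -42316; 179709; 28254; 11034; 3282; 4905];
    [:: -845; -98303; -12241; 9192; -3711; 4468];
    [:: -49291; 30795; 14781; 31405; 12840; 11563];
    [:: -23997; -25209; -7917; 24953; -15116; 14360];
    [:: 39375; 6364; 777; 5417; -157; 514];
    [:: 84007; 7364; 1349; 14302; -307; -1955]],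
   [:: [:: -93767; 3222; 9154; -155604; 452; 13038; -5960; -289; -429; -4785; -2732; 413]]);
  ([:: [:: -43; 1; 2; 0]; [:: 0; 5; 3; 5]; [:: 0; 0; 5; 0]; [:: 1; 1; 1; -4]], 800,
   [:: [:: -17446; 806; 1930; 4077; 2521; 7877];
    [:: 3669; 360; -260; 125; 399; -879];
    [:: 3982; -5931; -832; -8; -351; 225];
    [:: 2822; 4367; 189; 35; 920; 76]],
   [:: [:: 9847; 5757; -87; -144; -260; 743; 2356; -1781; -926; -1923; -3315; 8219];
    [:: -4272; 2179; -1484; -795; 618; 2146; -217; -55; 740; -2740; -1377; -1547];
    [:: -2914; 2201; 92; 3531; 721; 2258; 120; -41; 680; -1992; 1022; -327]]);
  ([:: [:: -40; -1; 4; 1]; [:: -3; 6; 1; 2]; [:: 4; 0; 3; 2]; [:: 0; 1; 0; -3]], 1000,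
   [:: [:: -5208; -497; -2648; 3634; -8589; 26634];
    [:: -6681; 334; 2793; 4079; 9308; 24243];
    [:: 3743; 194; -251; 210; -377; -1104];
    [:: 2609; -3146; -658; 81; -1086; 545];
    [:: 3048; 5032; 268; 63; 759; 399];
    [:: 8221; 202; -219; 1343; -688; -6021]],
   [:: [:: -7131; -1309; 78; -3467; -452; 2559; -423; -170; -326; -3240; -3003; -44];
    [:: -4125; -1945; -1523; 4608; -1040; 3607; 451; 35; -125; -2440; 3049; -224]]);
  ([:: [:: -45; 0; -1; 0]; [:: -1; -3; 0; -10]; [:: 8; 0; -7; 0]; [:: 0; 5; 0; -8]], 1500,
   [:: [:: -22923; -19036; 3844; 70; 1013; 303];
    [:: -22889; 19152; -3854; 69; -1007; 302];
    [:: -16758; -1009; 1762; 617; 1906; 2620];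
    [:: -16424; -360; 1533; 1521; 3541; 6389];
    [:: -15151; 289; -1421; 1621; -3718; 7368];
    [:: -8554; 32; -46; 244; -41; 2189];
    [:: -15923; 997; -1687; 565; -1768; 2538];
    [:: 12287; 3; 32; 2846; -153; -15819]],
   [:: [:: -1857; -23; -4; 10567; 2; 1165; -38; 0; 1; 2304; -165; 0]]);
  ([:: [:: -34; -2; 3; -2]; [:: -1; 9; 0; 3]; [:: 0; -2; 3; 2]; [:: 1; 0; 0; -3]], 700,
   [:: [:: 9517; -428; -2864; -2733; 433; 7409];
    [:: 2125; 1029; -13; 171; 3; -1210];
    [:: 3052; -2962; -473; 4; -978; 668];
    [:: 1784; 3022; 134; 74; 456; -265]],
   [:: [:: 7679; -1012; 400; -226; 1135; 109; 888; -2525; -877; -1868; -3731; 7314];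
    [:: -5192; 205; -266; -2130; 2678; 783; -241; 450; -3394; -1193; -756; 2244];
    [:: -6532; -608; 125; 3104; -2620; 9337; 1778; 463; 3381; -7994; 5982; 3132]]);
  ([:: [:: -39; 0; 3; 0]; [:: 0; 5; 0; 2]; [:: 6; -1; 5; 4]; [:: 1; 1; 1; -4]], 800,
   [:: [:: 13107; 304; -465; 1602; 400; -3666];
    [:: -9555; 358; 1426; 2986; 4612; 9549];
    [:: 5429; 1073; -284; 172; -129; -636];
    [:: 4756; -4423; -827; -7; -693; 449];
    [:: 3513; 5836; 313; 47; 314; 129];
    [:: 7585; 202; -1122; 3306; 4658; -13344]],
   [:: [:: -3902; 961; -862; -2122; 285; 1811; -186; 3; 166; -2786; -1870; -437];
    [:: -1958; 760; 1633; 2799; 563; 2102; 169; -11; 440; -2131; 1555; 425]]);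
  ([:: [:: -45; 1; -1; 0]; [:: -1; -3; 0; -10]; [:: 9; 0; -7; 0]; [:: 0; 5; 0; -8]], 1500,
   [:: [:: -22456; -19293; 3863; 149; 1032; 289];
    [:: -23335; 18923; -3844; -14; -992; 304];
    [:: -16518; -532; 1771; 727; 2127; 2945];
    [:: -16459; -59; 1631; 1404; 3421; 5746];
    [:: -14988; 593; -1447; 1704; -4110; 7969];
    [:: -8372; 177; -21; 236; 5; 2178];
    [:: -16208; 1458; -1767; 483; -1708; 2315];
    [:: 16298; -351; 63; 2976; -49; -12459]],
   [:: [:: -1885; -1; 2; 10552; 30; 1166; -37; 26; 1; 2303; -162; 10]]);
  ([:: [:: -44; 0; 4; 2]; [:: -1; 5; 0; 2]; [:: 6; -1; 5; 4]; [:: 1; 1; 1; -4]], 900,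
   [:: [:: 15583; 62; -531; 1947; 438; -4739];
    [:: -11218; 605; 1459; 3302; 5416; 11367];
    [:: 6229; -26; -445; 180; -284; -627];
    [:: 5614; -4587; -904; 31; -731; 356];
    [:: 3573; 7476; 492; 41; 427; 454];
    [:: 9059; 164; -1163; 3658; 4918; -15635]],
   [:: [:: -4536; 1225; -1433; -2727; 281; 2030; -215; 37; 163; -3174; -2497; -347];
    [:: -2018; 547; 2594; 3473; 674; 2360; 196; -8; 569; -2258; 2129; 425]]);
  ([:: [:: -43; 0; -1; 0]; [:: 1; -3; 0; -12]; [:: 8; 0; -5; 1]; [:: 0; 3; 0; -8]], 1200,
   [:: [:: -17912; -11295; 4335; 132; 1197; 461];
    [:: -16634; 12175; -3977; 98; -1149; 392];
    [:: -15473; -1776; 3035; 587; 1868; 2051];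
    [:: -14942; -394; 2491; 2172; 4225; 7595];
    [:: -13124; 264; -2031; 2323; -5063; 9245];
    [:: -4812; 53; -86; 154; -207; 1950];
    [:: -13664; 1511; -2544; 507; -1843; 2020];
    [:: 31302; 11; 73; 4668; 225; -7741]],
   [:: [:: -1729; 134; 438; 9940; 16; 984; -32; 0; -84; 1839; -119; -3]]);
  ([:: [:: -1; 0; 3; 3]; [:: -1; 5; -1; 11]; [:: 3; -1; 8; 0]; [:: 0; 1; 0; -2]], 1000,
   [:: [:: -129; 2784; 2142; 3435; 7606; 3386];
    [:: -551; -1326; -4462; 7319; -7837; 7833];
    [:: -703; 3536; 4007; 5986; 5654; 4248];
    [:: 679; -1859; -1214; 2766; -13867; 345];
    [:: 5417; 12100; 1279; -62; 874; 565];
    [:: 11293; -18004; -1996; 1126; -1043; 166]],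
   [:: [:: 1679; 3458; -290; 1674; -272; 300; -2198; 1234; -101; 92; 302; -1357];
    [:: -2900; 96; -1175; -2445; -158; 1410; -2230; 650; -31; -3096; -1809; 164]]);
  ([:: [:: -46; 0; -1; 0]; [:: 1; -3; 0; -11]; [:: 10; 0; -5; -1]; [:: 0; 4; 0; -8]], 1300,
   [:: [:: -19840; -13122; 4112; 107; 1139; 407];
    [:: -21668; 11832; -4458; 149; -1215; 490];
    [:: -15789; -1485; 2480; 545; 1932; 2171];
    [:: -14745; -349; 1973; 1781; 4292; 7338];
    [:: -19541; 878; -2812; 1333; -3047; 4165];
    [:: -5189; -83; 123; 140; 242; 1943];
    [:: -19570; 1581; -3058; 794; -2234; 2514];
    [:: 30835; -41; -230; 3736; -31; -7300]],
   [:: [:: -1668; -104; -480; 10546; -24; 899; -31; 0; 87; 1858; -111; 2]]);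
  ([:: [:: -13; 1; 11; 3]; [:: -1; 18; 0; 32]; [:: 1; 0; 20; 1]; [:: 0; 2; 1; 1]], 1500,
   [:: [:: -1533; 4340; 2448; 2376; 7952; 11682];
    [:: 1261; -3122; -1569; 776; -27039; 5755];
    [:: 26735; 270; -54; -3304; -43; 3333];
    [:: 2851; 8579; 1711; 785; 8514; 4214];
    [:: -1739; -1240; -2684; 3397; -13623; 26175];
    [:: 22885; 35301; 1938; 124; 2020; 1102];
    [:: 26847; -39046; -2018; 188; -1976; 673];
    [:: 20306; -853; -69; -9768; -81; 10594]],
   [:: [:: -5151; 2819; -1385; -1729; 94; 1538; -2269; 168; 5770; -12872; -10410; -5507]]);
  ([:: [:: -14; 1; 11; 3]; [:: -1; 18; 0; 33]; [:: 2; 0; 20; 1]; [:: 0; 2; 1; 1]], 1500,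
   [:: [:: -1408; 4297; 2437; 2136; 8396; 11675];
    [:: 1195; -3044; -1556; 735; -28188; 5852];
    [:: 22442; 29; -53; -3825; -99; 4678];
    [:: 2777; 8504; 1716; 739; 8729; 4253];
    [:: -1986; -1299; -2812; 3484; -14170; 26503];
    [:: 22798; 35718; 1965; 123; 2057; 1102];
    [:: 26905; -39605; -2042; 169; -1994; 674];
    [:: 18078; -314; -18; -6061; -205; 8408]],
   [:: [:: -5137; 2752; -1230; -1600; 54; 1465; -2222; 142; 5656; -12610; -10879; -5675]]);
  ([:: [:: 22; -2; -8; -1]; [:: 0; 1; -12; -1]; [:: 0; -3; -1; 1]; [:: -1; 0; 0; -2]], 1000,
   [:: [:: 5916; -3215; 3242; 3497; 4759; 10556];
    [:: 7080; -25444; 35400; 7363; 15521; 11748]],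
   [:: [:: -2999; -3130; -985; 615; 434; 685; 757; -1049; 359; -924; 2831; 5198];
    [:: -3535; 3091; -759; -374; -896; 1503; -698; -2338; -2373; -2942; -4174; 11749];
    [:: -2653; -3132; 2937; -5952; 748; 1047; 125; 184; 1531; -2176; 699; -1561];
    [:: 4077; 39; -2618; 1160; -1295; 154; -371; -209; -3013; 344; -3342; -1170]]);
  ([:: [:: -28; -2; 2; 2]; [:: -1; 4; 1; 4]; [:: 3; -1; 3; 2]; [:: 0; 2; 1; -1]], 1200,
   [:: [:: -3134; -317; -1626; 1707; -7884; 16141];
    [:: -4327; 553; 1035; 809; 3421; 6191];
    [:: 3845; -4147; -1340; 161; -1281; 174];
    [:: 923; 4399; 331; 40; 1589; 814]],
   [:: [:: -5211; 572; -1247; -1087; -187; 1482; -381; -120; -84; -3204; -3051; -423];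
    [:: -2070; -181; 1180; 3265; 283; 1548; 155; -132; 461; -2006; 1404; -469];
    [:: 4801; 1587; 146; 371; -588; 100; 192; 541; -407; 180; -1547; -3324]]);
  ([:: [:: 7; 0; 4; 0]; [:: 1; 21; -1; 4]; [:: 3; 0; 36; -1]; [:: 2; 2; 0; 40]], 4200,
   [:: [:: 149062; 68199; 5885; 4950; 3293; 1450];
    [:: 110306; 47093; 10517; 11676; 7184; 3752];
    [:: 161471; -80863; -5795; 4213; -3142; 1204];
    [:: 91540; 32116; 11788; 16800; 8085; 6167];
    [:: 85160; 47021; -5328; -7914; -6708; -1904];
    [:: 151627; 552; 16; 140; -104; 492]],
   [:: [:: 69970; -27429; -36533; 15650; 16168; 23580; -19069; -26011; 7820; 30081; -2357; -11853];
    [:: 47840; -5461; -13426; -7261; -2054; 11509; -11239; -19131; -4739; 10922; -4038; -12218]]);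
  ([:: [:: 22; -2; -8; -1]; [:: 0; 1; -11; -1]; [:: 0; -3; -1; 1]; [:: -1; 0; 0; -2]], 1000,
   [:: [:: 6229; -3776; 3922; 3704; 5129; 10537];
    [:: 7153; -20906; 29138; 6867; 13917; 11855]],
   [:: [:: -3009; -3079; -1090; 620; 457; 725; 734; -1008; 285; -840; 2752; 5039];
    [:: -3723; 3156; -816; -411; -970; 1563; -679; -2402; -2411; -3027; -4132; 11530];
    [:: -2590; -2993; 2809; -5634; 719; 998; 132; 184; 1461; -2042; 690; -1589];
    [:: 3997; 61; -2492; 1441; -1306; 184; -334; -260; -2900; 422; -3209; -1474]]);
  ([:: [:: -54; 1; 2; 1]; [:: 1; 7; 2; 4]; [:: 0; -2; 5; 6]; [:: 1; 1; 1; -4]], 1000,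
   [:: [:: -24729; 1149; 3065; 4882; 2638; 10457];
    [:: 6586; 401; -714; 118; -390; -774];
    [:: 7136; -3912; -1136; -28; -830; 332];
    [:: 4217; 8551; 76; 28; 571; 138]],
   [:: [:: 12288; 7062; -163; -175; -468; 468; 2761; -1657; -931; -2765; -5865; 10689];
    [:: -5975; 1276; -1620; -1639; 596; 2491; -210; -4; -247; -4071; -2141; -907];
    [:: -4746; 624; 343; 3252; 650; 2662; 191; -22; -15; -3210; 1692; -587]]);
  ([:: [:: -47; -2; -1; 2]; [:: -1; -4; 0; -9]; [:: 13; 0; -6; -2]; [:: 0; 3; 1; -6]], 2400,
   [:: [:: -30596; -29910; 5318; -278; 1645; -3];
    [:: -17568; 464; 1942; 831; 4074; 6191];
    [:: -18359; -378; 2247; 2613; 9958; 16955];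
    [:: -23487; -27; -5017; 5041; -14156; 23429];
    [:: -11274; 2018; 228; 390; 1511; 4510];
    [:: 120083; 3633; -1185; 10352; -206; -9725]],
   [:: [:: -4188; 93; -879; 14358; -819; 2061; -30; -122; -612; 4122; -361; -927];
    [:: -26804; 2973; 6749; -8401; -5933; 955; 615; 261; -3062; -635; 1582; 1444]]);
  ([:: [:: -43; 0; 1; 0]; [:: 0; 4; 2; 5]; [:: 0; -1; 5; 0]; [:: 1; 1; 1; -3]], 800,
   [:: [:: -12809; 195; 1722; 2655; 2331; 7080];
    [:: 3792; 121; -209; 170; 438; -1377];
    [:: 4876; -6111; -933; 1; -347; 122];
    [:: 2325; 4054; 318; 14; 958; 63]],
   [:: [:: 7849; 4278; 27; -19; 58; 294; 1489; -1154; -670; -1804; -2844; 6610];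
    [:: -2761; 1584; -622; -268; 583; 1546; -155; -50; 621; -2794; -1356; -1404];
    [:: -1768; 1396; -10; 2283; 627; 1587; 38; -34; 508; -2168; 555; -222]]);
  ([:: [:: -43; -2; 2; 2]; [:: 0; 6; 1; 5]; [:: 1; 0; 3; 2]; [:: 0; 1; 1; -3]], 1100,
   [:: [:: -13847; -924; -5119; 10216; -7489; 33909];
    [:: -7585; -31; 1697; 3071; 5488; 19321];
    [:: 3688; -409; -525; 223; -316; -1892];
    [:: 3674; -4638; -840; 96; -1174; -78];
    [:: 1805; 6354; 249; 22; 1237; 459];
    [:: 6159; 265; -795; 2982; 445; -22225]],
   [:: [:: -8115; 4405; -2708; -1603; 931; 3097; -543; -64; 661; -3428; -2674; -986];
    [:: -4557; 4128; 2776; 3864; 1743; 2847; 141; -315; 686; -2406; 1916; -162]]);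
  ([:: [:: -1; 0; 5; 4]; [:: -1; 5; -2; 11]; [:: 3; -1; 7; 0]; [:: 0; 1; 0; 0]], 900,
   [:: [:: 187; -1703; -2882; 3316; -5915; 5715];
    [:: 1404; -2899; -1840; 1789; -5921; 1738];
    [:: 4015; 9111; 1309; 29; 730; 1002];
    [:: 8137; -12760; -1867; 842; -1232; 405]],
   [:: [:: 457; -699; 2603; -178; 1381; 1147; 1006; 1577; 4257; -743; 3481; 2220];
    [:: 843; 2655; -118; 1108; -224; 140; -1881; 887; -356; 318; 351; -2052];
    [:: -1745; -240; -596; -1241; -138; 788; -1755; 323; -100; -3318; -3144; 600]]);
  ([:: [:: -43; -2; 2; 2]; [:: 0; 6; 1; 5]; [:: 4; 0; 3; 2]; [:: 0; 1; 1; -3]], 1100,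
   [:: [:: -17187; -1259; -8139; 13427; -11595; 35770];
    [:: -6451; 67; 2038; 2557; 7004; 19070];
    [:: 4505; -323; -541; 266; -277; -1992];
    [:: 3924; -4727; -875; 97; -1160; -60];
    [:: 1857; 6370; 259; 21; 1235; 462];
    [:: 10264; 369; -642; 1746; 48; -7672]],
   [:: [:: -8052; 3805; -2529; -1678; 732; 2888; -493; -72; 505; -3253; -2590; -856];
    [:: -4345; 3735; 2627; 3702; 1780; 2798; 135; -307; 661; -2538; 1997; -214]]);
  ([:: [:: -44; 0; 3; 2]; [:: -1; 6; 0; 3]; [:: 6; -1; 5; 2]; [:: 1; 1; 1; -4]], 1000,
   [:: [:: 14416; -172; -378; 1716; 539; -5031];
    [:: -12635; 744; 2239; 3433; 5395; 11716];
    [:: 6903; -919; -359; 226; -218; -1005];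
    [:: 6340; -5039; -735; 62; -707; 40];
    [:: 3522; 7087; 547; 27; 695; 514];
    [:: 9338; 92; -1202; 3762; 5459; -17403]],
   [:: [:: -5449; 2302; -1745; -2382; 584; 2203; -264; 97; 271; -3445; -2557; -298];
    [:: -2970; 1505; 2731; 3167; 1065; 2456; 220; -59; 771; -2698; 2145; 210]]);
  ([:: [:: -1; 0; 3; 5]; [:: -1; 5; -1; 11]; [:: 3; -1; 6; 0]; [:: 0; 1; 0; -2]], 900,
   [:: [:: -60; 3216; 2084; 2902; 5217; 3009];
    [:: -669; -1538; -5309; 7667; -5827; 6686];
    [:: -655; 4104; 4200; 5427; 3887; 3750];
    [:: 1165; -2649; -1470; 2740; -8528; -31];
    [:: 3013; 8729; 1099; 9; 1077; 804];
    [:: 9282; -14479; -2098; 1550; -1229; 112]],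
   [:: [:: 378; 2960; -645; 2140; -371; 231; -1808; 996; -165; 390; -126; -1387];
    [:: -3041; -454; -1537; -2607; -385; 1118; -2088; 495; -44; -2047; -1365; 350]]);
  ([:: [:: 27; -3; -5; 0]; [:: 0; 0; -8; 1]; [:: 0; -4; 0; 2]; [:: 1; 0; 0; -3]], 900,
   [:: [:: 7109; -15575; -41916; -8463; -17075; -13578];
    [:: 6269; -4099; -7290; -3262; -6316; -10151]],
   [:: [:: -3480; -7033; -1130; 1116; -51; 1894; 1986; -284; 1671; -7; -1133; 5744];
    [:: 3837; -396; -2561; -1048; -1037; 210; -163; 243; -1672; -26; -1489; 1234];
    [:: -3818; -5864; -1168; 772; 2504; 659; -136; -2173; -1171; -2640; 7638; 2565];
    [:: -2388; -3635; 3987; -4394; 529; 903; 76; 142; 830; -1275; 262; -826]]);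
  ([:: [:: -45; -2; 1; 0]; [:: -7; 5; 0; 6]; [:: 4; -1; 5; 0]; [:: -1; 2; 0; -1]], 1000,
   [:: [:: -3254; -216; -721; 900; -5369; 11688];
    [:: -3221; -43; 1258; 911; 6604; 13193];
    [:: 2516; 4696; 669; -16; 1294; 149];
    [:: 3974; -5612; -907; 47; -1140; 178]],
   [:: [:: -3568; 753; -142; -279; 32; 1057; -268; 27; -242; -3615; -3675; 160];
    [:: -1291; -307; -267; 2073; -6; 998; 38; -42; -498; -3153; 518; -28];
    [:: 4916; 1954; 164; 83; 101; 218; 0; 521; 79; -403; -1525; -4250]]);
  ([:: [:: -52; 0; 11; -3]; [:: 0; 16; 0; 6]; [:: 9; -2; -16; 0]; [:: -2; 0; 1; 17]], 3000,
   [:: [:: -39056; 2066; 954; 1179; -1137; 2174];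
    [:: -41248; 24736; 4705; 2006; -5603; 5186];
    [:: -59652; 44725; -7410; -1687; 5314; -6071];
    [:: -61472; 37240; 14417; 5383; -12780; 12051];
    [:: -186421; 20705; 20739; 38575; -17968; 31749];
    [:: -30684; -23560; -2160; 1455; 3391; 4172]],
   [:: [:: -96255; -11355; -47796; -1703; 13989; 8227; -4704; -3976; -8272; -4583; -9284; -5349];
    [:: -188077; 548; -20963; -8910; 8865; 8261; -17968; -7728; -4909; -4725; -15411; -6455]]);
  ([:: [:: -52; 0; 3; 0]; [:: 0; -8; 0; -20]; [:: -6; 0; -10; 0]; [:: 0; 8; 0; -30]], 3900,
   [:: [:: -144235; 12994; 7742; 5183; 4668; 6971];
    [:: -144235; -12994; -7742; 5183; -4668; 6971];
    [:: -146291; 7214; 6267; 7556; 4819; 10163];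
    [:: -146291; -7214; -6267; 7556; -4819; 10163];
    [:: -177275; -182798; 26908; -1280; 2644; -1722];
    [:: -177275; 182798; -26908; -1280; -2644; -1722];
    [:: -44307; 0; 0; 884; 0; 3018];
    [:: -103490; 0; 0; 10748; 0; 20622]],
   [:: [:: -23541; 0; 0; 78209; 0; 2397; 267; 0; 0; 3469; 359; 0]]);
  ([:: [:: -42; 1; 0; 0]; [:: 0; 4; 1; 5]; [:: 0; 0; 5; -1]; [:: 1; 1; 1; -4]], 800,
   [:: [:: -15490; 372; 1503; 3627; 2630; 7789];
    [:: 3679; -86; -111; 118; 318; -1101];
    [:: 4036; -6358; -712; -17; -406; 2];
    [:: 2665; 4412; 486; 11; 823; 2]],
   [:: [:: 9515; 5922; -225; -141; -83; 675; 2235; -1598; -905; -1888; -3137; 7652];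
    [:: -3046; 1891; 41; -50; 686; 1921; -96; -16; 891; -2309; -585; -1048];
    [:: -2367; 2237; -171; 1973; 733; 1966; 18; 45; 667; -2019; 17; -9]]);
  ([:: [:: -3; 1; -7; 4]; [:: 0; 5; 1; 31]; [:: -1; 0; 10; -3]; [:: 0; 1; 0; 0]], 1000,
   [:: [:: -3414; -298; 2177; 8573; 2224; 8947];
    [:: -3150; 2431; -1806; 7482; -3139; 9922];
    [:: 17557; -3428; -73; -7554; 40; 888];
    [:: 6806; 17480; 1987; -340; 1778; -587];
    [:: 8823; -22423; -1852; -836; -1087; -719];
    [:: -10222; 3061; 591; 20227; -7; 6563]],
   [:: [:: -1337; -1541; 2155; 3577; -694; 1802; -1845; -1929; -777; -7015; -2116; -3236];
    [:: -828; 2087; -1324; 4829; 1171; 1637; -1283; 2036; 1834; -6085; -1526; 1553]]);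
  ([:: [:: -45; -1; 0; 1]; [:: -1; -4; 0; -8]; [:: 10; -1; -8; 1]; [:: 0; 5; 0; -8]], 1500,
   [:: [:: -27699; -23673; 3988; -131; 782; -103];
    [:: -18147; 16392; -2875; 98; -1044; 128];
    [:: -14895; 679; 1260; 473; 1515; 2269];
    [:: -13709; -43; 1195; 1754; 4533; 8765];
    [:: -13284; -42; -1295; 1742; -4632; 8705];
    [:: -9405; 1037; -146; 254; -193; 1801];
    [:: -12269; 917; -1116; 363; -1347; 1859];
    [:: 18433; 208; -88; 3049; -486; -11157]],
   [:: [:: -3191; 810; -196; 8134; -150; 1196; 0; -40; -325; 2213; 1; -277]]);
  ([:: [:: -42; 0; -1; 0]; [:: 0; 7; 2; 4]; [:: 0; -2; 4; -1]; [:: 1; 1; 1; -4]], 900,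
   [:: [:: -25386; -660; 5097; 4650; 1588; 6956];
    [:: 3594; -158; -163; 67; 372; -927];
    [:: 4837; -4786; -547; -8; -371; -103];
    [:: 2351; 3313; 99; -20; 966; -27]],
   [:: [:: 8956; 4758; -31; 76; 631; 439; 1463; -1719; -1070; -2151; -1879; 8256];
    [:: -5512; 3252; 852; -382; 1546; 1889; -306; -278; 195; -3105; -615; -2270];
    [:: -4728; 3910; -2452; 2342; 1435; 2029; 34; 92; -353; -2711; -96; 652]]);
  ([:: [:: -45; 0; 2; -1]; [:: 1; -18; -2; 4]; [:: -8; 0; -3; 0]; [:: 1; 0; 0; -4]], 1000,
   [:: [:: -11937; -1013; -7523; 4247; -5896; 15844];
    [:: -12487; -659; -1045; 1345; -948; 4688];
    [:: -7163; 824; -12093; -4821; -8863; -30566];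
    [:: -3192; 2982; 26; 22; 765; -318];
    [:: -3526; -3981; -356; 78; -1262; 430];
    [:: -2805; 1065; -82; -24; 205; -1093]],
   [:: [:: -20012; 2772; -548; 2615; 1791; 4781; 1410; -951; 1206; 4240; 3304; -1680];
    [:: -26707; 2680; -2005; -3997; -11356; 9189; -1117; -3830; -9019; 5893; -1296; -6583]]);
  ([:: [:: -44; 0; 0; 0]; [:: 0; -4; 1; -12]; [:: 11; 0; -8; 1]; [:: 0; 4; 0; -9]], 1500,
   [:: [:: -22320; -21653; 3986; 0; 971; 0];
    [:: -26849; 29539; -4808; 0; -1158; 0];
    [:: -15180; 0; 1911; 562; 1838; 2445];
    [:: -15873; 0; 2006; 2418; 5697; 10052];
    [:: -15632; 0; -1919; 2224; -5492; 9392];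
    [:: -8621; 0; 97; 305; -89; 2336];
    [:: -16161; 0; -1973; 850; -2567; 3471];
    [:: 46476; 0; 117; 5319; 109; -7554]],
   [:: [:: -3320; -692; 783; 11077; 101; 1343; 0; 0; 10; 2424; 0; 0]]);
  ([:: [:: -37; -1; 1; 0]; [:: 1; -19; -3; 4]; [:: -6; 0; -3; 0]; [:: 1; 0; 0; -3]], 700,
   [:: [:: -5164; -347; -3149; 2292; -3264; 10974];
    [:: -5636; -268; -458; 678; -547; 2970];
    [:: -3099; 83; -4544; -2210; -4517; -19651];
    [:: -2230; 2218; 17; 18; 757; 0];
    [:: -2260; -2233; -284; 35; -1028; 100];
    [:: -1652; 28; -140; -77; -130; -1563]],
   [:: [:: -11880; 1405; -623; 1431; 1506; 3763; 694; -714; 1298; 4240; 1696; -1135];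
    [:: -13904; 1524; -1416; -1732; -4815; 5908; -496; -1449; -5287; 5330; -927; -2503]]);
  ([:: [:: -46; 0; 0; 0]; [:: 1; -3; 0; -12]; [:: 10; 0; -5; 0]; [:: 0; 3; 0; -8]], 1200,
   [:: [:: -18535; -17510; 5081; 0; 987; 0];
    [:: -18535; 17510; -5081; 0; -987; 0];
    [:: -14034; 0; 2724; 653; 2139; 2570];
    [:: -13867; 0; 2395; 2258; 5084; 8987];
    [:: -14936; 0; -2528; 2151; -4817; 7948];
    [:: -4432; 0; 29; 157; 19; 1955];
    [:: -14778; 0; -2812; 712; -2260; 2658];
    [:: 45026; 0; -98; 5100; 103; -6252]],
   [:: [:: -1865; 0; 0; 9669; 0; 926; 0; 0; 0; 1787; 0; 0]]);
  ([:: [:: -1; 0; 3; 3]; [:: 0; 5; -2; 11]; [:: 3; -1; 8; 0]; [:: 0; 1; 0; -2]], 1100,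
   [:: [:: -2; 2344; 1921; 3310; 9628; 4252];
    [:: -1496; -3294; -8269; 13069; -7685; 7183];
    [:: -326; 2569; 3164; 4921; 7205; 5477];
    [:: 625; -2184; -1371; 3067; -15038; 410];
    [:: 5962; 13628; 1483; -90; 806; 625];
    [:: 12126; -20754; -2307; 1185; -1209; 192]],
   [:: [:: 1291; -3975; 285; -1898; -187; 46; -2535; -1274; -369; -722; 155; 1564];
    [:: -3272; -1077; -529; -2899; -218; 1455; -2661; 278; -142; -3236; -1780; 679]]);
  ([:: [:: -12; 2; 6; 2]; [:: 0; 19; 1; 21]; [:: 1; 0; 17; -3]; [:: 0; 3; 0; 0]], 1200,
   [:: [:: -3240; 2894; 2446; 3198; 4389; 9734];
    [:: 1308; -3602; -719; 449; -10873; 338];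
    [:: 18555; -165; 147; -1767; 214; 1856];
    [:: 2283; 5033; 976; 419; 7597; 2168];
    [:: -3689; -476; -2071; 2937; -5220; 10468];
    [:: 14308; 17538; 1276; 114; 1946; 704];
    [:: 16441; -22390; -1139; 158; -1446; 221];
    [:: 15040; -1713; 27; -5352; 106; 5703]],
   [:: [:: -6329; 1334; -794; -2194; 207; 1341; -1321; 182; 808; -7454; -4242; -989]]);
  ([:: [:: -9; -2; 7; 3]; [:: -1; 16; 6; 28]; [:: 0; 0; 17; 1]; [:: 0; 2; 1; 1]], 1400,
   [:: [:: -4225; 1783; 3056; 4683; 5223; 12743];
    [:: 1170; -3495; -1651; 1100; -16650; 3830];
    [:: 22743; 7835; 265; -2598; 767; 2010];
    [:: 4629; 8926; 1251; 73; 6879; 2009];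
    [:: -1116; -1566; -2413; 3124; -10179; 16934];
    [:: 16328; 22226; 1423; -458; 2464; 949];
    [:: 20623; -32563; -2053; 727; -1644; 500];
    [:: 24298; 4538; -1109; -18211; 852; 10136]],
   [:: [:: -4439; 3721; -2651; -823; 192; 1568; -2234; 302; 4165; -10237; -6376; -3499]]);
  ([:: [:: -11; 0; 6; 3]; [:: 0; 16; 0; 21]; [:: 0; 1; 17; -1]; [:: 0; 2; 1; 1]], 1500,
   [:: [:: -656; 2532; 1956; 1200; 7791; 9618];
    [:: 1197; -2301; -1421; 628; -25562; 2626];
    [:: 25474; 6357; 555; -2036; 334; 1848];
    [:: 1978; 4631; 1513; 291; 8296; 4398];
    [:: -1203; -566; -2215; 2516; -12534; 23288];
    [:: 22334; 22939; 1596; -428; 1522; 921];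
    [:: 21227; -29735; -1735; 435; -1934; 298];
    [:: 30229; 2327; 2336; -21043; -582; 11933]],
   [:: [:: -2907; 3606; -1666; -119; 425; 1194; -1679; 428; 8284; -9962; -6770; -5967]]);
  ([:: [:: 33; -5; 1; -2]; [:: 2; 3; -11; -2]; [:: 2; -4; -1; 1]; [:: -1; 0; 0; -2]], 1000,
   [:: [:: 5890; -985; 3154; 2543; 5670; 11739];
    [:: 4494; -3945; -1324; -140; -3415; 665];
    [:: 4560; -188; -1225; -806; -2818; -4266];
    [:: 5122; -18290; 44364; 6613; 25762; -509]],
   [:: [:: -2535; -4363; 211; 916; 487; 571; 355; -717; 558; -690; 3521; 4399];
    [:: -3860; 4754; 668; -624; -1618; 2220; -1615; -2746; -4205; -4694; -8347; 16076];
    [:: -2983; -3087; 2138; -5496; 614; 870; 49; 165; 973; -1983; -107; -255]]);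
  ([:: [:: -33; 0; -1; 7]; [:: 4; -16; 0; 1]; [:: -6; 0; -3; 0]; [:: 2; 0; 0; -6]], 1200,
   [:: [:: -15928; 1642; -3458; 3449; -1455; 8665];
    [:: -41680; -3704; 14922; 2188; 6844; 2113];
    [:: -26029; -4536; -12888; -3738; -7200; -5632];
    [:: -15588; 2131; -361; 1906; 175; 4933];
    [:: -17083; -2300; -10254; -4235; -5510; -9732];
    [:: -4653; 6898; 332; 129; 1316; 1403]],
   [:: [:: -3119; 616; -3788; 5414; -113; 134; -127; -85; -688; 969; -906; -1253];
    [:: -36741; -9565; 5342; 2916; -4773; 11108; 1870; -2641; -1496; 6040; 1230; -3167]]);
  ([:: [:: 8; 0; 4; 0]; [:: 1; 22; -1; 4]; [:: 2; 0; 36; -1]; [:: 1; 2; 0; 39]], 4000,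
   [:: [:: 139649; 59027; 5691; 4732; 3429; 1543];
    [:: 115107; -51787; -20454; 20731; -13948; 6319];
    [:: 115049; 46621; 9585; 9826; 6705; 3289];
    [:: 146180; -67281; -5366; 3829; -3175; 1276];
    [:: 87342; 21896; 12665; 23260; 8494; 9255];
    [:: 71494; -36025; 12870; -14770; 15668; -5716];
    [:: 84243; 40528; -6395; -8647; -7923; -2525];
    [:: 144203; 372; 11; 100; -102; 466]],
   [:: [:: 49125; -22990; -11855; -1138; -4156; 16227; -12638; -36631; -10940; 11779; 3476; -22235]]);
  ([:: [:: 36; -4; 0; -1]; [:: 2; 0; -9; 0]; [:: 0; -5; 1; -1]; [:: -1; 0; 0; -2]], 800,
   [:: [:: 6251; -845; 3439; 3063; 5915; 12352];
    [:: 4377; -3876; -695; -60; -1339; 116];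
    [:: 5105; -437; -715; -603; -968; -2954];
    [:: -1314; 22255; -110593; -12368; 35904; 1750]],
   [:: [:: -1648; -3218; -9; 494; 450; 535; 213; -347; 702; -889; 2295; 2631];
    [:: -1550; 4366; 126; -449; -1948; 2678; -1481; -1991; -2267; -6542; -10778; 12172];
    [:: -1551; -2782; 1216; -2980; 508; 559; 34; 77; 838; -1577; -17; -244]]);
  ([:: [:: -38; 0; 1; -2]; [:: 1; -19; -2; 4]; [:: -7; 0; -3; 1]; [:: 1; 0; 0; -3]], 800,
   [:: [:: -5866; -332; -4201; 2714; -4579; 13959];
    [:: -6434; -551; -684; 723; -1134; 3315];
    [:: -3661; 258; -5788; -2736; -5969; -22898];
    [:: -2281; 2627; 7; -15; 616; -485];
    [:: -2823; -2418; -347; 81; -1420; 644];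
    [:: -1841; 809; -111; -81; -108; -1692]],
   [:: [:: -14212; 2114; -596; 1579; 2706; 4417; 765; -698; 2240; 4943; 1774; -1229];
    [:: -15819; 1701; -1065; -2057; -6122; 6521; -572; -1728; -6744; 5836; -773; -3403]]);
  ([:: [:: 10; 0; 4; 0]; [:: 0; 27; 0; 3]; [:: 4; 1; 37; -1]; [:: 1; 1; 1; 40]], 3500,
   [:: [:: 136451; 57930; 6944; 5143; 4618; 1678];
    [:: 91882; -41046; -116517; 102929; -115474; 39741];
    [:: 123026; 52276; 11105; 9054; 7958; 2974];
    [:: 141776; -60170; -5751; 4020; -3850; 1338];
    [:: 78494; 18263; 18384; 30206; 12781; 14093];
    [:: 94001; -45210; 8870; -8777; 9022; -2747];
    [:: 79171; 38344; -6015; -6368; -7426; -2196];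
    [:: 130622; -3654; -118; 284; -98; 451]],
   [:: [:: 43092; -926; -4643; -1822; 5378; 5872; -26375; -11572; 4807; 6334; -20074; -9831]]);
  ([:: [:: -37; -1; 1; 1]; [:: 0; -19; -3; 4]; [:: -7; 0; -3; 0]; [:: 1; 0; 0; -3]], 800,
   [:: [:: -6032; -391; -4454; 2859; -4584; 13334];
    [:: -6815; -110; -498; 697; -535; 2876];
    [:: -3524; 78; -5953; -2749; -5927; -24622];
    [:: -2751; 2624; 38; 43; 913; 242];
    [:: -2493; -2404; -308; 17; -1109; -158];
    [:: -1859; -332; -170; -81; -281; -1713]],
   [:: [:: -13186; 1589; -534; 1580; 1081; 3959; 808; -753; 903; 4485; 1976; -1211];
    [:: -15662; 1474; -1641; -1871; -6090; 6646; -485; -1678; -6637; 6023; -993; -2925]]);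
  ([:: [:: -3; 0; 0; 5]; [:: 0; 6; 1; 28]; [:: -1; 0; 10; -2]; [:: 0; 1; 0; 1]], 1100,
   [:: [:: -2406; 610; 2413; 7224; 2818; 9910];
    [:: -2490; 623; -2142; 7328; -3164; 9713];
    [:: 16695; 5231; 624; -5851; 276; 1157];
    [:: 666; 3111; 1176; -393; 10032; 1945];
    [:: 1230; -4916; -1348; 459; -7597; -1231];
    [:: 8723; 18441; 2099; -867; 1648; 328];
    [:: 6913; -19603; -2036; 647; -1859; -309];
    [:: -7820; 762; 23; 18823; -151; 7943]],
   [:: [:: -2483; 1125; -1346; 195; 593; 2063; -3531; 1021; 1350; -8682; -4403; -638]]);
  ([:: [:: 11; 0; -1; 0]; [:: 0; -16; -3; 10]; [:: -6; 0; -3; 1]; [:: 0; 0; 2; -7]], 900,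
   [:: [:: 920; 95; 2486; -2105; 4506; -23538];
    [:: 2758; 70; 276; -910; 0; -3558];
    [:: -702; 97; 3693; 2507; -8519; -34213];
    [:: -5131; 6594; 167; 94; 935; -23];
    [:: -1015; -6652; -242; 85; -1098; -33];
    [:: -4206; -255; -162; 325; -223; -573]],
   [:: [:: -9741; -2413; 881; -3039; 2220; 150; 64; 641; 3329; -718; -135; -618];
    [:: 9169; 3075; 1283; -2748; 4067; 130; -14; -1176; -5892; 1990; -476; -1110]]);
  ([:: [:: -3; 0; 0; 4]; [:: 0; 7; 1; 27]; [:: 0; 0; 10; -2]; [:: 0; 1; 0; 1]], 900,
   [:: [:: -1869; 368; 2868; 6096; 3411; 8805];
    [:: -1783; 376; -2560; 5693; -3791; 8624];
    [:: 8888; 2670; 347; -3994; 290; 1213];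
    [:: 684; 2484; 935; -331; 8006; 1304];
    [:: 1082; -3715; -1095; 350; -6507; -872];
    [:: 6471; 12669; 1495; -613; 1522; 256];
    [:: 6261; -15465; -1603; 486; -1538; -210];
    [:: 8994; 607; 60; -17791; 96; 5341]],
   [:: [:: -1822; 815; -899; 161; 348; 1357; -2545; 631; 1221; -6865; -3492; -627]]);
  ([:: [:: -10; -1; 6; 4]; [:: -1; 16; 6; 28]; [:: 0; 0; 17; 2]; [:: 0; 2; 1; 1]], 1300,
   [:: [:: -3568; 1865; 2615; 3790; 5110; 11920];
    [:: 1015; -2837; -1435; 774; -17453; 1918];
    [:: 21485; 5316; 68; -2506; 557; 1984];
    [:: 3832; 7770; 1098; 93; 6791; 1957];
    [:: -1473; -877; -2277; 2919; -9419; 16870];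
    [:: 15046; 21513; 1327; -294; 2320; 813];
    [:: 19245; -28862; -1883; 527; -1505; 298];
    [:: 22429; 2041; -960; -15043; 689; 9227]],
   [:: [:: -3981; 2978; -1967; -601; 98; 1401; -1935; 194; 3950; -9989; -6186; -3539]]);
  ([:: [:: -4; 0; 4; -1]; [:: 0; 4; 2; 38]; [:: 4; 0; 11; -1]; [:: 0; 1; 0; 0]], 1600,
   [:: [:: -4259; 3641; 8158; 10677; 12663; 13639];
    [:: -2601; -2999; -5336; 6574; -13943; 12238];
    [:: -23039; 60; 369; -10182; -377; -3273];
    [:: -7288; -920; 1493; -7055; -3570; -7600];
    [:: 869; 6429; 2071; 1374; 17174; 1663];
    [:: 84; -5056; -1999; 1560; -19011; 3037];
    [:: 12740; 46734; 4463; 492; 2449; 556];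
    [:: 13986; -53052; -4700; 255; -1578; 615]],
   [:: [:: -3378; 1409; 345; -471; -467; 665; -5213; 757; 2467; -2031; -11505; -3364]]);
  ([:: [:: 35; -5; 0; -1]; [:: 2; 0; -8; -2]; [:: 0; -5; 1; -2]; [:: -1; 0; 0; -2]], 900,
   [:: [:: 6866; -1249; 4369; 3569; 7013; 13509];
    [:: 5735; -4459; -935; -123; -1170; 57];
    [:: 6698; -901; -1020; -730; -864; -2746];
    [:: -2756; 27701; -119744; -17350; 31247; 2789]],
   [:: [:: -1786; -3228; -20; 567; 488; 530; 143; -385; 1002; -943; 3139; 2447];
    [:: -1735; 5110; 133; -686; -2637; 3192; -1786; -2333; -2179; -7771; -12772; 13021];
    [:: -1628; -2676; 538; -3418; 551; 536; 49; 87; 1016; -1759; 66; -312]]);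
  ([:: [:: -2; 0; 0; 3]; [:: 0; 4; 1; 32]; [:: 1; 0; 9; -1]; [:: 0; 1; 0; 1]], 1000,
   [:: [:: -3402; 454; 5750; 11236; 4111; 6606];
    [:: -2934; 468; -4888; 9411; -4367; 6416];
    [:: 762; 4783; 1204; -239; 6642; 627];
    [:: 801; -5090; -1327; 236; -6355; -589];
    [:: 4527; 16451; 2067; -413; 1964; 182];
    [:: 5711; -20244; -2384; 423; -1557; -148]],
   [:: [:: 3173; 3715; 142; 1048; 21; 188; -5826; 3751; 188; 13; 381; -2811];
    [:: -3114; 489; -955; 68; 105; 1776; -4920; 417; 199; -4039; -3125; -223]]);
  ([:: [:: -45; 0; -1; -1]; [:: -5; -35; 1; 3]; [:: -8; -2; -12; -1]; [:: 2; 0; 0; -6]], 2200,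
   [:: [:: -30387; -2731; -2; 495; 73; 1771];
    [:: -41106; -4338; 2172; 872; 4277; 2217];
    [:: -37031; -3509; -12011; -2350; -25024; -6151];
    [:: -16448; -122; -3504; -3965; -7983; -23574];
    [:: -25111; 6625; 1562; -366; 4472; -1249];
    [:: -25710; -6875; -605; 84; -1961; 510];
    [:: -14611; 450; -189; -1501; -437; -9839];
    [:: -17459; 266; -5139; 4241; -8453; 24324]],
   [:: [:: -39144; -4480; 5095; -800; -694; 6800; 12; -1181; -168; 13074; -185; -2965]]);
  ([:: [:: -34; -2; -2; 0]; [:: -2; -14; -2; 4]; [:: -7; -1; 4; 3]; [:: 1; 0; 0; -6]], 800,
   [:: [:: 14622; 6094; -5041; -538; 3887; 1465];
    [:: -13822; -522; -845; 2355; 469; 4629];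
    [:: 3911; 5523; -374; -42; 763; 121];
    [:: 3373; -3116; 221; -70; -1078; 78];
    [:: 3129; 18; -6; 12; -391; -509];
    [:: 17060; 6510; 26656; 2948; -16594; -7276]],
   [:: [:: -11758; -1182; -864; 534; 7562; 3098; -2285; 8094; -5967; -627; -2201; 19368];
    [:: 14690; 1720; -3687; -175; 400; 7391; -59; -1763; -1291; -5250; 263; 2429]]);
  ([:: [:: -3; 0; 0; 2]; [:: 0; 7; 0; 28]; [:: -1; 0; 10; -1]; [:: 0; 1; 0; 1]], 1000,
   [:: [:: -2173; 209; 2100; 6939; 2493; 9580];
    [:: -2032; 204; -1970; 6649; -2733; 9818];
    [:: 14380; 2173; 277; -4412; 117; 921];
    [:: 830; 3099; 1105; -179; 8461; 645];
    [:: 1218; -4124; -1182; 197; -7264; -485];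
    [:: 7396; 15602; 1773; -316; 1647; 128];
    [:: 6451; -15802; -1722; 272; -1903; -127];
    [:: -5701; 242; 197; 15693; 43; 8257]],
   [:: [:: -2109; 496; -491; 39; 276; 1695; -2896; 445; 861; -8714; -4045; -318]]);
  ([:: [:: -42; 1; -1; 0]; [:: -3; 11; 1; 4]; [:: 1; -1; 2; -1]; [:: -1; 0; 0; -4]], 600,
   [:: [:: -11793; -3275; 7943; 788; -4444; 1311];
    [:: -13866; -3625; -20911; -2215; 9146; -3095];
    [:: 1240; -34; -19; 17; 155; -644];
    [:: 1345; -2650; -149; -16; -442; -30];
    [:: 1123; 2091; 52; -12; 644; -18];
    [:: 9994; -368; 2374; -4226; -2186; 10763]],
   [:: [:: 8125; -132; -36; 129; -293; 2954; 1542; 2364; 673; -853; -4730; -7189];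
    [:: -13933; 731; 2173; -60; 4933; 9484; -817; -1418; -1978; -5111; -1504; -3051]]);
  ([:: [:: -9; -1; 2; -1]; [:: 1; 13; -1; 23]; [:: 0; 0; 13; 0]; [:: 0; 2; 0; 1]], 1000,
   [:: [:: -1997; 40; 1732; 2096; 4330; 9312];
    [:: 1981; -4278; -936; 170; -5888; 711];
    [:: 13036; 856; 109; -2212; -165; 1672];
    [:: 1536; 3517; 871; 94; 6577; 185];
    [:: -3025; -1031; -2208; 3312; -3629; 8463];
    [:: 9339; 14061; 1196; -14; 1530; 100];
    [:: 8435; -13388; -1207; 110; -1891; 263];
    [:: 13838; 1612; 769; -8199; -545; 5421]],
   [:: [:: -2958; -130; -26; -424; 0; 1020; -1375; 8; 60; -7822; -4833; 582]]);
  ([:: [:: -9; -1; 0; 0]; [:: 0; 12; 1; 23]; [:: 0; 2; 16; 2]; [:: 0; 2; 0; 1]], 1300,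
   [:: [:: -2415; -245; 2084; 2483; 8540; 13152];
    [:: 1679; -4099; -1144; 122; -9567; 39];
    [:: 21282; 2392; 300; -2951; 254; 1604];
    [:: 920; 2351; 860; -100; 16322; 55];
    [:: -3316; -402; -2502; 3325; -4966; 10753];
    [:: 20680; 28127; 1679; -203; 1347; 9];
    [:: 12766; -21006; -1645; 171; -1875; 11];
    [:: 23116; 2599; 1389; -13207; 217; 6606]],
   [:: [:: -2736; 406; -305; 20; 13; 1200; -1628; 86; 1216; -12750; -6942; -92]]);
  ([:: [:: -1; 0; 5; 3]; [:: 0; 3; 0; 40]; [:: 3; 0; 9; 0]; [:: 0; 1; 0; 0]], 1400,
   [:: [:: -639; -8709; -6997; 9258; -8206; 4949];
    [:: -33274; -3102; -424; -15298; 66; -938];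
    [:: -1279; -469; 14; -4627; -179; -12726];
    [:: 932; -10521; -4660; 5307; -8288; 2542];
    [:: 8968; 44274; 5068; 1017; 1846; 934];
    [:: 10734; -47113; -5479; 1716; -1792; 689];
    [:: -4111; -3737; 1728; -7129; -3788; -4811];
    [:: -4888; 2404; -2322; -8065; 4045; -4315]],
   [:: [:: 158; -683; 9621; -676; 5057; 1150; 5971; 1926; 8377; -117; 4211; 1133]]);
  ([:: [:: -34; -1; -2; 0]; [:: -1; -13; 1; 2]; [:: -8; -1; 2; 1]; [:: 1; 0; 0; -4]], 800,
   [:: [:: 16653; 4560; -4252; -936; 2832; 1656];
    [:: -9301; -137; -328; 1347; 267; 4050];
    [:: 2078; 3130; -54; -49; 597; 40];
    [:: 1787; -2578; 235; -62; -978; 127];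
    [:: 1658; 262; 92; -19; -185; -501];
    [:: 20908; 5678; 30940; 6442; -12640; -9626]],
   [:: [:: -9335; 1631; -414; 929; 13167; 4187; -250; 8365; -6950; 230; -3673; 24091];
    [:: 17176; 3969; -5899; -1165; -1012; 10928; 195; -2025; -1120; -6261; 272; 2636]]);
  ([:: [:: -49; -1; -1; -4]; [:: -2; -36; -3; 6]; [:: -8; 1; -6; 2]; [:: 2; 0; 0; -5]], 1100,
   [:: [:: -10498; -1424; -682; 649; -1672; 3374];
    [:: -41432; -7509; 10842; 1660; 10737; 2476];
    [:: -29837; -4488; -10537; -740; -13833; -1686];
    [:: -6455; -59; -3086; -2430; -3669; -20625];
    [:: -5600; 6889; 55; -96; 1023; -696];
    [:: -7621; -4674; -486; 122; -1982; 950];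
    [:: -4341; 1098; -179; -333; -369; -3896];
    [:: -8834; -290; -2996; 2403; -4574; 14426]],
   [:: [:: -32106; -140; 2133; -1443; -3416; 6812; 501; -1474; -4212; 8181; 752; -2244]]);
  ([:: [:: 7; 0; 2; 0]; [:: 0; 21; -1; 2]; [:: 3; 0; 35; -1]; [:: 0; 2; 0; 39]], 3800,
   [:: [:: 135506; 44212; 3726; 2177; 2052; 640];
    [:: 102663; -37603; -11840; 8150; -8792; 2393];
    [:: 100160; 31843; 13038; 10631; 9433; 3112];
    [:: 134049; -48283; -4257; 2291; -2599; 670];
    [:: 93474; 13173; 27787; 55250; 14036; 16032];
    [:: 91322; -12558; -29039; 59249; -14357; 17574];
    [:: 75751; -31047; 8072; -6713; 8734; -1976];
    [:: 77323; 27662; -7639; -7187; -8485; -2099];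
    [:: 24849; -18; 88; -36051; -36; -37430];
    [:: 133198; 670; 20; 66; -96; 230]],
   [::]);
  ([:: [:: -42; 2; -3; 0]; [:: -2; 10; -1; 4]; [:: 2; -1; 2; 0]; [:: 1; 0; 0; -4]], 800,
   [:: [:: 14651; 587; -7467; -6270; 2313; 13433];
    [:: -15495; 5880; -18426; 2898; 11407; 8309];
    [:: -21653; 8279; 10945; -1805; -3854; -3522];
    [:: 1474; 327; 84; -21; 34; -722];
    [:: 1493; -2914; -64; -59; -711; -20];
    [:: 1376; 2663; 171; -42; 570; -179]],
   [:: [:: -16157; -1761; -5085; -544; 59; 11410; -39; 2721; -1311; -5161; 519; 4473];
    [:: 12399; 418; -856; 442; 562; 2577; 3182; -2680; 300; -1848; -8439; 7881]]);
  ([:: [:: -44; -2; -1; -3]; [:: -5; -34; -3; 5]; [:: -9; 0; -6; 3]; [:: 2; 0; 0; -5]], 1100,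
   [:: [:: -9711; -1493; -736; 550; -1841; 2701];
    [:: -41284; -7616; 8875; 1422; 8467; 2169];
    [:: -27960; -4386; -12107; -1057; -16066; -2739];
    [:: -6426; -288; -3497; -2637; -4914; -20872];
    [:: -5720; 7367; 46; -83; 869; -475];
    [:: -7302; -3772; -521; 133; -2040; 888];
    [:: -4180; 787; -191; -316; -732; -3465];
    [:: -8091; -393; -3227; 2418; -4611; 13738]],
   [:: [:: -30684; 633; 2194; -1361; -2361; 7210; 301; -1513; -3055; 8380; 383; -1861]]);
  ([:: [:: 8; 0; 2; 0]; [:: -1; 22; 0; 6]; [:: 6; -1; 33; 0]; [:: 0; 4; -1; 29]], 2200,
   [:: [:: 70266; 30008; 2282; 786; 1514; 335];
    [:: 55405; -20145; -4863; 2794; -3944; 1062];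
    [:: 46730; 17030; 5113; 2958; 4641; 1321];
    [:: 71804; -29914; -2414; 899; -1596; 355];
    [:: 38294; 7509; 8582; 10392; 6031; 5029];
    [:: 7069; -56; 333; -11031; 2512; -26096];
    [:: 32737; -10086; 2848; -2861; 4751; -1242];
    [:: 35913; 11218; -2717; -2724; -3882; -1066];
    [:: 54442; -9079; -11245; 16307; -5933; 5450];
    [:: 68876; 81; 0; -624; 19; -19]],
   [::]);
  ([:: [:: -43; 5; -1; 1]; [:: 1; -18; 0; 5]; [:: -8; 0; -3; -1]; [:: 1; 0; 0; -4]], 900,
   [:: [:: -12953; 1744; -7468; 4083; -4940; 14858];
    [:: -22849; -2467; 9016; 1336; 6370; 523];
    [:: -20222; -3203; -16804; -2638; -13179; -1269];
    [:: -10331; 1377; 483; 845; 931; 3032];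
    [:: -5855; 488; -10814; -5038; -7764; -24850];
    [:: -2892; 3495; 228; 20; 1269; 199];
    [:: -2368; -4351; -145; -48; -972; -167];
    [:: -1900; -232; 5; -98; 171; -1576]],
   [:: [:: -21499; -5497; 3035; 851; -7007; 6481; 2175; -2079; -4271; 5074; 3863; -6087]]);
  ([:: [:: 8; 0; 2; 0]; [:: -1; 22; 0; 6]; [:: 7; -1; 32; 0]; [:: 0; 4; -1; 29]], 2200,
   [:: [:: 68357; 28956; 2502; 927; 1698; 380];
    [:: 58257; -21766; -4709; 2601; -3667; 952];
    [:: 49081; 18365; 5046; 2822; 4407; 1209];
    [:: 69916; -28764; -2713; 1099; -1835; 415];
    [:: 39134; 7858; 9323; 11057; 6228; 5220];
    [:: 10677; -76; 228; -8600; 1204; -13270];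
    [:: 33616; -10410; 2602; -2651; 4189; -1100];
    [:: 36437; 11436; -2465; -2513; -3436; -948];
    [:: 57948; -10039; -12866; 18017; -6208; 5639];
    [:: 66042; 60; 0; -625; 20; -20]],
   [::]);
  ([:: [:: -48; -2; -2; -3]; [:: -4; -35; -3; 5]; [:: -8; 0; -6; 3]; [:: 1; 0; 0; -3]], 1400,
   [:: [:: -10340; -1599; -1022; 376; -3976; 2546];
    [:: -35605; -8094; 7570; 1712; 11041; 3937];
    [:: -21146; -4423; -10024; -1522; -22921; -5980];
    [:: -5227; -336; -4221; -3566; -9954; -47362];
    [:: -7130; 8224; 126; -139; 1593; -710];
    [:: -9288; -2657; -932; 176; -4149; 1417];
    [:: -3968; 280; -353; -675; -2013; -10701];
    [:: -6593; -58; -5214; 3911; -11847; 38247]],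
   [:: [:: -23620; 1051; 2639; -1245; -2694; 5896; 610; -1589; -5907; 11377; 1749; -3744]]);
  ([:: [:: 7; 0; 2; 0]; [:: 0; 22; 0; 6]; [:: 8; 0; 33; 0]; [:: 0; 4; 0; 29]], 2300,
   [:: [:: 76285; 34276; 2601; 997; 1678; 349];
    [:: 54970; -22433; -5739; 3360; -4791; 1177];
    [:: 54970; 22433; 5739; 3360; 4791; 1177];
    [:: 76285; -34276; -2601; 997; -1678; 349];
    [:: 47674; 9961; 13514; 17823; 7267; 6241];
    [:: 10827; 0; 0; -8134; 0; -11119];
    [:: 34907; -12797; 2658; -2729; 4145; -956];
    [:: 34907; 12797; -2658; -2729; -4145; -956];
    [:: 47674; -9961; -13514; 17823; -7267; 6241];
    [:: 70978; 0; 0; -615; 0; 10]],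
   [::]);
  ([:: [:: 7; 0; 2; 0]; [:: 0; 22; 1; 6]; [:: 6; 0; 33; 1]; [:: 0; 3; 0; 33]], 2400,
   [:: [:: 77852; 35134; 3550; 1562; 2416; 485];
    [:: 63570; -24496; -6564; 4181; -4963; 1286];
    [:: 66034; 28627; 5739; 3097; 4425; 962];
    [:: 80181; -33857; -3168; 1458; -1961; 449];
    [:: 54272; 9605; 18375; 28980; 8655; 9183];
    [:: 14923; 27; -64; -10713; 13; -11288];
    [:: 43261; -14802; 3118; -3289; 4157; -1011];
    [:: 42221; 16534; -3367; -3142; -4308; -977];
    [:: 56934; -10140; -17948; 28105; -8509; 8495];
    [:: 75363; -63; 0; -640; 76; 10]],
   [::]);
  ([:: [:: -3; 0; 4; 3]; [:: 0; 3; 0; 41]; [:: 3; 0; 9; 0]; [:: 0; 1; 0; 0]], 1400,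
   [:: [:: 391; 7851; 2260; 1647; 10621; 2361];
    [:: -3820; -3998; -7323; 9857; -8793; 8786];
    [:: -23510; -1761; -269; -12042; 76; -2485];
    [:: -2455; -516; 36; -5020; -234; -11783];
    [:: -3195; 4899; 6463; 8399; 8879; 8589];
    [:: 763; -8424; -2325; 1713; -10220; 848];
    [:: 7427; 39691; 4490; 485; 2066; 782];
    [:: 8379; -40625; -4657; 875; -2058; 497];
    [:: -5142; -1834; 1247; -6721; -2719; -7015];
    [:: -6032; 546; -1678; -7395; 2963; -6449]],
   [::]);
  ([:: [:: -47; 0; 1; -2]; [:: 1; -16; -2; 7]; [:: -6; 2; -5; 1]; [:: 1; 0; 0; -6]], 1000,
   [:: [:: -14729; -3685; -4497; 574; -4720; 1763];
    [:: -16416; -2793; -16660; 2355; -15300; 6682];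
    [:: -12510; 658; -6554; -3440; -4372; -13004];
    [:: -4659; 5602; 130; -12; 879; -334];
    [:: -7585; -5391; -1066; 113; -1991; 569];
    [:: -4528; 1372; -152; -130; -21; -1568]],
   [:: [:: -19444; 6489; 243; 866; 3505; 4613; 2220; -836; 2055; 4268; 5390; -223];
    [:: -20722; 5887; -140; 1021; -7400; 418; 1870; 3756; -6980; -733; 1640; 8985]]);
  ([:: [:: -42; -2; -1; -1]; [:: -8; -35; -2; 8]; [:: -9; -2; -9; 1]; [:: 2; 0; 0; -5]], 1000,
   [:: [:: -11038; -720; -637; 515; -1284; 1934];
    [:: -25108; -3554; 2483; 669; 3827; 1357];
    [:: -17977; -2802; -8421; -1089; -16355; -3426];
    [:: -5368; -311; -1984; -1889; -4589; -15331];
    [:: -8700; 5850; 350; -82; 1568; -203];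
    [:: -8067; -4373; -527; 24; -2013; 119];
    [:: -4191; -72; -224; -599; -856; -5867];
    [:: -6989; -221; -2371; 1864; -3767; 10665]],
   [:: [:: -19942; -580; 1977; -1001; 122; 4056; 11; -780; 420; 6789; 49; -1238]]);
  ([:: [:: 8; 0; 2; 0]; [:: 0; 22; 0; 7]; [:: 7; 0; 34; 0]; [:: 0; 4; 0; 32]], 2200,
   [:: [:: 73631; 32054; 2563; 922; 1636; 352];
    [:: 54249; -19901; -5383; 3118; -4330; 1190];
    [:: 54249; 19901; 5383; 3118; 4330; 1190];
    [:: 73631; -32054; -2563; 922; -1636; 352];
    [:: 48080; 9278; 10385; 12904; 6199; 4925];
    [:: 12992; 0; 0; -8830; 0; -11216];
    [:: 37185; -10645; 2622; -2840; 3719; -1084];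
    [:: 37185; 10645; -2622; -2840; -3719; -1084];
    [:: 48080; -9278; -10385; 12904; -6199; 4925];
    [:: 69327; 0; 0; -782; 0; -59]],
   [::]);
  ([:: [:: -43; -1; -1; 1]; [:: 1; -18; 0; 5]; [:: -8; 0; -3; 1]; [:: 1; 0; 0; -4]], 700,
   [:: [:: -6987; 170; -5902; 3286; -4559; 13636];
    [:: -20385; -2134; 6136; 1348; 3893; 2226];
    [:: -14028; -1805; -11354; -2357; -9142; -5590];
    [:: -8588; 82; -581; 907; -590; 3187];
    [:: -7237; -569; -8390; -3561; -6610; -15555];
    [:: -1993; 3577; 128; -12; 816; 114];
    [:: -1904; -2406; -135; -29; -878; -251];
    [:: -1545; -505; -53; -74; -341; -1146]],
   [:: [:: -16900; -1333; 1956; 26; -3869; 7502; 894; -1361; -2588; 5633; 1286; -2215]]);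
  ([:: [:: 8; 0; 2; 0]; [:: 0; 21; 0; 6]; [:: 9; 0; 32; 0]; [:: -1; 5; 0; 29]], 2200,
   [:: [:: 70581; 29798; 2394; 868; 1512; 354];
    [:: 49173; -17203; -4821; 2895; -3853; 1233];
    [:: 51452; 17744; 5800; 3655; 4500; 1438];
    [:: 69313; -29214; -2391; 868; -1527; 360];
    [:: 55771; 12152; 11947; 13157; 6284; 4326];
    [:: 11634; 454; -968; -6752; -2302; -9382];
    [:: 33487; -9461; 1948; -2274; 3013; -906];
    [:: 32452; 9350; -2323; -2566; -3612; -1093];
    [:: 42063; -10521; -6555; 6001; -4672; 2741];
    [:: 64349; -9; 0; -672; 0; -33]],
   [::]);
  ([:: [:: -34; -1; -2; 0]; [:: -2; 8; 0; 4]; [:: -2; -3; 3; 2]; [:: 1; 0; 0; -3]], 700,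
   [:: [:: -4176; -2120; 23647; 2126; -22694; 16314];
    [:: -3632; -1941; 2008; 128; -2994; 1494];
    [:: -4721; 1587; 2065; -426; -2429; -1633];
    [:: -5894; 2065; -11014; 1967; 13203; 6802];
    [:: 11224; 1003; -1887; -1830; -75; 3911];
    [:: 2362; -112; -125; 73; -306; -1111];
    [:: 3348; -2012; -420; 12; -706; -288];
    [:: 1784; 3388; 142; -42; 479; -50]],
   [:: [:: 9658; 1068; 595; -271; 2952; 1786; 502; 4360; -2718; 2483; -2723; -10573]]);
  ([:: [:: -43; 0; 0; -2]; [:: 1; -19; 0; 8]; [:: -9; -1; -4; -1]; [:: 1; 0; 1; -6]], 1200,
   [:: [:: -11726; 1820; 4325; -360; 8334; -1582];
    [:: 24889; -115; 18626; -12096; -6668; 25077];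
    [:: -22831; -1038; 2159; 1227; 2387; 2773];
    [:: 12102; 363; 10311; 1863; -17230; -7944];
    [:: -22901; -644; -315; 1986; 205; 4475];
    [:: 11085; 161; 11324; 3854; -14696; -17939];
    [:: -6260; 6007; 460; -58; 1601; -479];
    [:: -3286; -9261; -224; 20; -1444; 311];
    [:: -4014; 1404; 181; -160; 541; -2051];
    [:: 6786; -637; 8603; -595; -29411; 4521]],
   [::]);
  ([:: [:: -43; 0; 0; -2]; [:: 1; -19; 0; 9]; [:: -9; -1; -4; 0]; [:: 1; 0; 1; -6]], 1100,
   [:: [:: -11087; 1852; 4020; -306; 7515; -1307];
    [:: 21092; -102; 16354; -10539; -6177; 23635];
    [:: -21857; -980; 2301; 1142; 2396; 2470];
    [:: 11048; 318; 9394; 1775; -15617; -7599];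
    [:: -22294; -519; -948; 2196; -308; 4660];
    [:: 10038; 147; 10253; 3490; -13445; -16445];
    [:: -5812; 6551; 422; -45; 1459; -369];
    [:: -2826; -8386; -216; 17; -1490; 289];
    [:: -3380; 1136; 130; -152; 256; -2130];
    [:: 6376; -638; 7872; -511; -26240; 3791]],
   [::]);
  ([:: [:: -3; 0; 5; 3]; [:: 0; 3; 0; 41]; [:: 3; 0; 8; 0]; [:: 0; 1; 0; 0]], 1300,
   [:: [:: -2653; 5980; 5922; 7122; 7556; 7285];
    [:: -3252; -5150; -6742; 8440; -7514; 7524];
    [:: -23520; -1505; -263; -11311; 68; -2235];
    [:: -1876; -399; 20; -4093; -177; -13012];
    [:: 497; 9158; 2557; 1865; 7878; 2369];
    [:: 926; -9828; -2597; 1881; -7567; 1202];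
    [:: 5511; 32338; 4202; 752; 2210; 1001];
    [:: 6187; -32644; -4306; 1053; -2226; 702];
    [:: -5066; -2189; 1373; -6138; -2791; -6394];
    [:: -5905; 1082; -1761; -6754; 2920; -5892]],
   [::]);
  ([:: [:: -41; -1; -1; 0]; [:: -7; -34; 0; 7]; [:: -9; 2; -6; 2]; [:: 1; 0; 0; -5]], 900,
   [:: [:: -9705; 11; -456; 435; -1079; 1695];
    [:: -31797; -4209; 11576; 2242; 11792; 2955];
    [:: -24681; -3660; -8042; -1374; -10193; -2315];
    [:: -5430; -284; -6374; -5307; -5943; -36972];
    [:: -4761; 6049; 172; -29; 1068; -21];
    [:: -5768; -4095; -278; -26; -1502; -67];
    [:: -2991; -78; 3; -276; -262; -3131];
    [:: -5499; 84; -7332; 4569; -10969; 29603]],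
   [:: [:: -23408; -291; 3025; -132; -7376; 4527; 1335; -757; -9141; 5709; 1843; -1042]]);
  ([:: [:: -47; -2; -1; -2]; [:: -5; -31; -1; 4]; [:: -8; -1; -7; 1]; [:: 3; 1; 0; -6]], 1300,
   [:: [:: -13100; -1218; -734; 793; -1274; 3684];
    [:: -40504; 5109; 10898; -2070; 10277; -2381];
    [:: -44605; -6791; 4129; 1023; 4189; 1680];
    [:: -30769; -3351; -4935; -449; -6248; -1255];
    [:: -30997; 1650; -6163; 922; -7914; 1355];
    [:: -14373; -663; -3191; -2128; -3460; -9505];
    [:: -8330; 6423; 189; -107; 1042; -521];
    [:: -9546; -5294; -433; 80; -1607; 571];
    [:: -6892; 1125; -75; -280; -158; -2270];
    [:: -8530; -328; -3282; 2457; -5387; 16794]],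
   [::]);
  ([:: [:: -4; -1; 3; 4]; [:: -1; 11; 3; 39]; [:: 6; 0; 3; 2]; [:: -1; 0; 0; -2]], 1000,
   [:: [:: 232; -473; 4358; 1561; -7773; -32783];
    [:: 3116; 2523; 4184; -7823; -6015; 9663];
    [:: -16745; -1929; -1693; -3003; 575; -998];
    [:: -407; -90; -1054; -521; 537; -15076];
    [:: 3477; 11907; 879; 50; 3636; 553];
    [:: 5037; -11499; -1956; 932; -3816; 243];
    [:: -5062; -2828; 197; -2450; -2709; -2490];
    [:: -5670; 3157; -3313; -751; 5548; -1643]],
   [:: [:: -3376; -4054; -7810; 4991; 1214; 3416; 2056; -1858; -6726; -2628; 196; -1425]]);
  ([:: [:: -47; -1; -1; -3]; [:: -4; -35; -3; 6]; [:: -8; 0; -8; 1]; [:: 3; 1; 0; -6]], 1200,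
   [:: [:: -13235; -1474; -770; 657; -1620; 2840];
    [:: -47091; 4493; 18835; -4439; 15875; -4806];
    [:: -41877; -7675; 4075; 881; 4506; 1338];
    [:: -26114; -3419; -3603; 60; -5621; 20];
    [:: -26215; -114; -4241; 789; -6598; 1559];
    [:: -9651; 9; -1940; -1587; -2283; -9366];
    [:: -8449; 7293; 148; -118; 1193; -597];
    [:: -11009; -5397; -630; 122; -1972; 688];
    [:: -6461; 921; -251; -452; -358; -3773];
    [:: -8004; -219; -2991; 2281; -6182; 15802]],
   [::]);
  ([:: [:: -45; -1; -1; -2]; [:: -3; -33; -2; 5]; [:: -10; 0; -7; 1]; [:: 3; 1; 0; -5]], 1200,
   [:: [:: -12158; -1255; -608; 475; -1458; 2168];
    [:: -40036; 4444; 15039; -3210; 14139; -3843];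
    [:: -37877; -6348; 3685; 805; 4215; 1302];
    [:: -23453; -3225; -3276; -114; -5370; -368];
    [:: -23971; 574; -3773; 690; -6111; 1426];
    [:: -8782; -179; -2294; -1580; -2761; -9867];
    [:: -7333; 6281; 161; -94; 1222; -471];
    [:: -9680; -4428; -543; 79; -1911; 525];
    [:: -5217; 636; -201; -358; -372; -3474];
    [:: -5696; -64; -3616; 2413; -8890; 22364]],
   [::]);
  ([:: [:: -2; 0; 3; 3]; [:: 0; 4; 0; 35]; [:: 3; 0; 9; 0]; [:: 0; 1; 0; 0]], 1200,
   [:: [:: -2278; 3713; 6440; 8830; 7373; 7407];
    [:: -2780; -2979; -7430; 10517; -7289; 7527];
    [:: -11872; -1690; -311; -7573; 175; -1895];
    [:: -2166; -671; 65; -4328; -348; -6790];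
    [:: 565; 5775; 1824; 1356; 9412; 1885];
    [:: 1019; -6636; -2027; 1610; -8651; 448];
    [:: 6661; 26789; 3017; 227; 1917; 567];
    [:: 8168; -29029; -3378; 881; -1874; 270];
    [:: -3559; -1423; 635; -5084; -1685; -4642];
    [:: -4711; -67; -1127; -5821; 2078; -3882]],
   [::]);
  ([:: [:: -4; 0; 3; 4]; [:: -1; 9; 3; 39]; [:: 6; 0; 2; 2]; [:: -1; 0; 0; -2]], 1000,
   [:: [:: 107; -645; 5832; 1639; -7155; -33317];
    [:: 4566; 2411; 6454; -10312; -6249; 9691];
    [:: -20589; -355; -1230; -3732; 53; -871];
    [:: -278; -51; -1057; -378; 31; -16216];
    [:: 3653; 11995; 1211; 169; 3787; 636];
    [:: 3226; -9702; -1743; 648; -4108; 127];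
    [:: -6499; -2782; 858; -3090; -3249; -2363];
    [:: -5218; 4769; -3087; -689; 4472; -1103]],
   [:: [:: -3136; -4304; -8283; 3683; 1483; 4163; 2284; -1598; -6624; -2322; -292; -1638]]);
  ([:: [:: -45; -3; -1; 0]; [:: -6; -35; -1; 9]; [:: -8; -1; -7; 1]; [:: 3; 1; 0; -7]], 1200,
   [:: [:: -13734; -708; -714; 977; -958; 3761];
    [:: -45663; 6316; 10025; -1556; 8888; -1018];
    [:: -50321; -6235; 4677; 1083; 4327; 1525];
    [:: -36667; -5864; -5559; -735; -6137; -1589];
    [:: -36597; 3120; -7623; 1385; -8562; 1333];
    [:: -13371; -1200; -3354; -2461; -3131; -10736];
    [:: -8455; 9774; 272; -47; 1482; -16];
    [:: -8506; -7956; -373; -11; -1681; -61];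
    [:: -5774; -450; -118; -362; -388; -3212];
    [:: -7816; -330; -3383; 2727; -4756; 17468]],
   [::]);
  ([:: [:: -44; -2; -1; -1]; [:: 0; -19; -1; 7]; [:: -9; -1; -4; 1]; [:: 0; 1; 0; -4]], 1100,
   [:: [:: -22640; 3255; 5240; -961; 4545; -1493];
    [:: -27048; 170; 16301; -7735; 5126; -12470];
    [:: -24174; -2829; 2931; 1021; 2871; 2362];
    [:: -16716; -2720; -4448; -403; -5042; -1680];
    [:: -13268; -742; -660; 984; -1127; 3569];
    [:: -16107; -1504; -8223; -2700; -5917; -9162];
    [:: -4448; 5912; 246; -57; 1417; -229];
    [:: -4938; -4732; -523; 13; -1984; 140];
    [:: -2761; 258; -121; -173; -361; -2693];
    [:: -17431; -163; -2541; 884; -3298; 2203]],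
   [::]);
  ([:: [:: 11; 2; 0; 0]; [:: -1; -16; -2; 9]; [:: -7; 0; -3; 4]; [:: 0; 0; 2; -6]], 900,
   [:: [:: -8683; 1639; 2152; -199; 3689; -219];
    [:: 414; 114; 2157; -1152; 2474; -18150];
    [:: -11415; -986; 2337; 385; 3010; -702];
    [:: 8017; 403; 3162; 219; -6126; 981];
    [:: 1413; 293; 313; -460; -446; -2824];
    [:: -737; -99; 3078; 1601; -6585; -29023];
    [:: -4311; 8193; 159; -26; 898; -6];
    [:: 20; -5004; -111; 20; -1431; -7];
    [:: -2799; -598; -186; 226; -742; -680];
    [:: 9022; -715; 3136; -173; -5255; 436]],
   [::]);
  ([:: [:: -42; 0; -1; -1]; [:: 1; -19; 0; 6]; [:: -9; 2; -2; 1]; [:: 1; 0; 0; -4]], 700,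
   [:: [:: -22904; 2836; -15570; 2843; -8673; 3671];
    [:: -6860; 387; -12879; 5118; -9076; 22003];
    [:: -39822; -5448; 23261; 4153; 8017; 3079];
    [:: -25182; -3600; -12082; -1912; -6160; -2213];
    [:: -8837; 8; -730; 779; -927; 2646];
    [:: -6017; -312; -12151; -5278; -3689; -25712];
    [:: -1058; 3638; 60; -22; 776; -146];
    [:: -1573; -3263; -124; -10; -1048; 123];
    [:: -910; 361; -13; -58; -62; -1333];
    [:: -24023; 2850; -10343; 1918; -5593; 2368]],
   [::]);
  ([:: [:: 9; 1; 1; -1]; [:: -4; -15; -1; 10]; [:: -6; 0; -3; 2]; [:: 0; 0; 2; -7]], 800,
   [:: [:: -12571; -2760; 2355; 884; 2434; -707];
    [:: 514; 3; 2067; -1323; 2513; -14064];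
    [:: -6565; 3085; 1957; -469; 3489; 178];
    [:: 10100; -4075; 3254; -883; -3601; -308];
    [:: 1152; 257; 484; -598; 19; -2847];
    [:: -627; -118; 3195; 2361; -7970; -32207];
    [:: -3870; 6906; 298; -85; 991; -68];
    [:: 468; -6713; 1; -82; -1188; 105];
    [:: -3537; 784; -73; 237; -144; -648];
    [:: 6118; 1552; 3314; 1146; -7698; 1887]],
   [::]);
  ([:: [:: 9; -1; 2; 0]; [:: -3; -17; -3; 5]; [:: -4; -1; -2; 0]; [:: 0; 0; 2; -7]], 800,
   [:: [:: -14870; -6947; 2817; 1192; 2843; -512];
    [:: 771; -280; 2141; -1797; 1338; -17345];
    [:: -7359; 3695; 2132; -1136; 4085; 1169];
    [:: 9036; -4390; 2765; -1472; -3757; -1276];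
    [:: 1844; -446; 389; -910; -96; -3028];
    [:: -429; -101; 3321; 2251; -6749; -34614];
    [:: -2766; 6298; 73; -186; 918; 42];
    [:: 1008; -6242; -39; -184; -916; -14];
    [:: -1305; 50; -49; -54; -14; -712];
    [:: 6274; 3015; 3327; 1405; -8410; 1392]],
   [::])].

End Certificates.

(** * Conclusion *)

Section Conclusion.

Definition sufficient (nt np nm : nat) : bool :=
  let nR := (nt + np + nm)%N in
  admissible nt np nm && [|| nR \in [:: 0; 2; 4; 6]%N, (nR == 8%N) && (nt != 1%N)
    | (nR == 10%N) && (nt \in [:: 5; 6; 7; 8; 9; 10]%N)].

Definition covers (ks : seq (nat * nat * nat)) : bool :=
  all (fun nt => all (fun np => all (fun nm => sufficient nt np nm ==> ((nt, np, nm) \in ks))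
    (iota 0 11)) (iota 0 11)) (iota 0 11).

Lemma certificates_check : all check certificates.
Proof. by vm_cast_no_check (erefl true). Qed.

Lemma certificates_cover : covers (map kinds certificates).
Proof. by vm_cast_no_check (erefl true). Qed.

End Conclusion.

Theorem theorem1p7 (R : realType) (nt np nm : nat)
  (hadm : admissible nt np nm)
  (hcases : let nR := (nt + np + nm)%N in
     nR \in [:: 0; 2; 4; 6]%N \/
     (nR = 8%N /\ nt <> 1%N) \/
     (nR = 10%N /\ nt \in [:: 5; 6; 7; 8; 9; 10]%N)) :
  exists C1 C2 : set (proj_point R),
    [/\ is_twisted_cubic C1, real_locus C1,
        is_twisted_cubic C2, real_locus C2 &
        realize C1 C2 nt np nm].
Proof.
have [nt10 np10 nm10] : [/\ nt < 11, np < 11 & nm < 11]%N by case/and5P: hadm.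
have suff_n : sufficient nt np nm.
  rewrite /sufficient hadm /=; case: hcases => [-> //|[[-> /eqP ->]|[-> ->]]];
    by rewrite eqxx /= ?orbT.
have : (nt, np, nm) \in map kinds certificates.
  have /allP/(_ nt) := certificates_cover; rewrite mem_iota => /(_ nt10).
  move=> /allP/(_ np); rewrite mem_iota => /(_ np10).
  by move=> /allP/(_ nm); rewrite mem_iota => /(_ nm10) /implyP; apply.
case/mapP => c /(allP certificates_check) /(check_sound R) sound kc.
by move: sound; rewrite -kc.
Qed.
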